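(* Fix $a>0$ and let $b\to+\infty$ through real values. Let $\mathcal{A}=\{\xi=x+iy\in\mathbb{C}:\ x<1 \text{ or } x-1-\tfrac12\log(x^2+y^2)<0\}$ and $\mathcal{B}=\{\xi=x+iy\in\mathbb{C}:\ x>1 \text{ and } x-1-\tfrac12\log(x^2+y^2)>0\}$. (a) For $\xi\in\mathcal{A}$, writing $w=\xi/(1-\xi)$, $$ {}_1F_1(a;b;b\xi)=(1-\xi)^{-a}\Big\{1-\frac{a(a+1)}{2}w^2\,b^{-1}+\Big[\frac{a(a+1)(a+2)(a+3)}{8}w^4+\frac{2a(a+1)(a+2)}{3}w^3+\frac{a(a+1)}{2}w^2\Big]b^{-2}+O(b^{-3})\Big\}, $$ uniformly for $\xi$ in compact subsets of $\mathcal{A}$, where $(1-\xi)^{-a}$ is the principal branch (i.e. $\arg(1-\xi)=0$ for real $\xi<1$). (b) For $\xi\in\mathcal{B}$, $$ {}_1F_1(a;b;b\xi)=e^{b(\xi-1-\log\xi)}\,b^{a-\frac12}\,\frac{\sqrt{2\pi}}{\Gamma(a)}\,\xi(\xi-1)^{a-1}\Big[1+\frac{1}{12b}\Big(1+\frac{12a(a-1)}{\xi-1}+\frac{6(a-1)(a-2)}{(\xi-1)^2}\Big)+O(b^{-2})\Big], $$ uniformly for $\xi$ in compact subsets of $\mathcal{B}$, where $\log\xi$ and $(\xi-1)^{a-1}$ are principal branches (i.e. $\arg\xi=\arg(\xi-1)=0$ for real $\xi>1$).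
   Context: ${}_1F_1(a;b;z)=\sum_{k=0}^\infty \frac{(a)_k}{(b)_k}\frac{z^k}{k!}$ is Kummer's confluent hypergeometric function, with $(x)_k=\Gamma(x+k)/\Gamma(x)$. *)

(* Defs.v *)
From HB Require Import structures.
From mathcomp Require Import all_boot all_order all_algebra.
From mathcomp Require Import all_classical all_reals all_analysis.
From mathcomp Require Import complex.
Set Implicit Arguments. Unset Strict Implicit. Unset Printing Implicit Defensive.
Import Order.TTheory GRing.Theory Num.Theory numFieldNormedType.Exports.
Local Open Scope classical_set_scope.
Local Open Scope ring_scope.
Local Open Scope complex_scope.

(* The complex plane over a real type R, with its numClosedField structure
   (hence the usual Euclidean norm topology from MathComp-Analysis). *)
Definition Cplx (R : realType) : numClosedFieldType := R[i].

Section ComplexFunctions.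
Variable R : realType.
Local Notation C := (Cplx R).

Definition cre (z : C) : R := complex.Re (z : R[i]).
Definition cim (z : C) : R := complex.Im (z : R[i]).
Definition cmod (z : C) : R := Num.sqrt (cre z ^+ 2 + cim z ^+ 2).
Definition cofR (x : R) : C := (x%:C : R[i]).

Definition cexp (z : C) : C :=
  ((expR (cre z) * cos (cim z)) +i* (expR (cre z) * sin (cim z)) : R[i]).

(* principal argument, in (-pi, pi]; arg 0 := 0 (irrelevant convention) *)
Definition carg (z : C) : R :=
  if z == 0 then 0
  else if 0 <= cim z then acos (cre z / cmod z) else - acos (cre z / cmod z).

Definition clog (z : C) : C := ((ln (cmod z)) +i* (carg z) : R[i]).

Definition cpow (z c : C) : C := cexp (c * clog z).

End ComplexFunctions.

Definition poch (R : realType) (x : R) (k : nat) : R := \prod_(j < k) (x + j%:R).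

Definition Gamma (R : realType) (a : R) : R :=
  (\int[@lebesgue_measure R]_(t in `[0%R, +oo[) (t `^ (a - 1) * expR (- t)))%R.

Definition F11 (R : realType) (a b : R) (z : Cplx R) : Cplx R :=
  limn (fun n : nat => \sum_(k < n)
          (cofR (poch a k / (poch b k * (k`!)%:R)) * z ^+ k)).

Definition regA (R : realType) : set (Cplx R) :=
  [set xi | cre xi < 1 \/
            cre xi - 1 - 2^-1 * ln (cre xi ^+ 2 + cim xi ^+ 2) < 0].
Definition regB (R : realType) : set (Cplx R) :=
  [set xi | 1 < cre xi /\
            0 < cre xi - 1 - 2^-1 * ln (cre xi ^+ 2 + cim xi ^+ 2)].

(* Main.v *)
Require Import Defs.
From HB Require Import structures.
From mathcomp Require Import all_boot all_order all_algebra.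
From mathcomp Require Import all_classical all_reals all_analysis.
From mathcomp Require Import complex measurable_realfun.
From mathcomp Require Import ring lra.
Set Implicit Arguments. Unset Strict Implicit. Unset Printing Implicit Defensive.
Import Order.TTheory GRing.Theory Num.Theory numFieldNormedType.Exports.
Local Open Scope classical_set_scope.
Local Open Scope ring_scope.

(** The function [f z = 1F1(a; b; b z)] solves [z f'' + b (1 - z) f' - a b f = 0].  In region A
    the truncated expansion solves this equation up to a residual [O(b^-2)]; the difference [e]
    is controlled by the Lyapunov function [|e|^2 + (om / b) |e'|^2] along paths [s] on which
    [Re s' (1 - s) / s] is bounded below: a segment from 0, followed by a curve along which
    [Re s] and [ln |s|] are affine.  In region B the quotient of [f] by [exp (b z) z^(1 - b)]
    solves an equation damped in the opposite direction, and the same method applies to paths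
    that leave a real point [x0 > 1] close to 1.  At [x0] the quotient [G] of this function by
    its approximant is found from infinity: [G' / G] solves a Riccati equation with a strong
    restoring term, so that [G] is constant on [[x0, +oo[] up to a factor [1 + O(b^-2)].  Its
    limit is computed from [Gamma (a + k) / Gamma (b + k) ~ k^(a - b)] by averaging over a
    Poisson distribution, and then expanded by Stirling's formula. *)

(** * Complex arithmetic and calculus along paths *)

(** The path condition explains the regions: Re (s' (1 - s) / s) is the derivative of ln |s| - Re s.
    Without damping a Gronwall bound would lose a factor exponential in b, so ln |s| - Re s has to
    increase along every path in A and to decrease along every path in B. At the saddle z = 1 this
    function equals -1, and that level separates A from B. At z = 0 it tends to minus infinity;
    there the weight [om] may vanish with the path parameter, so that the common value 1 of f and
    its approximant starts the estimate. No point of B offers such data, and the constant Gamma(b) /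
    Gamma(a) has to be carried in from infinity.

    Orders: damping of order b turns a residual eps into an error eps / b. In A, terms kept through
    b^-2 leave a residual b^-2 and an error b^-3; in B, terms kept through b^-1 leave a residual
    b^-1 and an error b^-2. The summand 1/12 in (b) does not come from the differential equation: it
    is the first correction in Stirling's formula for Gamma(b). *)

Section ComplexBasics.
Variable R : realType.
Local Notation C := (Cplx R).
Implicit Types (z w : C) (x : R).

Lemma cofR_is_zmod_morphism : zmod_morphism (@cofR R).
Proof. by move=> x y; apply/eqP; rewrite eq_complex /= oppr0 addr0 !eqxx. Qed.

Lemma cofR_is_monoid_morphism : monoid_morphism (@cofR R).
Proof.
split => // x y; apply/eqP; rewrite eq_complex /= !mul0r !mulr0 subr0 addr0.
by rewrite !eqxx.
Qed.

HB.instance Definition _ := GRing.isZmodMorphism.Build R C (@cofR R) cofR_is_zmod_morphism.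
HB.instance Definition _ := GRing.isMonoidMorphism.Build R C (@cofR R) cofR_is_monoid_morphism.

Lemma creD z w : cre (z + w) = cre z + cre w. Proof. by case: z; case: w. Qed.
Lemma cimD z w : cim (z + w) = cim z + cim w. Proof. by case: z; case: w. Qed.
Lemma creN z : cre (- z) = - cre z. Proof. by case: z. Qed.
Lemma cimN z : cim (- z) = - cim z. Proof. by case: z. Qed.
Lemma creM z w : cre (z * w) = cre z * cre w - cim z * cim w.
Proof. by case: z; case: w. Qed.
Lemma cimM z w : cim (z * w) = cre z * cim w + cim z * cre w.
Proof. by case: z; case: w. Qed.
Lemma cre1 : cre (1 : C) = 1. Proof. by []. Qed.
Lemma cim1 : cim (1 : C) = 0. Proof. by []. Qed.
Lemma cre0 : cre (0 : C) = 0. Proof. by []. Qed.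
Lemma cim0 : cim (0 : C) = 0. Proof. by []. Qed.
Lemma cre_cofR x : cre (cofR x) = x. Proof. by []. Qed.
Lemma cim_cofR x : cim (cofR x) = 0. Proof. by []. Qed.
Lemma ceq z w : cre z = cre w -> cim z = cim w -> z = w.
Proof. by case: z; case: w => a b c d /= -> ->. Qed.

Definition cE := (creD, cimD, creN, cimN, creM, cimM, cre1, cim1, cre0, cim0,
  cre_cofR, cim_cofR).

Lemma normE z : `|z| = cofR (cmod z).
Proof. by rewrite [LHS]normc_def. Qed.

Lemma ler_cofR : {mono (@cofR R) : x y / x <= y}.
Proof. by move=> x y; rewrite [LHS]lecR. Qed.

Lemma cofR_inj : injective (@cofR R). Proof. by move=> x y []. Qed.

Lemma ltr_cofR : {mono (@cofR R) : x y / x < y}.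
Proof. by move=> x y; rewrite !lt_neqAle ler_cofR (inj_eq cofR_inj). Qed.

Lemma cmodM z w : cmod (z * w) = cmod z * cmod w.
Proof. by apply: cofR_inj; rewrite rmorphM /= -!normE normrM. Qed.
Lemma cmodV z : cmod (z^-1) = (cmod z)^-1.
Proof. by apply: cofR_inj; rewrite fmorphV /= -!normE normfV. Qed.
Lemma cmodX z n : cmod (z ^+ n) = cmod z ^+ n.
Proof. by apply: cofR_inj; rewrite rmorphXn /= -!normE normrX. Qed.
Lemma cmodD z w : cmod (z + w) <= cmod z + cmod w.
Proof. by rewrite -ler_cofR rmorphD /= -!normE ler_normD. Qed.
Lemma cmodN z : cmod (- z) = cmod z.
Proof. by apply: cofR_inj; rewrite -!normE normrN. Qed.
Lemma cmodB z w : cmod (z - w) <= cmod z + cmod w.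
Proof. by rewrite -(cmodN w) cmodD. Qed.
Lemma cmod_ge0 z : 0 <= cmod z. Proof. exact: sqrtr_ge0. Qed.
Lemma cmod_cofR x : cmod (cofR x) = `|x|.
Proof. by rewrite /cmod !cE expr0n addr0 sqrtr_sqr. Qed.
Lemma cmod_eq0 z : (cmod z == 0) = (z == 0).
Proof. by rewrite -(inj_eq cofR_inj) -normE rmorph0 normr_eq0. Qed.
Lemma cmod_gt0 z : (0 < cmod z) = (z != 0).
Proof. by rewrite lt_def cmod_eq0 cmod_ge0 andbT. Qed.
Lemma sqr_cmod z : cmod z ^+ 2 = cre z ^+ 2 + cim z ^+ 2.
Proof. by rewrite sqr_sqrtr // addr_ge0 ?sqr_ge0. Qed.
Lemma normr_cre_le z : `|cre z| <= cmod z.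
Proof. by rewrite -sqrtr_sqr ler_sqrt ?addr_ge0 ?sqr_ge0// lerDl sqr_ge0. Qed.
Lemma normr_cim_le z : `|cim z| <= cmod z.
Proof. by rewrite -sqrtr_sqr ler_sqrt ?addr_ge0 ?sqr_ge0// lerDr sqr_ge0. Qed.
Lemma cmod_le z : cmod z <= `|cre z| + `|cim z|.
Proof.
rewrite -(ler_pXn2r (n:=2)) ?nnegrE ?cmod_ge0 ?addr_ge0//.
by rewrite sqr_cmod sqrrD !real_normK ?num_real// lerD2r lerDl mulrn_wge0// mulr_ge0.
Qed.
Lemma cofR_eq0 x : (cofR x == 0) = (x == 0).
Proof. by rewrite fmorph_eq0. Qed.
End ComplexBasics.

(** * Derivatives of real functions, monotonicity and Gronwall's inequality *)

Section RealDerivative.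
Variable R : realType.
Implicit Types (f g : R -> R) (t d : R).

Definition rder f t d := is_derive t (1 : R) f d.

Lemma rder_eq {f t d' d} : rder f t d' -> d' = d -> rder f t d.
Proof. by move=> h <-. Qed.

Lemma rder_ext {f g t d} : rder f t d -> f =1 g -> rder g t d.
Proof. by move=> h /funext <-. Qed.

Lemma rder_near {f g t d} : rder f t d -> (\near t, f t = g t) -> rder g t d.
Proof. by move=> h fg; apply: near_eq_is_derive fg h. Qed.

Lemma rder_cst (k t : R) : rder (fun=> k) t 0.
Proof. exact: is_derive_cst. Qed.
Lemma rder_id t : rder (fun u => u) t 1.
Proof. exact: is_derive_id. Qed.
Lemma rderD {f g t df dg} : rder f t df -> rder g t dg ->
  rder (fun u => f u + g u) t (df + dg).
Proof. by move=> h1 h2; exact: is_deriveD. Qed.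
Lemma rderN {f t df} : rder f t df -> rder (fun u => - f u) t (- df).
Proof. by move=> h1; exact: is_deriveN. Qed.
Lemma rderB {f g t df dg} : rder f t df -> rder g t dg ->
  rder (fun u => f u - g u) t (df - dg).
Proof. by move=> h1 h2; exact: is_deriveB. Qed.
Lemma rderM {f g t df dg} : rder f t df -> rder g t dg ->
  rder (fun u => f u * g u) t (df * g t + f t * dg).
Proof.
move=> h1 h2; apply: (is_derive_eq (is_deriveM h1 h2)).
by rewrite /GRing.scale/= addrC mulrC.
Qed.
Lemma rderX {f t df} n : rder f t df ->
  rder (fun u => f u ^+ n) t (n%:R * f t ^+ n.-1 * df).
Proof.
move=> h1; case: n => [|n].
  by rewrite !mul0r; apply: rder_ext; first exact: (rder_cst 1).
have -> : (fun u => f u ^+ n.+1) = f ^+ n.+1 by apply/funext => u; rewrite exprfctE.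
apply: (is_derive_eq (is_deriveX n.+1 h1)).
by rewrite /GRing.scale/= mulr_natl.
Qed.
Lemma rder_comp {f g t df dg} : rder f (g t) df -> rder g t dg ->
  rder (fun u => f (g u)) t (df * dg).
Proof. by move=> h1 h2; exact: is_derive1_comp. Qed.
Lemma rderV {f t df} : rder f t df -> f t != 0 ->
  rder (fun u => (f u)^-1) t (- df / f t ^+ 2).
Proof.
move=> h1 h2; apply: (is_derive_eq (is_deriveV h2 h1)).
by rewrite /GRing.scale/= mulNr mulNr mulrC.
Qed.
Lemma rder_exp {f t df} : rder f t df -> rder (fun u => expR (f u)) t (df * expR (f t)).
Proof. by move=> h; rewrite mulrC; apply: (rder_comp (f := expR)) h; exact: is_derive_expR. Qed.
Lemma rder_ln {f t df} : rder f t df -> 0 < f t -> rder (fun u => ln (f u)) t (df / f t).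
Proof. by move=> h h0; rewrite mulrC; apply: (rder_comp (f := @ln R)) h; exact: is_derive1_ln. Qed.
Lemma rder_sqrt {f t df} : rder f t df -> 0 < f t ->
  rder (fun u => Num.sqrt (f u)) t (df / (2 * Num.sqrt (f t))).
Proof.
by move=> h h0; rewrite mulrC; apply: (rder_comp (f := @Num.sqrt R)) h; exact: is_derive1_sqrt.
Qed.
Lemma rder_cos {f t df} : rder f t df -> rder (fun u => cos (f u)) t (- (df * sin (f t))).
Proof. by move=> h; rewrite -mulNr mulrC mulrN -mulNr; apply: (rder_comp (f := @cos R)) h; exact: is_derive_cos. Qed.
Lemma rder_sin {f t df} : rder f t df -> rder (fun u => sin (f u)) t (df * cos (f t)).
Proof. by move=> h; rewrite mulrC; apply: (rder_comp (f := @sin R)) h; exact: is_derive_sin. Qed.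
Lemma rder_atan {f t df} : rder f t df -> rder (fun u => atan (f u)) t (df / (1 + f t ^+ 2)).
Proof. by move=> h; rewrite mulrC; apply: (rder_comp (f := @atan R)) h; exact: is_derive1_atan. Qed.

Lemma rder_cont {f t d} : rder f t d -> {for t, continuous f}.
Proof.
by move=> [h _]; apply/differentiable_continuous/derivable1_diffP.
Qed.

Lemma rder_within f df a b : (forall t, a <= t <= b -> rder f t (df t)) ->
  {within `[a, b], continuous f}.
Proof.
move=> h; apply: continuous_in_subspaceT => x.
by rewrite inE /= in_itv /= => /h /rder_cont.
Qed.

Lemma rder_le0_nincr f df a b : a <= b ->
  (forall t, a <= t <= b -> rder f t (df t)) ->
  (forall t, a <= t <= b -> df t <= 0) -> f b <= f a.
Proof.
move=> ab h h0.
have h' x : x \in `]a, b[ -> is_derive x 1 f (df x).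
  by rewrite in_itv /= => /andP[xa xb]; apply: h; rewrite !ltW.
have [c] := MVT_segment ab h' (rder_within h).
rewrite in_itv /= => cab fab.
by rewrite -subr_le0 fab mulr_le0_ge0 ?h0// subr_ge0.
Qed.

Lemma rder_ge0_ndecr f df a b : a <= b ->
  (forall t, a <= t <= b -> rder f t (df t)) ->
  (forall t, a <= t <= b -> 0 <= df t) -> f a <= f b.
Proof.
move=> ab h h0; rewrite -lerN2.
apply: (rder_le0_nincr (f := fun u => - f u) (df := fun u => - df u) ab) => t tab.
  exact/rderN/h.
by rewrite oppr_le0 h0.
Qed.

(** In Carathéodory's form, the slope function of [f], given the value 0 at [t], is dominated by
    that of [g]. This turns a quadratic remainder bound into a derivative. *)
Lemma rder_squeeze f g t : rder g t 0 -> g t = 0 ->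
  (\near t, `|f t| <= g t) -> rder f t 0.
Proof.
move=> /is_derive1_caratheodory[h [hE hC ht]] gt fg.
have ft : f t = 0 by apply/normr0_eq0/le_anti; rewrite normr_ge0 andbT -gt; apply: nbhs_singleton fg.
apply/is_derive1_caratheodory.
exists (fun z => if z == t then 0 else f z / (z - t)); split.
- move=> z; rewrite ft subr0; case: eqP => [->|/eqP zt]; first by rewrite mul0r.
  by rewrite divfK// subr_eq0.
- apply/cvgrPdist_le => e e0; rewrite eqxx.
  have /cvgrPdist_le/(_ e e0) := hC; rewrite ht => hC'.
  near=> z; rewrite sub0r normrN; case: eqP => [_|/eqP zt]; first by rewrite normr0 ltW.
  have : `|0 - h z| <= e by near: z.
  rewrite sub0r normrN; apply: le_trans.
  rewrite normrM normfV ler_pdivrMr ?normr_gt0 ?subr_eq0//.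
  rewrite -normrM -hE gt subr0; apply: le_trans (ler_norm _); near: z.
  exact: fg.
- by rewrite eqxx.
Unshelve. all: by end_near. Qed.

(** The function [(V + e) exp (- K (u - a))] is nonincreasing; the shift by [e] treats a constant
    forcing term as additional initial data. *)
Lemma gronwall (V dV : R -> R) (a b K e : R) : a <= b ->
  (forall t, a <= t <= b -> rder V t (dV t)) ->
  (forall t, a <= t <= b -> dV t <= K * (V t + e)) ->
  V b + e <= (V a + e) * expR (K * (b - a)).
Proof.
move=> ab h h0.
have := rder_le0_nincr (f := fun u => (V u + e) * expR (- K * (u - a)))
  (df := fun u => dV u * expR (- K * (u - a)) + (V u + e) * (- K * expR (- K * (u - a)))) ab.
rewrite subrr mulr0 expR0 mulr1 => H.
rewrite -ler_pdivrMr ?expR_gt0// -expRN -mulNr; apply: H => t tab.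
  apply: rder_eq.
    apply: rderM; first by apply: rderD; [exact: h|exact: rder_cst].
    apply: rder_exp; apply: rderM; first exact: rder_cst.
    apply: rderB; [exact: rder_id|exact: rder_cst].
  by rewrite /=; ring.
have E : 0 <= expR (- K * (t - a)) by rewrite ltW ?expR_gt0.
have := h0 _ tab; nra.
Qed.

End RealDerivative.

(** * Complex differentiability tested along real paths *)

Section PathDerivative.
Variable R : realType.
Local Notation C := (Cplx R).
Implicit Types (f g s : R -> C) (t : R) (d : C) (F G : C -> C).

Definition cder f t d := rder (fun u => cre (f u)) t (cre d) /\
                         rder (fun u => cim (f u)) t (cim d).

Lemma cder_eq {f t d' d} : cder f t d' -> d' = d -> cder f t d.
Proof. by move=> h <-. Qed.
Lemma cder_ext {f g t d} : cder f t d -> f =1 g -> cder g t d.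
Proof. by move=> h /funext <-. Qed.
Lemma cder_near {f g t d} : cder f t d -> (\near t, f t = g t) -> cder g t d.
Proof.
move=> [h1 h2] h; split; [apply: rder_near h1 _|apply: rder_near h2 _].
  by near=> u; congr cre; near: u.
by near=> u; congr cim; near: u.
Unshelve. all: by end_near. Qed.
Lemma cder_cst d t : cder (fun=> d) t 0.
Proof. by split; rewrite ?cE; exact: rder_cst. Qed.
Lemma cder_cofR {f : R -> R} {t} {d : R} : rder f t d -> cder (fun u => cofR (f u)) t (cofR d).
Proof. by move=> h; split => //; exact: rder_cst. Qed.
Lemma cder_mk {f g : R -> R} {t df dg} : rder f t df -> rder g t dg ->
  cder (fun u => (Complex (f u) (g u) : C)) t (Complex df dg).
Proof. by []. Qed.
Lemma cderD {f g t df dg} : cder f t df -> cder g t dg ->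
  cder (fun u => f u + g u) t (df + dg).
Proof.
move=> [f1 f2] [g1 g2]; split; rewrite !cE.
  by apply: (rder_ext (rderD f1 g1)) => u; rewrite cE.
by apply: (rder_ext (rderD f2 g2)) => u; rewrite cE.
Qed.
Lemma cderN {f t df} : cder f t df -> cder (fun u => - f u) t (- df).
Proof.
move=> [f1 f2]; split; rewrite !cE.
  by apply: (rder_ext (rderN f1)) => u; rewrite cE.
by apply: (rder_ext (rderN f2)) => u; rewrite cE.
Qed.
Lemma cderB {f g t df dg} : cder f t df -> cder g t dg ->
  cder (fun u => f u - g u) t (df - dg).
Proof. by move=> hf hg; apply: cderD => //; exact: cderN. Qed.
Lemma cderM {f g t df dg} : cder f t df -> cder g t dg ->
  cder (fun u => f u * g u) t (df * g t + f t * dg).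
Proof.
move=> [f1 f2] [g1 g2]; split.
  refine (rder_ext (rder_eq (rderB (rderM f1 g1) (rderM f2 g2)) _) _); first by rewrite !cE; ring.
  by move=> u; rewrite cE.
refine (rder_ext (rder_eq (rderD (rderM f1 g2) (rderM f2 g1)) _) _); first by rewrite !cE; ring.
by move=> u; rewrite cE.
Qed.

Lemma cder_sqr_cmod {f t df} : cder f t df ->
  rder (fun u => cmod (f u) ^+ 2) t (2 * cre ((f t)^*%C * df : C)).
Proof.
move=> [f1 f2]; refine (rder_ext (rder_eq (rderD (rderX 2 f1) (rderX 2 f2)) _) _).
  have -> : cre ((f t)^*%C * df : C) = cre (f t) * cre df + cim (f t) * cim df.
    by rewrite creM; case: (f t) => x y; rewrite /cre /cim/=; ring.
  by rewrite /=; ring.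
by move=> u; rewrite sqr_cmod.
Qed.

(** Complex differentiability is encoded as the chain rule along differentiable real paths, the only
    form in which it is used: every estimate follows a path. Products and compositions then reduce
    to real calculus of the two components. *)
Definition cdiff F z d := forall s t (s' : C), s t = z -> cder s t s' ->
  cder (fun u => F (s u)) t (d * s').

Lemma cdiff_eq {F z d' d} : cdiff F z d' -> d' = d -> cdiff F z d.
Proof. by move=> h <-. Qed.
Lemma cdiff_cst d z : cdiff (fun=> d) z 0.
Proof. by move=> s t s' _ _; rewrite mul0r; exact: cder_cst. Qed.
Lemma cdiff_id z : cdiff (fun w => w) z 1.
Proof. by move=> s t s' _ hs; rewrite mul1r. Qed.
Lemma cdiffD {F G z dF dG} : cdiff F z dF -> cdiff G z dG ->
  cdiff (fun w => F w + G w) z (dF + dG).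
Proof. by move=> hF hG s t s' st hs; rewrite mulrDl; apply: cderD; [exact: hF|exact: hG]. Qed.
Lemma cdiffN {F z dF} : cdiff F z dF -> cdiff (fun w => - F w) z (- dF).
Proof. by move=> hF s t s' st hs; rewrite mulNr; apply: cderN; exact: hF. Qed.
Lemma cdiffB {F G z dF dG} : cdiff F z dF -> cdiff G z dG ->
  cdiff (fun w => F w - G w) z (dF - dG).
Proof. by move=> hF hG; apply: cdiffD => //; exact: cdiffN. Qed.
Lemma cdiffM {F G z dF dG} : cdiff F z dF -> cdiff G z dG ->
  cdiff (fun w => F w * G w) z (dF * G z + F z * dG).
Proof.
move=> hF hG s t s' st hs; apply: cder_eq.
  by apply: cderM; [exact: (hF _ _ _ st hs)|exact: (hG _ _ _ st hs)].
by rewrite /= st; ring.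
Qed.
Lemma cdiff_comp {F G z dF dG} : cdiff F (G z) dF -> cdiff G z dG ->
  cdiff (fun w => F (G w)) z (dF * dG).
Proof.
move=> hF hG s t s' st hs; rewrite -mulrA; apply: (hF (fun u => G (s u))).
  by rewrite st.
exact: hG.
Qed.

Lemma cdiffV z : z != 0 -> cdiff (fun w => w^-1) z (- (z^-1) ^+ 2).
Proof.
move=> z0 s t s' st [s1 s2].
have n0 : cre (s t) ^+ 2 + cim (s t) ^+ 2 != 0 by rewrite -sqr_cmod sqrf_eq0 cmod_eq0 st.
have invE (w : C) : w^-1 = Complex (cre w / (cre w ^+ 2 + cim w ^+ 2))
                            (- (cim w / (cre w ^+ 2 + cim w ^+ 2))).
  by case: w => x y.
have dn := rderD (rderX 2 s1) (rderX 2 s2).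
have dnV := rderV dn n0.
refine (cder_ext (cder_eq (cder_mk (rderM s1 dnV) (rderN (rderM s2 dnV))) _) _); last first.
  by move=> u; rewrite invE.
move: n0; rewrite -st invE; case: (s t) => x y; case: (s') => p q.
by rewrite /cre /cim /= => n0; apply: ceq; rewrite !cE /cre /cim /=; field.
Qed.

End PathDerivative.
Arguments cdiff_cst {R} d z.
Arguments cdiff_id {R} z.
Arguments cdiffV {R z} _.
Arguments cdiff_comp {R F G z dF dG} _ _.
Arguments cdiff_eq {R F z d' d} _ _.
Arguments cdiffM {R F G z dF dG} _ _.
Arguments cdiffD {R F G z dF dG} _ _.
Arguments cdiffB {R F G z dF dG} _ _.
Arguments cdiffN {R F z dF} _.

(** * Complex exponential, principal logarithm and powers *)

Section ComplexExpLog.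
Variable R : realType.
Local Notation C := (Cplx R).
Implicit Types (z w : C) (x : R).

Lemma cexpD z w : cexp (z + w) = cexp z * cexp w.
Proof.
apply: ceq; rewrite !cE /cexp /cre /cim /= -/(cre _) -/(cim _) !cE expRD.
  by rewrite cosD; ring.
by rewrite sinD; ring.
Qed.

Lemma cmod_cexp z : cmod (cexp z) = expR (cre z).
Proof.
rewrite /cmod /cexp /cre /cim /= !exprMn -mulrDr cos2Dsin2 mulr1 sqrtr_sqr.
by rewrite ger0_norm// expR_ge0.
Qed.

Lemma cexp_neq0 z : cexp z != 0.
Proof. by rewrite -cmod_eq0 cmod_cexp expR_eq0. Qed.

Lemma cexp_cofR x : cexp (cofR x) = cofR (expR x).
Proof. by apply: ceq; rewrite /cexp /cre /cim /= ?cos0 ?sin0 ?mulr1 ?mulr0. Qed.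

Lemma cdiff_cexp z : cdiff (@cexp R) z (cexp z).
Proof.
move=> s t s' <- [s1 s2]; split.
- refine (rder_eq (rderM (rder_exp s1) (rder_cos s2)) _).
  by rewrite cE /cexp /cre /cim /=; ring.
- refine (rder_eq (rderM (rder_exp s1) (rder_sin s2)) _).
  by rewrite cE /cexp /cre /cim /=; ring.
Qed.

Lemma cos_sin_carg z : z != 0 ->
  cos (carg z) = cre z / cmod z /\ sin (carg z) = cim z / cmod z.
Proof.
move=> z0; have n0 : 0 < cmod z by rewrite cmod_gt0.
have xn : -1 <= cre z / cmod z <= 1.
  rewrite -ler_norml normrM normfV (gtr0_norm n0) ler_pdivrMr// mul1r.
  exact: normr_cre_le.
have sE : Num.sqrt (1 - (cre z / cmod z) ^+ 2) = `|cim z| / cmod z.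
  have -> : 1 - (cre z / cmod z) ^+ 2 = (cim z / cmod z) ^+ 2.
    have := sqr_cmod z; move: (cre z) (cim z) (cmod z) n0 => x y n n0 h.
    have hy : y ^+ 2 = n ^+ 2 - x ^+ 2 by rewrite h; ring.
    by rewrite !exprMn hy; field; rewrite gt_eqF.
  by rewrite sqrtr_sqr normrM normfV (gtr0_norm n0).
rewrite /carg (negbTE z0); case: ifPn => [y0|]; last rewrite -ltNge => y0.
  by rewrite acosK ?in_itv//= sin_acos// sE ger0_norm.
by rewrite cosN sinN acosK ?in_itv//= sin_acos// sE ltr0_norm// mulNr opprK.
Qed.

Lemma clogK z : z != 0 -> cexp (clog z) = z.
Proof.
move=> z0; have [h1 h2] := cos_sin_carg z0.
have n0 : 0 < cmod z by rewrite cmod_gt0.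
apply: ceq; rewrite /cexp /clog /cre /cim /= ?h1 ?h2 lnK ?posrE//;
  rewrite -/(cre z) -/(cim z) mulrC divfK// gt_eqF//.
Qed.

(** The plane cut along the nonpositive real axis, written as positivity of the denominator in the
    half-angle formula for the argument. *)
Definition slit z := 0 < cmod z + cre z.

Lemma slit_neq0 z : slit z -> z != 0.
Proof.
rewrite /slit; apply: contraTN => /eqP ->.
have /eqP -> : cmod (0 : C) == 0 by rewrite cmod_eq0.
by rewrite cre0 addr0 ltxx.
Qed.

Lemma slit_cre z : 0 < cre z -> slit z.
Proof. by move=> h; rewrite /slit ltr_wpDl// cmod_ge0. Qed.

Lemma slit_cim z : cim z != 0 -> slit z.
Proof.
move=> h; rewrite /slit -ltrBlDr sub0r.
apply: (@le_lt_trans _ _ `|cre z|); first by rewrite lerNl lerNnormlW.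
rewrite -(ltr_pXn2r (n:=2)) ?nnegrE ?cmod_ge0 ?normr_ge0//.
by rewrite sqr_cmod real_normK ?num_real// ltrDl lt_def sqr_ge0 sqrf_eq0 h.
Qed.

(** Half-angle formula: tan (arg z / 2) = Im z / (|z| + Re z). Unlike the definition by cases
    through [acos], it is one differentiable expression on the whole slit plane. *)
Lemma carg_atan z : slit z -> carg z = 2 * atan (cim z / (cmod z + cre z)).
Proof.
move=> hz; have z0 := slit_neq0 hz.
have n0 : 0 < cmod z by rewrite cmod_gt0.
set u := cim z / _; set th := 2 * atan u.
have cth : cos th = cre z / cmod z.
  have h := cmod_gt0 z; rewrite /th mulr_natl cos_mulr2n cos_atan exprVn sqr_sqrtr; last first.
    by rewrite addr_ge0// sqr_ge0.
  have -> : 1 + u ^+ 2 = 2 * cmod z / (cmod z + cre z).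
    rewrite /u; have := sqr_cmod z; move: hz n0; rewrite /slit.
    move: (cre z) (cim z) (cmod z) => x y n hz n0 h2.
    have hy : y ^+ 2 = n ^+ 2 - x ^+ 2 by rewrite h2; ring.
    by rewrite exprMn hy; field; rewrite gt_eqF.
  move: hz n0; rewrite /slit; move: (cre z) (cmod z) => x n hz n0.
  by field; rewrite !gt_eqF.
have [l1 l2] := (atan_gtNpi2 u, atan_ltpi2 u).
rewrite /carg (negbTE z0); case: ifPn => [y0|]; last rewrite -ltNge => y0; rewrite -cth.
  rewrite cosK// in_itv /=; apply/andP; split.
    rewrite mulr_ge0//; have := le_atan (x := 0) (y := u); rewrite atan0; apply.
    by rewrite /u divr_ge0// ltW.
  by rewrite /th mulrC -ler_pdivlMr// ltW.
rewrite cosKN ?opprK// /th; apply/andP; split.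
  by rewrite mulrC -ler_pdivrMr// mulNr ltW.
rewrite pmulr_rle0//; have := le_atan (x := u) (y := 0); rewrite atan0; apply.
by rewrite /u pmulr_lle0 ?invr_gt0// ltW.
Qed.

Lemma slit_near (s : R -> C) (t : R) s' : cder s t s' -> slit (s t) -> \near t, slit (s t).
Proof.
move=> hs h.
have n0 : 0 < cmod (s t) ^+ 2 by rewrite exprn_gt0// cmod_gt0 slit_neq0.
have hc := rder_cont (rderD (rder_sqrt (cder_sqr_cmod hs) n0) hs.1).
have h0 : 0 < Num.sqrt (cmod (s t) ^+ 2) + cre (s t).
  by rewrite sqrtr_sqr ger0_norm ?cmod_ge0.
apply: (filterS _ (cvgr_gt _ hc _ h0)) => u /=.
by rewrite /slit sqrtr_sqr ger0_norm ?cmod_ge0.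
Qed.

(** The arctangent formula is used only for the existence of a derivative [L']. Its value then
    follows by differentiating exp (log s) = s and comparing with [s']. *)
Lemma cdiff_clog z : slit z -> cdiff (@clog R) z z^-1.
Proof.
move=> hz s t s' st hs; rewrite -st in hz *.
have n0 : 0 < cmod (s t) ^+ 2 by rewrite exprn_gt0// cmod_gt0 slit_neq0.
have dn := rder_sqrt (cder_sqr_cmod hs) n0.
have sq u : Num.sqrt (cmod (s u) ^+ 2) = cmod (s u) by rewrite sqrtr_sqr ger0_norm ?cmod_ge0.
have hn : 0 < Num.sqrt (cmod (s t) ^+ 2) by rewrite sqrtr_gt0.
have hd : Num.sqrt (cmod (s t) ^+ 2) + cre (s t) != 0 by rewrite sq gt_eqF.
have [L' hL] : exists L', cder (fun u => clog (s u)) t L'.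
  eexists; refine (cder_near (cder_mk (rder_ln dn hn)
     (rderM (rder_cst 2 t) (rder_atan (rderM hs.2 (rderV (rderD dn hs.1) hd))))) _).
  by apply: filterS (slit_near hs hz) => u hu; rewrite /clog carg_atan// sq.
have h1 : cder s t (cexp (clog (s t)) * L').
  apply: (cder_near (cdiff_cexp erefl hL)).
  by apply: filterS (slit_near hs hz) => u hu; rewrite clogK// slit_neq0.
have h2 : cexp (clog (s t)) * L' = s'.
  move: h1 hs => [a1 a2] [b1 b2]; apply: ceq.
    by rewrite -(derive_val (is_derive := a1)) -(derive_val (is_derive := b1)).
  by rewrite -(derive_val (is_derive := a2)) -(derive_val (is_derive := b2)).
by rewrite -h2 clogK ?slit_neq0// mulKf ?slit_neq0.
Qed.

Lemma cdiff_cpow c z : slit z -> cdiff (fun w => cpow w c) z (c * z^-1 * cpow z c).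
Proof.
move=> hz; refine (cdiff_eq (cdiff_comp (F := @cexp R) (G := fun w => c * clog w)
  (cdiff_cexp (z := _)) (cdiffM (cdiff_cst c z) (cdiff_clog hz))) _).
by rewrite /cpow; ring.
Qed.

Lemma cpow_neq0 z c : cpow z c != 0.
Proof. exact: cexp_neq0. Qed.

Lemma cmod_cpow z x : z != 0 -> cmod (cpow z (cofR x)) = cmod z `^ x.
Proof.
move=> z0; rewrite cmod_cexp creM cim_cofR mul0r subr0 cre_cofR /clog /= /cre /=.
by rewrite /powR cmod_eq0 (negbTE z0).
Qed.

Lemma clog_gt0 x : 0 < x -> clog (cofR x) = cofR (ln x).
Proof.
move=> x0; apply: ceq; rewrite /clog /cre /cim /= ?cmod_cofR ?gtr0_norm//.
rewrite carg_atan ?slit_cre// cim_cofR mul0r atan0 mulr0 //.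
Qed.

Lemma cpow_gt0 x y : 0 < x -> cpow (cofR x) (cofR y) = cofR (x `^ y).
Proof.
by move=> x0; rewrite /cpow clog_gt0// -rmorphM cexp_cofR /powR gt_eqF.
Qed.

End ComplexExpLog.
Arguments cdiff_cexp {R} z.
Arguments cdiff_clog {R z} _.
Arguments cdiff_cpow {R} c {z} _.

(** * The damped energy estimate *)

Section Lyapunov.
Variable R : realType.
Local Notation C := (Cplx R).

Lemma conj_cre_le (z w : C) : `|cre ((z^*)%C * w : C)| <= cmod z * cmod w.
Proof.
apply: le_trans (normr_cre_le _) _; rewrite cmodM ler_wpM2r ?cmod_ge0//.
by rewrite le_eqVlt; apply/orP; left; apply/eqP; case: z => x y; rewrite /cmod /cre /cim /= sqrrN.
Qed.

Lemma conj_mul_cre (z w : C) : cre ((z^*)%C * (w * z) : C) = cre w * cmod z ^+ 2.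
Proof. by rewrite sqr_cmod; case: z; case: w => x y p q; rewrite /cre /cim /=; ring. Qed.

Lemma conj_scale_cre (x : R) (z w : C) : x * cre ((z^*)%C * w : C) = cre ((z^*)%C * (cofR x * w) : C).
Proof. by case: z; case: w => p q r t; rewrite /cre /cim /=; ring. Qed.

(* The weight [om / b] on [|g|^2] makes the damping [Re mu >= ka] absorb the
   coupling terms uniformly in [b]; [om] is allowed to vanish at the start of the
   path, which is what happens at a regular singular point. *)
Lemma lyapunov (N ka b eps t0 t1 : R) (e g g' mu nu be rho s' : R -> C) (om om' : R -> R) :
  0 < ka -> 0 < b -> 3 * N <= ka * b -> 0 <= eps -> t0 <= t1 ->
  (forall t, t0 <= t <= t1 ->
    [/\ cder e t (g t * s' t), cder g t (g' t), rder om t (om' t) & 0 <= om t] /\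
    [/\ cofR (om t) * g' t = - (cofR b * mu t + nu t) * g t
           + cofR b * be t * e t + rho t,
        ka <= cre (mu t), cmod (nu t) <= N & `|om' t| <= N] /\
    [/\ cmod (be t) <= N, cmod (s' t) <= N & cmod (rho t) <= eps]) ->
  let V t := cmod (e t) ^+ 2 + om t / b * cmod (g t) ^+ 2 in
  V t1 + (eps / b) ^+ 2 <= (V t0 + (eps / b) ^+ 2) * expR ((8 * N ^+ 2 + 2) / ka * (t1 - t0)).
Proof.
move=> ka0 b0 Nb eps0 t01 H; set V := fun t => _; cbv zeta; rewrite -/V.
pose dV t := 2 * cre (((e t)^*)%C * (g t * s' t) : C) + (om' t / b * cmod (g t) ^+ 2
   + om t / b * (2 * cre (((g t)^*)%C * g' t : C))).
apply: (gronwall (V := V) (dV := dV)) => // t /H [[he hg hom om0] [[hode hmu hnu hom'] [hbe hs' hrho]]].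
  refine (rder_eq (rderD (cder_sqr_cmod he) (rderM (rderM hom (rder_cst b^-1 t)) (cder_sqr_cmod hg))) _).
  by rewrite /dV /=; ring.
have N0 : 0 <= N by apply: le_trans hs'; exact: cmod_ge0.
set E := cmod (e t); set G := cmod (g t).
have E0 : 0 <= E by exact: cmod_ge0.
have G0 : 0 <= G by exact: cmod_ge0.
have h1 : cre (((e t)^*)%C * (g t * s' t) : C) <= N * (E * G).
  apply: le_trans (ler_norm _) _; apply: le_trans (conj_cre_le _ _) _.
  by rewrite cmodM mulrA mulrC ler_wpM2r// mulr_ge0.
have h2 : om t * cre (((g t)^*)%C * g' t : C) <=
    - (b * ka) * G ^+ 2 + N * G ^+ 2 + b * (N * (E * G)) + G * eps.
  rewrite conj_scale_cre hode.
  have -> : ((g t)^*)%C * (- (cofR b * mu t + nu t) * g t + cofR b * be t * e t + rho t) =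
    - ((g t)^*)%C * ((cofR b * mu t) * g t) - ((g t)^*)%C * (nu t * g t)
     + ((g t)^*)%C * (cofR b * (be t * e t)) + ((g t)^*)%C * rho t :> C by ring.
  rewrite mulNr !creD !creN !conj_mul_cre -conj_scale_cre creM cre_cofR cim_cofR mul0r subr0.
  rewrite -/G; apply: lerD; last first.
    apply: le_trans (ler_norm _) _; apply: le_trans (conj_cre_le _ _) _.
    by rewrite ler_wpM2l.
  apply: lerD; last first.
    rewrite ler_pM2l//; apply: le_trans (ler_norm _) _; apply: le_trans (conj_cre_le _ _) _.
    by rewrite cmodM -/E -/G; rewrite mulrC -mulrA ler_wpM2r// mulr_ge0.
  apply: lerD.
    by rewrite mulNr lerN2 ler_wpM2r ?sqr_ge0// ler_pM2l.
  rewrite -mulNr ler_wpM2r ?sqr_ge0// lerNl; apply: lerNnormlW.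
  exact: le_trans (normr_cre_le _) hnu.
have q0 : 0 <= eps / b by rewrite divr_ge0 // ltW.
(* Differentiating the weighted term gives damping [2 ka G^2]. The contributions of [nu] and [om']
   take up at most [3 (N / b) G^2], which [3 N <= ka b] bounds by [ka G^2]; one half of the damping
   survives. *)
have h3 : dV t <= 4 * N * E * G - ka * G ^+ 2 + 2 * G * (eps / b).
  have hom'G : om' t / b * G ^+ 2 <= N / b * G ^+ 2.
    by rewrite ler_wpM2r ?sqr_ge0// ler_pM2r ?invr_gt0//; exact: le_trans (ler_norm _) hom'.
  have h2' : om t / b * (2 * cre (((g t)^*)%C * g' t : C)) <=
     2 / b * (- (b * ka) * G ^+ 2 + N * G ^+ 2 + b * (N * (E * G)) + G * eps).
    rewrite [leLHS](_ : _ = 2 / b * (om t * cre (((g t)^*)%C * g' t : C))); last by ring.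
    by rewrite ler_pM2l// divr_gt0.
  have hb : 3 * (N / b) * G ^+ 2 <= ka * G ^+ 2.
    by rewrite ler_wpM2r ?sqr_ge0// mulrA ler_pdivrMr.
  have e2 : 2 / b * (- (b * ka) * G ^+ 2 + N * G ^+ 2 + b * (N * (E * G)) + G * eps) =
     - (2 * ka) * G ^+ 2 + 2 * (N / b * G ^+ 2) + 2 * (N * (E * G)) + 2 * G * (eps / b).
    by field; rewrite gt_eqF.
  rewrite e2 in h2'; rewrite /dV -/G; move: hb; rewrite -mulrA; lra.
apply: le_trans h3 _.
have h4 : 0 <= om t / b * G ^+ 2 by rewrite mulr_ge0 ?sqr_ge0// divr_ge0// ltW.
rewrite /V -/E -/G [leRHS]mulrAC ler_pdivlMr//.
set q := eps / b in q0 *; set W := om t / b * G ^+ 2 in h4 *.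
(* The two squares split the remaining damping: 4 N E G <= ka G^2 / 2 + 8 N^2 E^2 / ka and 2 G q <=
   ka G^2 / 2 + 2 q^2 / ka. This is the origin of the rate [(8 N^2 + 2) / ka]. *)
have sq1 := sqr_ge0 (ka * G - 4 * N * E); have sq2 := sqr_ge0 (ka * G - 2 * q).
have n8 : 0 <= 8 * N ^+ 2 by apply: mulr_ge0 => //; exact: sqr_ge0.
have sq3 : 0 <= (8 * N ^+ 2) * W by exact: mulr_ge0.
have sq4 : 0 <= (8 * N ^+ 2) * q ^+ 2 by apply: mulr_ge0 => //; exact: sqr_ge0.
have := sqr_ge0 E; lra.
Qed.
End Lyapunov.

(** * Power series and Kummer's equation *)

Section ComplexSeries.
Variable R : realType.
Local Notation C := (Cplx R).
Implicit Types (M B : R) (u v : nat -> C) (c : nat -> R) (z h : C).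

(** Domination by an exponential series: it gives convergence and an explicit bound on the sum, and
    it is stable under sums, scaling and termwise differentiation. *)
Definition expbnd u M B := [/\ 0 <= M, 0 <= B & forall k, cmod (u k) <= M * (B ^+ k / k`!%:R)].

Definition csum u : C :=
  Complex (limn (series (fun k => cre (u k)))) (limn (series (fun k => cim (u k)))).

Lemma cvg_series_expbnd (x : nat -> R) M B : 0 <= M -> 0 <= B ->
  (forall k, `|x k| <= M * (B ^+ k / k`!%:R)) -> cvgn (series x).
Proof.
move=> M0 B0 h; apply: normed_cvg.
apply: (@series_le_cvg R _ (M *: exp_coeff B)) => //.
- by move=> n; rewrite /= normr_ge0.
- by move=> n; apply: mulr_ge0 => //; exact: exp_coeff_ge0.
- by apply: is_cvg_seriesZ; exact: is_cvg_series_exp_coeff.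
Qed.

Lemma lim_series_expbnd (x : nat -> R) M B : 0 <= M -> 0 <= B ->
  (forall k, `|x k| <= M * (B ^+ k / k`!%:R)) -> `|limn (series x)| <= M * expR B.
Proof.
move=> M0 B0 h.
have cM : cvgn (series (M *: exp_coeff B)).
  by apply: is_cvg_seriesZ; exact: is_cvg_series_exp_coeff.
have cN : cvgn [normed series x].
  apply: (@series_le_cvg R _ (M *: exp_coeff B)) => //.
    by move=> n; rewrite /= normr_ge0.
  by move=> n; apply: mulr_ge0 => //; exact: exp_coeff_ge0.
apply: le_trans (lim_series_norm cN) _.
apply: le_trans (lim_series_le cN cM h) _.
by rewrite lim_seriesZ//; exact: is_cvg_series_exp_coeff.
Qed.

Lemma expbnd_cvg u M B : expbnd u M B ->
  cvgn (series (fun k => cre (u k))) /\ cvgn (series (fun k => cim (u k))).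
Proof.
move=> [M0 B0 h]; split; apply: (cvg_series_expbnd M0 B0) => k; apply: le_trans (h k).
  exact: normr_cre_le.
exact: normr_cim_le.
Qed.

Lemma csum_bound u M B : expbnd u M B -> cmod (csum u) <= 2 * M * expR B.
Proof.
move=> [M0 B0 h]; apply: le_trans (cmod_le _) _; rewrite -mulrA mulr_natl mulr2n.
apply: lerD; apply: (lim_series_expbnd M0 B0) => k; apply: le_trans (h k).
  exact: normr_cre_le.
exact: normr_cim_le.
Qed.

Lemma csumD u v M B M' B' : expbnd u M B -> expbnd v M' B' ->
  csum (fun k => u k + v k) = csum u + csum v.
Proof.
move=> /expbnd_cvg[u1 u2] /expbnd_cvg[v1 v2]; apply: ceq; rewrite !cE /csum /cre /cim /=.
  rewrite -lim_seriesD//; congr (limn (series _)); apply/funext => k /=.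
  exact: creD.
rewrite -lim_seriesD//; congr (limn (series _)); apply/funext => k /=.
exact: cimD.
Qed.

Lemma csumZ (l : C) u M B : expbnd u M B -> csum (fun k => l * u k) = l * csum u.
Proof.
move=> /expbnd_cvg[u1 u2].
have lin (x y : R) : limn (series (fun k => x * cre (u k) + y * cim (u k))) =
    x * limn (series (fun k => cre (u k))) + y * limn (series (fun k => cim (u k))).
  apply: cvg_lim => //.
  rewrite (_ : series _ = (fun n => x * series (fun k => cre (u k)) n
                                    + y * series (fun k => cim (u k)) n)).
    by apply: cvgD; (apply: cvgM; first exact: cvg_cst).
  by apply/funext => n; rewrite /series /= big_split /= !mulr_sumr.
have E1 : cre (csum u) = limn (series (fun k => cre (u k))) by [].
have E2 : cim (csum u) = limn (series (fun k => cim (u k))) by [].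
apply: ceq; rewrite !cE E1 E2; rewrite -?mulNr ?(addrC (cre l * limn (series (fun k => cim (u k))))) -lin.
  by congr (limn (series _)); apply/funext => k; rewrite creM; ring.
by congr (limn (series _)); apply/funext => k; rewrite cimM; ring.
Qed.

Lemma lim_series_shift (x : nat -> R) : cvgn (series x) ->
  limn (series x) = x 0%N + limn (series (fun k => x k.+1)).
Proof.
move=> cx.
have E : (fun n => series x n.+1) = (fun n => x 0%N + series (fun k => x k.+1) n).
  by apply/funext => n; rewrite /series /= big_nat_recl.
have c1 : (fun n => series x n.+1) @ \oo --> limn (series x) by rewrite cvg_shiftS.
have c2 : series (fun k => x k.+1) @ \oo --> limn (series x) - x 0%N.
  have -> : series (fun k => x k.+1) = (fun n => series x n.+1 - x 0%N).
    by apply/funext => n; rewrite (congr1 (@^~ n) E) addrC addKr.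
  by apply: cvgB => //; exact: cvg_cst.
by rewrite (cvg_lim _ c2)//; ring.
Qed.

Lemma csum_shift u M B : expbnd u M B -> csum u = u 0%N + csum (fun k => u k.+1).
Proof.
move=> /expbnd_cvg[u1 u2]; apply: ceq; rewrite !cE.
  by rewrite /csum {1}/cre/= lim_series_shift.
by rewrite /csum {1}/cim/= lim_series_shift.
Qed.

Lemma expbndD u v M B M' B' : expbnd u M B -> expbnd v M' B' ->
  expbnd (fun k => u k + v k) (M + M') (B + B').
Proof.
move=> [M0 B0 h] [M0' B0' h']; split; rewrite ?addr_ge0// => k.
apply: le_trans (cmodD _ _) _; rewrite mulrDl; apply: lerD.
  apply: le_trans (h k) _; rewrite ler_wpM2l// ler_wpM2r ?invr_ge0//.
  by rewrite lerXn2r ?nnegrE ?addr_ge0// lerDl.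
apply: le_trans (h' k) _; rewrite ler_wpM2l// ler_wpM2r ?invr_ge0//.
by rewrite lerXn2r ?nnegrE ?addr_ge0// lerDr.
Qed.

Lemma expbndZ (l : C) u M B : expbnd u M B -> expbnd (fun k => l * u k) (cmod l * M) B.
Proof.
move=> [M0 B0 h]; split; rewrite ?mulr_ge0 ?cmod_ge0// => k.
by rewrite cmodM -mulrA ler_wpM2l ?cmod_ge0.
Qed.

Lemma csum_cvg u M B : expbnd u M B -> (fun n => \sum_(k < n) u k) @ \oo --> csum u.
Proof.
move=> /expbnd_cvg[u1 u2]; apply/cvgrPdist_lt => e e0.
have [x ex] : exists x, e = cofR x.
  move: e0; case: e => x y; rewrite ltcE /= => /andP[/eqP y0 _]; exists x.
  by apply: ceq; rewrite /cre /cim.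
move: e0; rewrite ex -(rmorph0 (@cofR R)) ltr_cofR => x0.
have /cvgrPdist_lt/(_ _ (divr_gt0 x0 (ltr0n R 2))) h1 := u1.
have /cvgrPdist_lt/(_ _ (divr_gt0 x0 (ltr0n R 2))) h2 := u2.
near=> n; rewrite normE ltr_cofR.
apply: le_lt_trans (cmod_le _) _; rewrite (splitr x) !cE.
have sE (f : C -> R) : {morph f : p q / p + q} -> f 0 = 0 ->
    f (\sum_(k < n) u k) = series (fun k => f (u k)) n.
  move=> fD f0; rewrite /series /= big_mkord.
  by elim/big_ind2: _ => // p q p' q'; rewrite fD => -> ->.
rewrite (sE (@cre R) (@creD R) (@cre0 R)) (sE (@cim R) (@cimD R) (@cim0 R)).
by apply: ltrD; near: n.
Unshelve. all: by end_near. Qed.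

Definition cps c z : C := csum (fun k => cofR (c k) * z ^+ k).
Definition dcoef c := fun k => k.+1%:R * c k.+1 : R.
Definition cbnd c M B := [/\ 0 <= M, 0 <= B & forall k, `|c k| <= M * (B ^+ k / k`!%:R)].

Lemma cbnd_expbnd c M B z r : cbnd c M B -> cmod z <= r ->
  expbnd (fun k => cofR (c k) * z ^+ k) M (B * r).
Proof.
move=> [M0 B0 h] zr; have r0 : 0 <= r := le_trans (cmod_ge0 z) zr.
split; rewrite ?mulr_ge0// => k.
rewrite cmodM cmod_cofR cmodX exprMn mulrAC mulrA; apply: ler_pM => //.
- by rewrite exprn_ge0// cmod_ge0.
- by rewrite lerXn2r ?nnegrE ?cmod_ge0.
Qed.

Lemma cbnd_dcoef c M B : cbnd c M B -> cbnd (dcoef c) (M * B) B.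
Proof.
move=> [M0 B0 h]; split; rewrite ?mulr_ge0// => k.
rewrite /dcoef normrM ger0_norm//.
apply: le_trans (_ : k.+1%:R * (M * (B ^+ k.+1 / k.+1`!%:R)) <= _).
  by rewrite ler_wpM2l.
have h1 : k.+1%:R != 0 :> R by rewrite pnatr_eq0.
have h2 : k`!%:R != 0 :> R by rewrite pnatr_eq0 -lt0n fact_gt0.
rewrite factS natrM exprS le_eqVlt; apply/orP; left; apply/eqP.
move: h1 h2; move: (k.+1%:R) (k`!%:R) (B ^+ k) => p q w h1 h2.
by field; rewrite h1 h2.
Qed.

(** Induction through R_(k+1) = (z + h) R_k + h^2 k z^(k-1). The factor 4^k leaves room for both
    summands and for k <= 4^k, while the bound stays geometric, so that summation against the
    coefficients still gives an exponential series. *)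
Lemma taylor1_pow_bound (z h : C) r k : 1 <= r -> cmod z <= r -> cmod (z + h) <= r ->
  cmod ((z + h) ^+ k - z ^+ k - h * (k%:R * z ^+ k.-1)) <= cmod h ^+ 2 * (4 * r) ^+ k.
Proof.
move=> r1 zr zhr; have r0 : 0 <= r by apply: le_trans r1.
have h2 := sqr_ge0 (cmod h).
elim: k => [|k IH].
  rewrite !expr0 subrr mul0r mulr0 subr0 mulr1.
  by have /eqP -> : cmod (0 : C) == 0 by rewrite cmod_eq0.
have -> : (z + h) ^+ k.+1 - z ^+ k.+1 - h * (k.+1%:R * z ^+ k.+1.-1) =
   (z + h) * ((z + h) ^+ k - z ^+ k - h * (k%:R * z ^+ k.-1)) + h ^+ 2 * (k%:R * z ^+ k.-1).
  by case: k {IH} => [|k] /=; rewrite ?expr0 ?expr1 ?exprS; ring.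
apply: le_trans (cmodD _ _) _.
rewrite (cmodM (z + h)) (cmodM (h ^+ 2)) (cmodM k%:R) (cmodX h).
have a1 : cmod (z + h) * cmod ((z + h) ^+ k - z ^+ k - h * (k%:R * z ^+ k.-1)) <=
   r * (cmod h ^+ 2 * (4 * r) ^+ k) by apply: ler_pM; rewrite ?cmod_ge0.
have a2 : cmod ((k%:R : C)) * cmod (z ^+ k.-1) <= (4 * r) ^+ k * r.
  have -> : (k%:R : C) = cofR k%:R by rewrite rmorph_nat.
  rewrite cmod_cofR ger0_norm// cmodX exprMn.
  have k4 : (k%:R : R) <= 4 ^+ k.
    by rewrite -natrX ler_nat; apply/ltnW/ltn_expl.
  have zk : cmod z ^+ k.-1 <= r ^+ k.
    apply: le_trans (_ : r ^+ k.-1 <= _); first by rewrite lerXn2r ?nnegrE ?cmod_ge0.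
    by apply: ler_weXn2l => //; exact: leq_pred.
  rewrite -mulrA; apply: ler_pM => //; first by rewrite exprn_ge0// cmod_ge0.
  by apply: le_trans zk _; rewrite ler_peMr// exprn_ge0.
have a3 : cmod h ^+ 2 * (cmod (k%:R : C) * cmod (z ^+ k.-1)) <= cmod h ^+ 2 * ((4 * r) ^+ k * r).
  by rewrite ler_wpM2l.
apply: le_trans (lerD a1 a3) _; rewrite (exprS (4 * r) k).
have : 0 <= cmod h ^+ 2 * (4 * r) ^+ k * r.
  by apply: mulr_ge0 => //; apply: mulr_ge0 => //; rewrite exprn_ge0// mulr_ge0.
lra.
Qed.

Lemma cps_taylor1 c M B z h r : cbnd c M B -> 1 <= r -> cmod z <= r -> cmod (z + h) <= r ->
  cmod (cps c (z + h) - cps c z - h * cps (dcoef c) z) <= cmod h ^+ 2 * (2 * M * expR (B * (4 * r))).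
Proof.
move=> cb r1 zr zhr; have [M0 B0 hc] := cb.
have r0 : 0 <= r by apply: le_trans r1.
have e1 := cbnd_expbnd cb zhr; have e2 := cbnd_expbnd cb zr.
have e3 := cbnd_expbnd (cbnd_dcoef cb) zr.
have e4 := expbndZ (-1) e2.
pose w k := h * (cofR (c k) * (k%:R * z ^+ k.-1)).
have T k : cofR (c k) * ((z + h) ^+ k - z ^+ k - h * (k%:R * z ^+ k.-1)) =
  cofR (c k) * (z + h) ^+ k + (-1) * (cofR (c k) * z ^+ k) + - w k.
  by rewrite /w; ring.
have bT : expbnd (fun k => cofR (c k) * ((z + h) ^+ k - z ^+ k - h * (k%:R * z ^+ k.-1)))
   (cmod h ^+ 2 * M) (B * (4 * r)).
  split; rewrite ?mulr_ge0 ?cmod_ge0// => k.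
  rewrite cmodM cmod_cofR exprMn.
  have := ler_pM (normr_ge0 (c k)) (cmod_ge0 _) (hc k) (taylor1_pow_bound k r1 zr zhr).
  by move/le_trans; apply; rewrite le_eqVlt; apply/orP; left; apply/eqP; ring.
(* The linear terms need a domination of their own before the series can be split; it is read off
   from [T], which writes them as a combination of three dominated sequences. *)
have bw : expbnd (fun k => - w k) (cmod h ^+ 2 * M + M + cmod (-1 : C) * M)
   (B * (4 * r) + (B * r + B * r)).
  have := expbndD bT (expbndZ (-1) (expbndD e1 e4)).
  have [p1 p2 _] := expbndD bT (expbndZ (-1) (expbndD e1 e4)).
  move=> [q1 q2 q3]; split => //.
    by rewrite !addr_ge0 ?mulr_ge0 ?cmod_ge0.
  move=> k; have := q3 k; rewrite T cmodN.
  rewrite [X in cmod X](_ : _ = - w k); last by ring.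
  rewrite cmodN => /le_trans; apply; rewrite ler_wpM2r ?divr_ge0 ?exprn_ge0 ?addr_ge0 ?mulr_ge0//.
  have -> : cmod (-1 : C) = 1 by rewrite cmodN -(rmorph1 (@cofR R)) cmod_cofR normr1.
  by rewrite !mul1r addrA.
have sw : csum (fun k => - w k) = - (h * cps (dcoef c) z).
  rewrite (csum_shift bw) /w mulr0n mul0r !mulr0 oppr0 add0r -mulNr -(csumZ _ e3).
  by congr csum; apply/funext => k; rewrite /dcoef rmorphM /= rmorph_nat; ring.
have := csum_bound bT.
rewrite (_ : csum _ = cps c (z + h) - cps c z - h * cps (dcoef c) z).
  by rewrite mulrA => /le_trans; apply; rewrite le_eqVlt; apply/orP; left; apply/eqP; ring.
rewrite -sw (_ : - cps c z = csum (fun k => -1 * (cofR (c k) * z ^+ k))).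
  rewrite /cps -(csumD e1 e4) -(csumD (expbndD e1 e4) bw); congr csum; apply/funext => k.
  exact: T.
by rewrite (csumZ _ e2) mulN1r.
Qed.

(** By [cps_taylor1] the remainder along the path is at most a multiple of |s u - z|^2, a function
    with value and derivative 0 at [t]; [rder_squeeze] applies to both components. *)
Lemma cdiff_cps c M B z : cbnd c M B -> cdiff (cps c) z (cps (dcoef c) z).
Proof.
move=> cb s t s' st hs.
have [M0 B0 hc] := cb.
(* The radius |z| + 1 admits all increments of modulus at most 1, and nearby parameters give no
   larger ones. *)
set r := cmod z + 1; have r1 : 1 <= r by rewrite lerDr cmod_ge0.
have zr : cmod z <= r by rewrite lerDl.
set K := 2 * M * expR (B * (4 * r)).
pose rem (u : R) := cps c (s u) - cps c z - (s u - z) * cps (dcoef c) z.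
have dsz : cder (fun u : R => s u - z) t s'.
  by apply: (cder_eq (cderB hs (cder_cst z t))); rewrite subr0.
have dB : rder (fun u : R => K * cmod (s u - z) ^+ 2) t 0.
  refine (rder_eq (rderM (rder_cst K t) (cder_sqr_cmod dsz)) _).
  by rewrite st subrr /= !mul0r creM /= !mul0r; rewrite !(mulr0,mul0r,subr0,addr0,oppr0).
have B0' : K * cmod (s t - z) ^+ 2 = 0.
  have /eqP -> : cmod (s t - z) == 0 by rewrite cmod_eq0 st subrr.
  by rewrite expr0n mulr0.
have nb : \near t, cmod (rem t) <= K * cmod (s t - z) ^+ 2.
  have : \near t, cmod (s t - z) ^+ 2 < 1.
    have hcont := rder_cont (cder_sqr_cmod dsz).
    have : cmod (s t - z) ^+ 2 < 1.
      have /eqP -> : cmod (s t - z) == 0 by rewrite cmod_eq0 st subrr.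
      by rewrite expr0n ltr01.
    by move=> h1; exact: (cvgr_lt _ hcont _ h1).
  apply: filterS => u hu.
  have h1 : cmod (s u - z) <= 1.
    rewrite -(@expr_le1 _ 2) ?cmod_ge0//; exact: ltW.
  have := @cps_taylor1 c M B z (s u - z) r cb r1 zr.
  rewrite (_ : z + (s u - z) = s u) ?(mulrC K); last by ring.
  apply.
  by rewrite -[s u](subrK z) /r addrC; apply: le_trans (cmodD _ _) _; rewrite lerD2l.
have dr : cder rem t 0.
  split; apply: rder_squeeze dB B0' _; apply: filterS nb => u; apply: le_trans.
    exact: normr_cre_le.
  exact: normr_cim_le.
have := cderD dr (cderD (cder_cst (cps c z) t) (cderM dsz (cder_cst (cps (dcoef c) z) t))).
rewrite !add0r mulr0 addr0 mulrC => /cder_ext; apply => u.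
rewrite /rem; move: (cps c (s u)) (cps c z) (cps (dcoef c) z) => p q r'; ring.
Qed.

End ComplexSeries.

(** * Kummer's equation and positivity on the real axis *)

Section Kummer.
Variable R : realType.
Local Notation C := (Cplx R).
Implicit Types (a b M B : R) (c : nat -> R) (z : C).

Lemma cbnd_eulerop c M B : cbnd c M B -> cbnd (fun k => k%:R * c k) M (2 * B).
Proof.
move=> [M0 B0 h]; split; rewrite ?mulr_ge0// => k.
rewrite normrM ger0_norm// exprMn -mulrA mulrCA; apply: ler_pM => //.
by rewrite -natrX ler_nat; apply/ltnW/ltn_expl.
Qed.

Lemma cpsD c c' M B M' B' z : cbnd c M B -> cbnd c' M' B' ->
  cps (fun k => c k + c' k) z = cps c z + cps c' z.
Proof.
move=> h h'; have e := cbnd_expbnd h (lexx (cmod z)).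
have e' := cbnd_expbnd h' (lexx (cmod z)).
rewrite /cps -(csumD e e'); congr csum; apply/funext => k.
by rewrite rmorphD /=; ring.
Qed.

Lemma cpsZ (x : R) c M B z : cbnd c M B -> cps (fun k => x * c k) z = cofR x * cps c z.
Proof.
move=> h; have e := cbnd_expbnd h (lexx (cmod z)).
by rewrite /cps -(csumZ _ e); congr csum; apply/funext => k; rewrite rmorphM /=; ring.
Qed.

Lemma cbndD c c' M B M' B' : cbnd c M B -> cbnd c' M' B' ->
  cbnd (fun k => c k + c' k) (M + M') (B + B').
Proof.
move=> [M0 B0 h] [M0' B0' h']; split; rewrite ?addr_ge0// => k.
apply: le_trans (ler_normD _ _) _; rewrite mulrDl; apply: lerD.
  apply: le_trans (h k) _; rewrite ler_wpM2l// ler_wpM2r ?invr_ge0//.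
  by rewrite lerXn2r ?nnegrE ?addr_ge0// lerDl.
apply: le_trans (h' k) _; rewrite ler_wpM2l// ler_wpM2r ?invr_ge0//.
by rewrite lerXn2r ?nnegrE ?addr_ge0// lerDr.
Qed.

Lemma cbndZ (x : R) c M B : cbnd c M B -> cbnd (fun k => x * c k) (`|x| * M) B.
Proof.
move=> [M0 B0 h]; split; rewrite ?mulr_ge0// => k.
by rewrite normrM -mulrA ler_wpM2l.
Qed.

Lemma mul_cps_dcoef c M B z : cbnd c M B ->
  z * cps (dcoef c) z = cps (fun k => k%:R * c k) z.
Proof.
move=> h; have e := cbnd_expbnd (cbnd_eulerop h) (lexx (cmod z)).
have e' := cbnd_expbnd (cbnd_dcoef h) (lexx (cmod z)).
rewrite /cps (csum_shift e) mul0r rmorph0 mul0r add0r -(csumZ _ e').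
by congr csum; apply/funext => k; rewrite /dcoef exprS; ring.
Qed.

Lemma cps0 z : cps (fun=> 0) z = 0.
Proof.
rewrite /cps /csum; apply: ceq; rewrite /cre /cim /=; apply: cvg_lim => //.
  rewrite (_ : series _ = fun=> 0); first exact: cvg_cst.
  by apply/funext => n; rewrite /series /= big1// => k _; rewrite mul0r.
rewrite (_ : series _ = fun=> 0); first exact: cvg_cst.
by apply/funext => n; rewrite /series /= big1// => k _; rewrite mul0r.
Qed.

(** Taylor coefficients in z of 1F1(a; b; b z); the factor [b ^+ k] absorbs the scaling of the
    argument. *)
Definition kc a b k : R := poch a k * b ^+ k / (poch b k * k`!%:R).

Lemma poch_gt0 a k : 0 < a -> 0 < poch a k.
Proof. by move=> a0; apply: prodr_gt0 => i _; rewrite ltr_wpDr. Qed.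

Lemma pochS a k : poch a k.+1 = poch a k * (a + k%:R).
Proof. by rewrite /poch big_ord_recr. Qed.

Lemma poch0 a : poch a 0 = 1.
Proof. by rewrite /poch big_ord0. Qed.

Lemma kc0 a b : kc a b 0 = 1.
Proof. by rewrite /kc !poch0 expr0 fact0 !mulr1 divr1. Qed.

Lemma kcS a b k : 0 < b -> k.+1%:R * (b + k%:R) * kc a b k.+1 = b * (a + k%:R) * kc a b k.
Proof.
move=> b0; rewrite /kc !pochS exprS factS natrM.
have h1 : k.+1%:R != 0 :> R by rewrite pnatr_eq0.
have h2 : k`!%:R != 0 :> R by rewrite pnatr_eq0 -lt0n fact_gt0.
have h3 : b + k%:R != 0 by rewrite gt_eqF// ltr_wpDr.
have h4 : poch b k != 0 by rewrite gt_eqF// poch_gt0.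
move: h1 h2 h3 h4; move: (b + k%:R) (poch b k) (k.+1%:R) (k`!%:R) => p q r s h1 h2 h3 h4.
by field; rewrite h1 h2 h3 h4.
Qed.

Lemma kc_ge0 a b k : 0 < a -> 0 < b -> 0 <= kc a b k.
Proof.
by move=> a0 b0; rewrite divr_ge0 ?mulr_ge0 ?exprn_ge0 ?ltW ?poch_gt0.
Qed.

(** Induction on the recurrence [kcS]: the growth constant a + b works because b (a + k) <= (b + k)
    (a + b). *)
Lemma cbnd_kc a b : 0 < a -> 0 < b -> cbnd (kc a b) 1 (a + b).
Proof.
move=> a0 b0; split => //; first by rewrite addr_ge0// ltW.
move=> k; rewrite mul1r ger0_norm ?kc_ge0//; elim: k => [|k IH].
  by rewrite kc0 expr0 fact0 divr1.
have bk : 0 < b + k%:R by rewrite ltr_wpDr.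
rewrite -(ler_pM2l (_ : 0 < k.+1%:R * (b + k%:R))) ?mulr_gt0// kcS//.
have ->: k.+1%:R * (b + k%:R) * ((a + b) ^+ k.+1 / k.+1`!%:R) =
   (b + k%:R) * (a + b) * ((a + b) ^+ k / k`!%:R).
  have h1 : k.+1%:R != 0 :> R by rewrite pnatr_eq0.
  have h2 : k`!%:R != 0 :> R by rewrite pnatr_eq0 -lt0n fact_gt0.
  rewrite exprS factS natrM; move: h1 h2; move: (k.+1%:R) (k`!%:R) => r s h1 h2.
  by field; rewrite h1 h2.
apply: ler_pM; rewrite ?kc_ge0//; first by rewrite mulr_ge0 ?addr_ge0 ?(ltW a0) ?(ltW b0).
have : 0 <= a * k%:R by rewrite mulr_ge0// ltW.
nra.
Qed.

Definition kf a b z := cps (kc a b) z.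
Definition kf1 a b z := cps (dcoef (kc a b)) z.
Definition kf2 a b z := cps (dcoef (dcoef (kc a b))) z.

Lemma F11_kf a b z : 0 < a -> 0 < b -> F11 a b (cofR b * z) = kf a b z.
Proof.
move=> a0 b0; rewrite /F11 /kf /cps; apply: cvg_lim; first exact: norm_hausdorff.
have := csum_cvg (cbnd_expbnd (cbnd_kc a0 b0) (lexx (cmod z))).
rewrite (_ : (fun n => _) = fun n => \sum_(k < n) (cofR (poch a k / (poch b k * k`!%:R)) * (cofR b * z) ^+ k)); first by apply.
apply/funext => n; apply: eq_bigr => k _.
by rewrite exprMn -rmorphXn /= mulrA -rmorphM /= /kc; congr (cofR _ * _); ring.
Qed.

Lemma cdiff_kf a b z : 0 < a -> 0 < b -> cdiff (kf a b) z (kf1 a b z).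
Proof. by move=> a0 b0; exact: cdiff_cps (cbnd_kc a0 b0). Qed.

Lemma cdiff_kf1 a b z : 0 < a -> 0 < b -> cdiff (kf1 a b) z (kf2 a b z).
Proof. by move=> a0 b0; exact: cdiff_cps (cbnd_dcoef (cbnd_kc a0 b0)). Qed.

(** Multiplication of a derivative by z is the Euler operator on coefficients ([mul_cps_dcoef]), so
    the whole equation becomes one power series whose coefficients vanish by [kcS]. *)
Lemma kummer_ode a b z : 0 < a -> 0 < b ->
  z * kf2 a b z = - (cofR b * (1 - z)) * kf1 a b z + cofR (a * b) * kf a b z.
Proof.
move=> a0 b0; have h := cbnd_kc a0 b0; have h1 := cbnd_dcoef h.
rewrite /kf2 /kf1 /kf (mul_cps_dcoef z h1); apply/eqP; rewrite -subr_eq0; apply/eqP.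
have -> : cps (fun k => k%:R * dcoef (kc a b) k) z -
  (- (cofR b * (1 - z)) * cps (dcoef (kc a b)) z + cofR (a * b) * cps (kc a b) z) =
  cps (fun k => k%:R * dcoef (kc a b) k) z + (cofR b * cps (dcoef (kc a b)) z +
  (cofR (- b) * (z * cps (dcoef (kc a b)) z) + cofR (- (a * b)) * cps (kc a b) z)).
  by rewrite !rmorphN; ring.
rewrite (mul_cps_dcoef z h) -(cpsZ _ z h1) -(cpsZ _ z h) -(cpsZ _ z (cbnd_eulerop h)).
rewrite -(cpsD z (cbndZ (- b) (cbnd_eulerop h)) (cbndZ (- (a * b)) h)).
rewrite -(cpsD z (cbndZ b h1) (cbndD (cbndZ (- b) (cbnd_eulerop h)) (cbndZ (- (a * b)) h))).
rewrite -(cpsD z (cbnd_eulerop h1) (cbndD (cbndZ b h1) (cbndD (cbndZ (- b) (cbnd_eulerop h)) (cbndZ (- (a * b)) h)))).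
rewrite -[RHS](cps0 z); congr (cps _ z); apply/funext => k.
by have := kcS a k b0; rewrite /dcoef; lra.
Qed.

Lemma cps_ge0 c M B (x : R) : cbnd c M B -> (forall k, 0 <= c k) -> 0 <= x ->
  0 <= cre (cps c (cofR x)).
Proof.
move=> h c0 x0; have [h1 _] := expbnd_cvg (cbnd_expbnd h (lexx (cmod (cofR x)))).
rewrite /cps /csum {1}/cre /=; apply: limr_ge => //.
near=> n; rewrite /series /=; apply: sumr_ge0 => k _.
by rewrite -rmorphXn -rmorphM /= mulr_ge0// exprn_ge0.
Unshelve. all: by end_near. Qed.

Lemma cps_ge_c0 c M B (x : R) : cbnd c M B -> (forall k, 0 <= c k) -> 0 <= x ->
  c 0%N <= cre (cps c (cofR x)).
Proof.
move=> h c0 x0; have e := cbnd_expbnd h (lexx (cmod (cofR x))).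
have [h1 _] := expbnd_cvg e.
rewrite /cps /csum {1}/cre /=; apply: limr_ge => //.
near=> n; rewrite /series /=; rewrite big_ltn; last by near: n; exact: nbhs_infty_gt.
rewrite expr0 mulr1 cre_cofR lerDl; apply: sumr_ge0 => k _.
by rewrite -rmorphXn -rmorphM /= mulr_ge0// exprn_ge0.
Unshelve. all: by end_near. Qed.

Lemma cim_cps_cofR c M B (x : R) : cbnd c M B -> cim (cps c (cofR x)) = 0.
Proof.
move=> h; rewrite /cps /csum {1}/cim /=; apply: cvg_lim => //.
rewrite (_ : series _ = fun=> 0); first exact: cvg_cst.
apply/funext => n; rewrite /series /= big1// => k _.
by rewrite -rmorphXn -rmorphM.
Qed.

Lemma kf_ge1 a b x : 0 < a -> 0 < b -> 0 <= x -> 1 <= cre (kf a b (cofR x)).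
Proof.
move=> a0 b0 x0; rewrite -(kc0 a b); apply: cps_ge_c0 => //; first exact: cbnd_kc.
by move=> k; exact: kc_ge0.
Qed.

Lemma kf1_ge0 a b x : 0 < a -> 0 < b -> 0 <= x -> 0 <= cre (kf1 a b (cofR x)).
Proof.
move=> a0 b0 x0; apply: cps_ge0 => //; first exact/cbnd_dcoef/cbnd_kc.
by move=> k; rewrite mulr_ge0// kc_ge0.
Qed.

(** By [kcS] the coefficients of f' are those of f times b (a + k) / (b + k), a factor at most b.
    The bound on f' / f supplies crude initial data for the Riccati equation. *)
Lemma kf1_le a b x : 0 < a -> a <= b -> 0 <= x ->
  cre (kf1 a b (cofR x)) <= b * cre (kf a b (cofR x)).
Proof.
move=> a0 ab x0; have b0 : 0 < b by exact: lt_le_trans ab.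
have h := cbnd_kc a0 b0; have h1 := cbnd_dcoef h.
rewrite -subr_ge0.
have -> : b * cre (kf a b (cofR x)) - cre (kf1 a b (cofR x)) =
  cre (cps (fun k => b * kc a b k + (-1) * dcoef (kc a b) k) (cofR x)).
  rewrite (cpsD _ (cbndZ b h) (cbndZ (-1) h1)) (cpsZ _ _ h) (cpsZ _ _ h1) !cE.
  by rewrite !mul0r !subr0 mulN1r.
apply: cps_ge0 => //; first exact: cbndD (cbndZ b h) (cbndZ (-1) h1).
move=> k; rewrite mulN1r subr_ge0 /dcoef.
have bk : 0 < b + k%:R by rewrite ltr_wpDr.
have kS := kcS a k b0; rewrite -(ler_pM2l bk).
have : b * (a + k%:R) * kc a b k <= (b + k%:R) * b * kc a b k.
  by rewrite ler_wpM2r ?kc_ge0// mulrC ler_pM2r// lerD2r.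
by lra.
Qed.

End Kummer.

(** * Region A *)

Section BoundedOnDiscs.
Variable R : realType.
Local Notation C := (Cplx R).
Implicit Types (F G : C -> C) (W : R).

(** Closure under sums, products and powers bounds a residual polynomial from its shape alone,
    without explicit constants. *)
Definition bdisc F W := exists2 B, 0 <= B & forall w, cmod w <= W -> cmod (F w) <= B.

Lemma bdisc_cst (c : C) W : bdisc (fun=> c) W.
Proof. by exists (cmod c); rewrite ?cmod_ge0. Qed.

Lemma bdisc_id W : bdisc (fun w => w) W.
Proof. by exists `|W| => // w h; exact: le_trans (ler_norm _). Qed.

Lemma bdiscD F G W : bdisc F W -> bdisc G W -> bdisc (fun w => F w + G w) W.
Proof.
move=> [A A0 hA] [B B0 hB]; exists (A + B); rewrite ?addr_ge0// => w hw.
by apply: le_trans (cmodD _ _) _; rewrite lerD ?hA ?hB.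
Qed.

Lemma bdiscM F G W : bdisc F W -> bdisc G W -> bdisc (fun w => F w * G w) W.
Proof.
move=> [A A0 hA] [B B0 hB]; exists (A * B); rewrite ?mulr_ge0// => w hw.
by rewrite cmodM ler_pM ?cmod_ge0 ?hA ?hB.
Qed.

Lemma bdiscX F W n : bdisc F W -> bdisc (fun w => F w ^+ n) W.
Proof.
move=> h; elim: n => [|n IH]; first by under eq_fun do rewrite expr0; exact: bdisc_cst.
by under eq_fun do rewrite exprS; exact: bdiscM.
Qed.

Lemma cdiffXn n (z : C) : cdiff (fun w => w ^+ n) z (n%:R * z ^+ n.-1).
Proof.
elim: n => [|n IH].
  rewrite mul0r => s t s' _ _; rewrite mul0r; apply: (cder_ext (cder_cst 1 t)) => u.
  by rewrite expr0.
move=> s t s' st hs; have := cdiffM (cdiff_id z) IH s t s' st hs.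
move=> h; apply: (cder_ext (cder_eq h _)); last by move=> u; rewrite exprS.
by case: n {h IH} => [|n]; rewrite ?expr0 ?exprS /=; ring.
Qed.
End BoundedOnDiscs.
Arguments cdiffXn {R} n z.

Section RegionA.
Variables (R : realType) (a : R).
Hypothesis a0 : 0 < a.
Local Notation C := (Cplx R).
Implicit Types (z w xi : C) (b : R).

Definition wA z : C := z / (1 - z).
Definition PA z : C := cpow (1 - z) (cofR (- a)).

Let c1 : C := cofR (a * (a + 1) / 2).
Let c3 : C := cofR (2 * a * (a + 1) * (a + 2) / 3).
Let c4 : C := cofR (a * (a + 1) * (a + 2) * (a + 3) / 8).

(* The truncated bracket of the expansion and its first two derivatives in w. *)
Definition SA b w : C := 1 - c1 * w ^+ 2 * cofR b^-1
  + (c4 * w ^+ 4 + c3 * w ^+ 3 + c1 * w ^+ 2) * cofR (b ^- 2).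
Definition SA1 b w : C := - (c1 * (2 * w) * cofR b^-1)
  + (c4 * (4 * w ^+ 3) + c3 * (3 * w ^+ 2) + c1 * (2 * w)) * cofR (b ^- 2).
Definition SA2 b w : C := - (c1 * 2 * cofR b^-1)
  + (c4 * (12 * w ^+ 2) + c3 * (6 * w) + c1 * 2) * cofR (b ^- 2).

(** With T the b^-2 coefficient of [SA], this is z (PA T)'' / PA written in w; the prefactor w (1 +
    w) is z (1 + w)^2. *)
Definition resA w : C := w * (1 + w) *
  (cofR a * (cofR a + 1) * (c4 * w ^+ 4 + c3 * w ^+ 3 + c1 * w ^+ 2)
   + 2 * (cofR a + 1) * (1 + w) * (c4 * (4 * w ^+ 3) + c3 * (3 * w ^+ 2) + c1 * (2 * w))
   + (1 + w) ^+ 2 * (c4 * (12 * w ^+ 2) + c3 * (6 * w) + c1 * 2)).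

Definition AA b z := PA z * SA b (wA z).
Definition AA1 b z := let w := wA z in
  PA z * ((1 + w) * (cofR a * SA b w + (1 + w) * SA1 b w)).
Definition AA2 b z := let w := wA z in
  PA z * ((1 + w) ^+ 2 * (cofR a * (cofR a + 1) * SA b w
     + 2 * (cofR a + 1) * (1 + w) * SA1 b w + (1 + w) ^+ 2 * SA2 b w)).

Lemma cdiff_SA b w : cdiff (SA b) w (SA1 b w).
Proof.
refine (cdiff_eq (cdiffD (cdiffB (cdiff_cst 1 w)
   (cdiffM (cdiffM (cdiff_cst c1 w) (cdiffXn 2 w)) (cdiff_cst (cofR b^-1) w)))
   (cdiffM (cdiffD (cdiffD (cdiffM (cdiff_cst c4 w) (cdiffXn 4 w))
      (cdiffM (cdiff_cst c3 w) (cdiffXn 3 w))) (cdiffM (cdiff_cst c1 w) (cdiffXn 2 w)))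
      (cdiff_cst (cofR (b ^- 2)) w))) _).
by rewrite /SA1 /=; ring.
Qed.

Lemma cdiff_SA1 b w : cdiff (SA1 b) w (SA2 b w).
Proof.
refine (cdiff_eq (cdiffD (cdiffN
   (cdiffM (cdiffM (cdiff_cst c1 w) (cdiffM (cdiff_cst 2 w) (cdiff_id w))) (cdiff_cst (cofR b^-1) w)))
   (cdiffM (cdiffD (cdiffD (cdiffM (cdiff_cst c4 w) (cdiffM (cdiff_cst 4 w) (cdiffXn 3 w)))
      (cdiffM (cdiff_cst c3 w) (cdiffM (cdiff_cst 3 w) (cdiffXn 2 w))))
       (cdiffM (cdiff_cst c1 w) (cdiffM (cdiff_cst 2 w) (cdiff_id w))))
      (cdiff_cst (cofR (b ^- 2)) w))) _).
by rewrite /SA2 /=; ring.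
Qed.

Lemma bdisc_resA W : bdisc resA W.
Proof.
have I := bdisc_id W; have K := @bdisc_cst _ ^~ W; have X n := bdiscX n I.
have L := bdiscD (K 1) I.
exact: bdiscM (bdiscM I L) (bdiscD (bdiscD
  (bdiscM (K (cofR a * (cofR a + 1)))
    (bdiscD (bdiscD (bdiscM (K c4) (X 4%N)) (bdiscM (K c3) (X 3%N))) (bdiscM (K c1) (X 2%N))))
  (bdiscM (bdiscM (K (2 * (cofR a + 1))) L)
    (bdiscD (bdiscD (bdiscM (K c4) (bdiscM (K 4) (X 3%N)))
       (bdiscM (K c3) (bdiscM (K 3) (X 2%N)))) (bdiscM (K c1) (bdiscM (K 2) I)))))
  (bdiscM (bdiscX 2 L)
    (bdiscD (bdiscD (bdiscM (K c4) (bdiscM (K 12) (X 2%N)))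
       (bdiscM (K c3) (bdiscM (K 6) I))) (bdiscM (K c1) (K 2))))).
Qed.

Lemma wA1 z : 1 - z != 0 -> 1 + wA z = (1 - z)^-1.
Proof. by move=> h; rewrite /wA; field. Qed.

Lemma cdiff_1B z : cdiff (fun w : C => 1 - w) z (-1).
Proof. by apply: (cdiff_eq (cdiffB (cdiff_cst 1 z) (cdiff_id z))); rewrite sub0r. Qed.
Arguments cdiff_1B z : clear implicits.

Lemma cdiff_wA z : 1 - z != 0 -> cdiff wA z ((1 + wA z) ^+ 2).
Proof.
move=> h; refine (cdiff_eq (cdiffM (cdiff_id z)
  (cdiff_comp (F := fun w : C => w^-1) (G := fun w : C => 1 - w) (cdiffV h) (cdiff_1B z))) _).
by rewrite /wA; field.
Qed.
Arguments cdiff_wA {z} _.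

Lemma cdiff_PA z : slit (1 - z) -> cdiff PA z (cofR a * (1 + wA z) * PA z).
Proof.
move=> h; refine (cdiff_eq (cdiff_comp (F := fun w : C => cpow w (cofR (- a))) (G := fun w : C => 1 - w)
   (cdiff_cpow _ h) (cdiff_1B z)) _).
by rewrite wA1 ?slit_neq0// rmorphN /PA rmorphN /=; ring.
Qed.
Arguments cdiff_PA {z} _.

Lemma cdiff_AA b z : slit (1 - z) -> cdiff (AA b) z (AA1 b z).
Proof.
move=> h; refine (cdiff_eq (cdiffM (cdiff_PA h) (cdiff_comp (F := SA b) (G := wA)
   (@cdiff_SA _ _) (cdiff_wA (slit_neq0 h)))) _).
by rewrite /AA1 /=; ring.
Qed.

Lemma cdiff_AA1 b z : slit (1 - z) -> cdiff (AA1 b) z (AA2 b z).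
Proof.
move=> h; have dw := cdiff_wA (slit_neq0 h).
have d1w := cdiffD (cdiff_cst 1 z) dw.
refine (cdiff_eq (cdiffM (cdiff_PA h) (cdiffM d1w (cdiffD
  (cdiffM (cdiff_cst (cofR a) z) (cdiff_comp (F := SA b) (G := wA) (@cdiff_SA _ _) dw))
  (cdiffM d1w (cdiff_comp (F := SA1 b) (G := wA) (@cdiff_SA1 _ _) dw))))) _).
by rewrite /AA2 /=; ring.
Qed.

(** All derivatives are [PA] times polynomials in w, because 1 + w = 1 / (1 - z) and w' = (1 + w)^2.
    The constants [c1], [c3], [c4] make the orders b, 1 and b^-1 cancel; the second derivative of
    the last kept term has no partner and is the residual. *)
Lemma AA_ode b z : b != 0 -> slit (1 - z) ->
  z * AA2 b z = - (cofR b * (1 - z)) * AA1 b z + cofR (a * b) * AA b z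
    + PA z * cofR (b ^- 2) * resA (wA z).
Proof.
move=> b0 /slit_neq0 h; rewrite /AA /AA1 /AA2 /=.
have zE : z = wA z / (1 + wA z) by rewrite wA1// invrK /wA divfK.
have w1 : 1 + wA z != 0 by rewrite wA1// invr_eq0.
have z1 : 1 - z = (1 + wA z)^-1 by rewrite wA1// invrK.
rewrite z1 {1}zE; move: (wA z) w1 (PA z) => w w1 P {zE z1 h}.
have bC : cofR b != 0 by rewrite cofR_eq0.
rewrite /resA /SA /SA1 /SA2 /c1 /c3 /c4.
have -> : cofR b^-1 = (cofR b)^-1 by rewrite fmorphV.
have -> : cofR (b ^- 2) = (cofR b) ^- 2 by rewrite fmorphV rmorphXn.
have -> : cofR (a * b) = cofR a * cofR b by rewrite rmorphM.
have -> : cofR (a * (a + 1) / 2) = cofR a * (cofR a + 1) / 2 by field.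
have -> : cofR (2 * a * (a + 1) * (a + 2) / 3) = 2 * cofR a * (cofR a + 1) * (cofR a + 2) / 3 by field.
have -> : cofR (a * (a + 1) * (a + 2) * (a + 3) / 8) =
  cofR a * (cofR a + 1) * (cofR a + 2) * (cofR a + 3) / 8 by field.
move: (cofR a) (cofR b) bC => al be bC.
by field; rewrite bC w1.
Qed.
End RegionA.

(** * Error estimate along paths in region A *)

Section RegionAEstimate.
Variables (R : realType) (a : R).
Hypothesis a0 : 0 < a.
Local Notation C := (Cplx R).
Implicit Types (z w xi : C) (b : R).

Definition eA b z : C := kf a b z - AA a b z.
Definition eA1 b z : C := kf1 a b z - AA1 a b z.

Lemma cmod1 : cmod (1 : C) = 1.
Proof. by rewrite -(rmorph1 (@cofR R)) cmod_cofR normr1. Qed.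

Lemma cmod0 : cmod (0 : C) = 0.
Proof. by apply/eqP; rewrite cmod_eq0. Qed.

Lemma cmod_PA z : 1 - z != 0 -> cmod (PA a z) = cmod (1 - z) `^ (- a).
Proof. by move=> h; rewrite /PA cmod_cpow. Qed.

Lemma cmod_PA_le z dl : 0 < dl -> dl <= cmod (1 - z) -> cmod (PA a z) <= dl `^ (- a).
Proof.
move=> dl0 h; have m0 : 0 < cmod (1 - z) by exact: lt_le_trans h.
rewrite cmod_PA -?cmod_gt0// !powRN lef_pV2 ?posrE ?powR_gt0//.
by apply: ge0_ler_powR => //; rewrite ?nnegrE; exact: ltW.
Qed.

Lemma cmod_PA_ge z D : 0 < cmod (1 - z) -> cmod (1 - z) <= D -> D `^ (- a) <= cmod (PA a z).
Proof.
move=> m0 h; have D0 : 0 < D by exact: lt_le_trans h.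
rewrite cmod_PA -?cmod_gt0// !powRN lef_pV2 ?posrE ?powR_gt0//.
by apply: ge0_ler_powR => //; rewrite ?nnegrE; exact: ltW.
Qed.

(** Multiplied by [m], Kummer's equation takes the form required by [lyapunov], because
    [om s' = m s]. This covers both legs: [om = t], [m = 1] on a segment from 0, and [om = 1],
    [m = s' / s] away from 0. *)
Lemma A_path (dl D N ka : R) : 0 < dl -> 0 < ka -> exists2 M, 0 <= M &
  forall b, 0 < b -> 3 * N <= ka * b ->
  forall (s s' m : R -> C) (om om' : R -> R),
  (forall t, 0 <= t <= 1 ->
    [/\ cder s t (s' t), rder om t (om' t), 0 <= om t,
       cofR (om t) * s' t = m t * s t & slit (1 - s t)] /\
    [/\ dl <= cmod (1 - s t), cmod (s t) <= D & ka <= cre (m t * (1 - s t))] /\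
    [/\ `|om' t| <= N, cmod (m t) <= N, cmod (m t) * a <= N & cmod (s' t) <= N]) ->
  let V t := cmod (eA b (s t)) ^+ 2 + om t / b * cmod (eA1 b (s t)) ^+ 2 in
  V 1 + (M * b ^- 2 / b) ^+ 2 <=
    (V 0 + (M * b ^- 2 / b) ^+ 2) * expR ((8 * N ^+ 2 + 2) / ka).
Proof.
move=> dl0 ka0.
have [Br Br0 hBr] := bdisc_resA a (D / dl).
exists (`|N| * (dl `^ (- a) * Br)); first by rewrite !mulr_ge0 ?powR_ge0.
move=> b b0 hN s s' m om om' H.
have b2 : 0 <= b ^- 2 by rewrite invr_ge0 exprn_ge0 ?ltW.
set eps := _ * b ^- 2.
have eps0 : 0 <= eps by rewrite /eps !mulr_ge0 ?powR_ge0.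
have := @lyapunov R N ka b eps 0 1 (fun t => eA b (s t)) (fun t => eA1 b (s t))
  (fun t => (kf2 a b (s t) - AA2 a b (s t)) * s' t) (fun t => m t * (1 - s t)) (fun=> 0)
  (fun t => m t * cofR a)
  (fun t => - (m t * (PA a (s t) * cofR (b ^- 2) * resA a (wA (s t))))) s' om om'
  ka0 b0 hN eps0 ler01.
rewrite subr0 mulr1; apply => t t01.
have [[hs hom om0 oms hslit] [[hdl hD hka] [hom' hm hma hs']]] := H t t01.
have s1 := slit_neq0 hslit.
split; [split => //|split; [split => //|split => //]].
- have d : cdiff (eA b) (s t) (eA1 b (s t)).
    by apply: cdiffB; [exact: cdiff_kf|exact: cdiff_AA].
  exact: d.
- have d : cdiff (eA1 b) (s t) (kf2 a b (s t) - AA2 a b (s t)).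
    by apply: cdiffB; [exact: cdiff_kf1|exact: cdiff_AA1].
  exact: d.
- rewrite mulrCA oms.
  have -> : (kf2 a b (s t) - AA2 a b (s t)) * (m t * s t) =
     m t * (s t * kf2 a b (s t)) - m t * (s t * AA2 a b (s t)) by ring.
  rewrite kummer_ode// AA_ode ?gt_eqF// /eA /eA1 (rmorphM _ a b).
  ring.
- by rewrite cmod0; apply: le_trans (cmod_ge0 _) hs'.
- by rewrite cmodM cmod_cofR gtr0_norm.
- rewrite cmodN /eps (cmodM (m t)) (cmodM _ (resA a _)) (cmodM (PA a _)) cmod_cofR ger0_norm//.
  have hw : cmod (wA (s t)) <= D / dl.
    rewrite /wA cmodM cmodV; apply: ler_pM; rewrite ?cmod_ge0 ?invr_ge0 ?cmod_ge0//.
    by rewrite lef_pV2 ?posrE ?cmod_gt0.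
  have hP := cmod_PA_le dl0 hdl; have hr := hBr _ hw.
  have hm' : cmod (m t) <= `|N| := le_trans hm (ler_norm _).
  have h2 : cmod (PA a (s t)) * b ^- 2 * cmod (resA a (wA (s t))) <= dl `^ (- a) * Br * b ^- 2.
    by rewrite mulrAC ler_wpM2r// ler_pM ?cmod_ge0.
  rewrite -(mulrA `|N|) ler_pM ?cmod_ge0//.
  by rewrite !mulr_ge0 ?cmod_ge0.
Qed.

Lemma eA_at0 b : 0 < b -> eA b 0 = 0.
Proof.
move=> b0; rewrite /eA /AA.
have -> : wA (0 : C) = 0 by rewrite /wA mul0r.
have -> : SA a b 0 = 1 by rewrite /SA; ring.
have -> : PA a 0 = 1.
  by rewrite /PA subr0 -(rmorph1 (@cofR R)) cpow_gt0// powR1.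
rewrite mulr1.
have -> : kf a b 0 = 1; last by rewrite subrr.
rewrite /kf /cps (csum_shift (cbnd_expbnd (cbnd_kc a0 b0) (lexx (cmod 0)))).
rewrite expr0 mulr1 kc0 rmorph1; apply/eqP; rewrite -subr_eq0 addrAC subrr add0r; apply/eqP.
rewrite -[RHS](cps0 0) /cps; congr csum; apply/funext => k.
by rewrite expr0n /= mulr0 rmorph0 mul0r.
Qed.

(** On the segment t z the weight [om = t] vanishes at 0, so the energy starts at |eA 0|^2 = 0; the
    damping is Re (1 - t z) >= dl. The derivative is bounded with the weight b^-1, the one with
    which the second leg starts. *)
Lemma A_leg1 (dl D : R) : 0 < dl -> dl <= 1 -> 0 <= D -> exists M b0, 
  forall b, b0 <= b -> 0 < b /\ forall z, cmod z <= D -> cre z <= 1 - dl ->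
  cmod (eA b z) ^+ 2 + b^-1 * cmod (eA1 b z) ^+ 2 <= (M * b ^- 3) ^+ 2.
Proof.
move=> dl0 dl1 D0.
have [N1 Na ND] : [/\ 1 <= 1 + a + D, a <= 1 + a + D & D <= 1 + a + D] by have := a0; split; lra.
set N := 1 + a + D in N1 Na ND.
have [M M0 hM] := @A_path dl D N dl dl0 dl0.
exists (M * expR ((8 * N ^+ 2 + 2) / dl)), (3 * N / dl + 1) => b hb.
have N0 : 0 <= N by rewrite /N !addr_ge0// ltW.
have b0 : 0 < b by apply: lt_le_trans hb; rewrite ltr_wpDl// divr_ge0 ?mulr_ge0// ltW.
split => // z hzD hz.
have hN : 3 * N <= dl * b.
  by rewrite [leRHS]mulrC -ler_pdivrMr//; apply: le_trans hb; rewrite lerDl.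
have := hM b b0 hN (fun t => cofR t * z) (fun=> z) (fun=> 1) (fun t => t) (fun=> 1).
cbv beta zeta; rewrite !rmorph0 !rmorph1 !mul0r !mul1r eA_at0// cmod0 expr0n /= !add0r => H.
set e := M * b ^- 2 / b in H.
have eE : e = M * b ^- 3 by rewrite /e -mulrA -invfM -exprSr.
set K := expR _ in H *.
have K1 : 1 <= K.
  by rewrite -expR0 ler_expR divr_ge0 ?(ltW dl0)// addr_ge0// pmulr_rge0// sqr_ge0.
apply: (@le_trans _ _ (e ^+ 2 * K)).
  refine (le_trans _ (H _)); first by rewrite lerDl sqr_ge0.
  move=> t /andP[t0 t1].
  have hd : dl <= 1 - t * cre z.
    have [z0|z0] := leP (cre z) 0.
      by apply: (le_trans dl1); rewrite lerDl oppr_ge0 mulr_ge0_le0.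
    rewrite lerBrDr addrC -lerBrDr; apply: le_trans hz.
    by rewrite ler_piMl// ltW.
  have hre : cre (1 - cofR t * z) = 1 - t * cre z by rewrite !cE mul0r subr0.
  split; first split => //.
  - apply: (cder_eq (cderM (cder_cofR (rder_id t)) (cder_cst z t))).
    by rewrite mulr0 addr0 rmorph1 mul1r.
  - exact: rder_id.
  - by rewrite mul1r.
  - by apply: slit_cre; rewrite hre; exact: lt_le_trans hd.
  split; first split.
  - by apply: le_trans hd _; rewrite -hre; apply: le_trans (ler_norm _) (normr_cre_le _).
  - by rewrite cmodM cmod_cofR ger0_norm//; apply: le_trans hzD; rewrite ler_piMl ?cmod_ge0.
  - by rewrite mul1r hre.
  by rewrite cmod1 normr1 mul1r; split => //; exact: le_trans ND.
rewrite [leRHS](_ : _ = (e * K) ^+ 2); last by rewrite eE; ring.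
by rewrite (exprMn _ e K) ler_wpM2l ?(sqr_ge0 e)// ler_eXnr.
Qed.

End RegionAEstimate.

Section RegionALeg2.
Variables (R : realType) (a : R).
Hypothesis a0 : 0 < a.
Local Notation C := (Cplx R).
Implicit Types (z w xi : C) (b : R).

Lemma cre_div (p q : C) : cre (p / q) = (cre p * cre q + cim p * cim q) / cmod q ^+ 2.
Proof. by rewrite sqr_cmod; case: p => x y; case: q => u v; rewrite /cre /cim /=; ring. Qed.

(* Along [s t] both [cre (s t)] and [ln |s t|] are affine in [t], and the slope of
   [ln |s t| - cre (s t)] is at least [kp]. *)
Lemma A_leg2 (kp D : R) : 0 < kp -> kp <= 1 -> 1 <= D -> exists M b0,
  forall b, b0 <= b -> 0 < b /\ forall xi, cmod xi <= D -> 0 <= cre xi ->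
  expR (cre xi - 1 + 2 * kp) <= cmod xi ->
  cmod (eA a b xi) <= M * b ^- 3.
Proof.
move=> kp0 kp1 D1; have a0' := a0.
pose dl := kp * expR (-1).
have dl0 : 0 < dl by rewrite mulr_gt0 ?expR_gt0.
pose N1 := D + (D + 2) * D ^+ 2 / dl.
have D2 : 0 <= D ^+ 2 by exact: sqr_ge0.
have N10 : 0 <= N1 by rewrite /N1 addr_ge0 ?divr_ge0 ?mulr_ge0 ?(ltW dl0)//; lra.
pose N := N1 * expR 1 * (1 + a) + 1.
have e1 : 1 <= expR 1 :> R by rewrite -[leLHS]expR0 ler_expR.
(* The first leg is taken with margin 1, that is for Re z <= 0, because the second leg starts on the
   imaginary axis. *)
have [M1 [b1 leg1]] := A_leg1 a0 ltr01 (lexx 1) (le_trans ler01 D1).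
have [M2 M20 leg2] := @A_path R a a0 dl D N kp dl0 kp0.
set K := expR ((8 * N ^+ 2 + 2) / kp).
have K1 : 1 <= K.
  by rewrite -expR0 ler_expR divr_ge0 ?(ltW kp0)// addr_ge0// pmulr_rge0// sqr_ge0.
exists ((`|M1| + M2) * K), (Num.max b1 (3 * N / kp)) => b.
rewrite ge_max => /andP[/leg1[b0 {}leg1] hb2]; split => // xi hD x0 hxi.
have hN : 3 * N <= kp * b by rewrite [leRHS]mulrC -ler_pdivrMr.
have {}leg2 := leg2 b b0 hN.
set x := cre xi in x0 hxi *; set U := ln (cmod xi).
have m0 : 0 < cmod xi by apply: lt_le_trans hxi; exact: expR_gt0.
have expU : expR U = cmod xi by rewrite lnK.
have hU : x - 1 + 2 * kp <= U by rewrite -ler_expR expU.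
have xD : x <= D by apply: le_trans hD; apply: le_trans (ler_norm _) (normr_cre_le _).
have UD : U <= D by apply: le_trans hD; apply/ltW/ln_sublinear.
(* The curve starts at an imaginary point of modulus exp (kp - 1). Half of the margin [2 * kp] is
   spent on this start, and the other half makes the slope [L] of ln |s| exceed the slope x of Re s
   by at least kp. *)
pose u0 := kp - 1; pose L := U - u0; pose u t := u0 + t * L.
have L0 : x + kp <= L by rewrite /L /u0; lra.
have LD : L <= D + 1 by rewrite /L /u0; lra.
pose q t := expR (2 * u t) - (t * x) ^+ 2.
have u_ge t : 0 <= t -> kp - 1 + t * x <= u t.
  by move=> t0; rewrite /u /u0 lerD2l ler_wpM2l//; lra.
have u_le t : t <= 1 -> u t <= U.
  move=> t1; rewrite /u; have -> : U = u0 + 1 * L by rewrite /L; ring.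
  by rewrite lerD2l ler_wpM2r//; lra.
have exp2 t : expR (2 * u t) = expR (u t) ^+ 2 by rewrite mulr_natl -[2%N]/(1 + 1)%N mulrnDr !mulr1n expRD expr2.
(* With v = t x, |s| >= exp (kp + v - 1) >= (1 + kp) exp (v - 1), and exp (v - 1) >= v; the excess
   over v is at least kp exp (-1), the constant [dl]. It keeps the imaginary part of s away from
   0. *)
have gap t : 0 <= t -> dl <= expR (u t) - t * x.
  move=> t0; have tx0 : 0 <= t * x by rewrite mulr_ge0.
  have h1 := expR_ge1Dx (t * x - 1).
  have h2 := expR_ge1Dx kp.
  have h3 : expR (-1) <= expR (t * x - 1) by rewrite ler_expR; lra.
  have h4 : expR kp * expR (t * x - 1) <= expR (u t).
    by rewrite -expRD ler_expR; have := u_ge t t0; lra.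
  have h5 : (1 + kp) * expR (t * x - 1) <= expR kp * expR (t * x - 1).
    by rewrite ler_wpM2r ?expR_ge0.
  have h6 : kp * expR (-1) <= kp * expR (t * x - 1) by rewrite ler_wpM2l// ltW.
  by rewrite /dl; lra.
have q_ge t : 0 <= t -> dl ^+ 2 <= q t.
  move=> t0; have tx0 : 0 <= t * x by rewrite mulr_ge0.
  have g := gap t t0; rewrite /q exp2.
  have h : dl ^+ 2 <= (expR (u t) - t * x) ^+ 2 by rewrite lerXn2r ?nnegrE ?(ltW dl0)// (le_trans (ltW dl0)).
  by apply: le_trans h _; nra.
have q_gt0 t : 0 <= t -> 0 < q t by move=> /q_ge; apply: lt_le_trans; rewrite exprn_gt0.
have sq_ge t : 0 <= t -> dl <= Num.sqrt (q t).
  by move=> t0; rewrite -(ger0_norm (ltW dl0)) -sqrtr_sqr ler_wsqrtr ?q_ge.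
(* Here |xi| > Re xi >= 0, so xi is not real; the sign of Im xi decides in which half-plane the
   whole curve lies. *)
pose sg := Num.sg (cim xi).
have q1 : q 1 = cim xi ^+ 2.
  have -> : q 1 = expR (u 1) ^+ 2 - x ^+ 2 by rewrite /q exp2 mul1r.
  have -> : u 1 = U by rewrite /u /L; ring.
  by rewrite expU sqr_cmod /x; ring.
have y0 : cim xi != 0.
  by have := q_gt0 1 ler01; rewrite q1; apply: contraTneq => ->; rewrite expr0n ltxx.
have sg2 : sg ^+ 2 = 1 by rewrite /sg sqr_sg y0.
have sgn : `|sg| = 1 by rewrite /sg normr_sg y0.
pose s t : C := Complex (t * x) (sg * Num.sqrt (q t)).
pose dq t := 2 * L * expR (2 * u t) - 2 * t * x ^+ 2.
pose s' t : C := Complex x (sg * (dq t / (2 * Num.sqrt (q t)))).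
have cmod_s t : 0 <= t -> cmod (s t) = expR (u t).
  move=> t0; rewrite /cmod; have -> : cre (s t) = t * x by [].
  have -> : cim (s t) = sg * Num.sqrt (q t) by [].
  rewrite exprMn [(sg * _) ^+ 2]exprMn sg2 mul1r sqr_sqrtr ?(ltW (q_gt0 _ t0))//.
  by rewrite /q exp2 -exprMn addrC subrK sqrtr_sqr ger0_norm ?expR_ge0.
have s0 t : 0 <= t -> s t != 0 by move=> t0; rewrite -cmod_gt0 cmod_s ?expR_gt0.
have s1E : s 1 = xi.
  apply: ceq; rewrite /s; first by rewrite /cre /= mul1r.
  by rewrite q1 sqrtr_sqr {1}/cim /= /sg -numEsg.
have s0cre : cre (s 0) = 0 by rewrite /cre /= mul0r.
have s0D : cmod (s 0) <= D.
  rewrite cmod_s// /u mul0r addr0; apply: le_trans D1; rewrite -expR0 ler_expR /u0; lra.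
have {}leg1 : cmod (eA a b (s 0)) ^+ 2 + b^-1 * cmod (eA1 a b (s 0)) ^+ 2 <= (M1 * b ^- 3) ^+ 2.
  by apply: leg1 => //; rewrite s0cre subrr.
have s'N1 t : 0 <= t -> t <= 1 -> cmod (s' t) <= N1.
  move=> t0 t1; apply: le_trans (cmod_le _) _.
  rewrite {1}/cre {1}/cim /= normrM sgn mul1r (ger0_norm x0); rewrite /N1. apply: lerD => //.
  have sqt0 : 0 < Num.sqrt (q t) by rewrite sqrtr_gt0 q_gt0.
  have -> : dq t / (2 * Num.sqrt (q t)) = (L * expR (2 * u t) - t * x ^+ 2) / Num.sqrt (q t).
    by rewrite /dq; field; rewrite gt_eqF.
  rewrite normrM normfV (gtr0_norm sqt0) ler_pM ?invr_ge0 ?(ltW sqt0)//; last first.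
    by rewrite lef_pV2 ?posrE// sq_ge.
  apply: le_trans (ler_normB _ _) _.
  have eu : expR (2 * u t) <= D ^+ 2.
    rewrite exp2 lerXn2r ?nnegrE ?expR_ge0 ?(le_trans ler01)//.
    by apply: le_trans hD; rewrite -expU ler_expR u_le.
  have x2 : x ^+ 2 <= D ^+ 2 by rewrite lerXn2r ?nnegrE ?(le_trans x0).
  have l1 : `|L * expR (2 * u t)| <= (D + 1) * D ^+ 2.
    rewrite ger0_norm; last by rewrite mulr_ge0 ?expR_ge0//; lra.
    by rewrite ler_pM ?expR_ge0//; lra.
  have l2 : `|t * x ^+ 2| <= 1 * D ^+ 2.
    by rewrite ger0_norm ?mulr_ge0 ?sqr_ge0// ler_pM ?sqr_ge0.
  by apply: le_trans (lerD l1 l2) _; lra.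
have N1N : N1 * expR 1 <= N /\ N1 * expR 1 * a <= N /\ N1 <= N.
  have p1 : 0 <= N1 * expR 1 by rewrite mulr_ge0 ?expR_ge0.
  have p2 : 0 <= N1 * expR 1 * a by rewrite mulr_ge0 ?(ltW a0).
  have p3 : N1 <= N1 * expR 1 by rewrite ler_peMr.
  by rewrite /N; clear -p1 p2 p3; split; [|split]; lra.
have := leg2 s s' (fun t => s' t / s t) (fun=> 1) (fun=> 0).
cbv beta zeta; rewrite !mul1r s1E => {}leg2.
set e2 := M2 * b ^- 2 / b in leg2.
have e2E : e2 = M2 * b ^- 3 by rewrite /e2 -mulrA -invfM -exprSr.
have {}leg2 : cmod (eA a b xi) ^+ 2 <= ((M1 * b ^- 3) ^+ 2 + e2 ^+ 2) * K.
  refine (le_trans _ (le_trans (leg2 _) _)).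
  - by rewrite -addrA lerDl addr_ge0 ?sqr_ge0// mulr_ge0 ?sqr_ge0// invr_ge0 ltW.
  - move=> t /andP[t0 t1].
    have sqt0 : 0 < Num.sqrt (q t) by rewrite sqrtr_gt0 q_gt0.
    have im1s : cim (1 - s t) = - (sg * Num.sqrt (q t)) by rewrite !cE sub0r.
    have hm : cmod (s' t / s t) <= N1 * expR 1.
      rewrite cmodM cmodV ler_pM ?cmod_ge0 ?invr_ge0 ?cmod_ge0 ?s'N1//.
      rewrite cmod_s// -expRN ler_expR lerNl.
      have := u_ge t t0; have : 0 <= t * x by rewrite mulr_ge0.
      lra.
    split; first split => //.
    + have hq : rder q t (dq t).
        refine (rder_eq (rderB (rder_exp (rderM (rder_cst 2 t) (rderD (rder_cst u0 t)
            (rderM (rder_id t) (rder_cst L t))))) (rderX 2 (rderM (rder_id t) (rder_cst x t)))) _).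
        by rewrite /dq /u /=; ring.
      refine (cder_eq (cder_mk (rderM (rder_id t) (rder_cst x t))
        (rderM (rder_cst sg t) (rder_sqrt hq (q_gt0 t t0)))) _).
      by apply: ceq; rewrite /s' /cre /cim /=; ring.
    + exact: rder_cst.
    + by rewrite mul1r divfK ?s0.
    + by apply: slit_cim; rewrite im1s oppr_eq0 mulf_neq0 ?(gt_eqF sqt0)// -normr_eq0 sgn oner_eq0.
    split; first split.
    + apply: le_trans (normr_cim_le _); rewrite im1s normrN normrM sgn mul1r gtr0_norm//.
      exact: sq_ge.
    + by rewrite cmod_s//; apply: le_trans hD; rewrite -expU ler_expR u_le.
    (* The damping is Re (s' / s) - Re s', the difference L - x of the two constant slopes. *)
    + have -> : s' t / s t * (1 - s t) = s' t / s t - s' t by field; rewrite s0.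
      rewrite creD creN cre_div cmod_s// -exp2.
      have -> : cre (s' t) * cre (s t) + cim (s' t) * cim (s t) = L * expR (2 * u t).
        rewrite /s /s' /cre /cim /=.
        have -> : sg * (dq t / (2 * Num.sqrt (q t))) * (sg * Num.sqrt (q t)) = sg ^+ 2 * (dq t / 2).
          by field; rewrite gt_eqF.
        by rewrite sg2 /dq; field.
      rewrite mulfK ?gt_eqF ?expR_gt0// lerBrDr addrC.
      exact: L0.
    have [n1 [n2 n3]] := N1N; split.
    + by rewrite normr0; apply: le_trans n3.
    + exact: le_trans hm n1.
    + by apply: le_trans n2; rewrite ler_wpM2r// ltW.
    + by apply: le_trans n3; exact: s'N1.
  by rewrite ler_wpM2r ?(le_trans ler01 K1)// lerD2r.
have b3 : 0 <= b ^- 3 by rewrite invr_ge0 exprn_ge0 ?ltW.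
rewrite -(@ler_pXn2r _ 2%N) ?nnegrE ?cmod_ge0 ?mulr_ge0 ?addr_ge0 ?(le_trans ler01 K1)//.
apply: le_trans leg2 _; rewrite e2E.
have M1n : M1 ^+ 2 = `|M1| ^+ 2 by rewrite real_normK ?num_real.
have -> : ((M1 * b ^- 3) ^+ 2 + (M2 * b ^- 3) ^+ 2) * K =
  ((`|M1| ^+ 2 + M2 ^+ 2) * (b ^- 3) ^+ 2) * K by rewrite -M1n; ring.
have -> : ((`|M1| + M2) * K * b ^- 3) ^+ 2 = ((`|M1| + M2) ^+ 2 * (b ^- 3) ^+ 2) * K ^+ 2 by ring.
apply: ler_pM.
- by rewrite mulr_ge0 ?addr_ge0 ?sqr_ge0.
- exact: le_trans ler01 K1.
- rewrite ler_wpM2r ?sqr_ge0// sqrrD lerD2r lerDl.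
  by rewrite mulrn_wge0// mulr_ge0.
- by rewrite ler_eXnr.
Qed.
End RegionALeg2.

(** * Uniform bounds on compact sets *)

Section Compactness.
Variable R : realType.
Local Notation C := (Cplx R).
Implicit Types (K : set C) (f : C -> R).

Lemma cmod_lipschitz_continuous f :
  (forall z w : C, `|f z - f w| <= cmod (z - w)) -> continuous f.
Proof.
move=> h z.
have FF : Filter (nbhs z) := nbhs_filter z.
apply/(@cvgrPdist_lt _ _ _ _ FF) => e e0.
have e0C : 0 < cofR e by rewrite -(rmorph0 (@cofR R)) ltr_cofR.
near=> w; apply: le_lt_trans (h _ _) _; rewrite -ltr_cofR -normE.
have : ball z (cofR e) w by near: w; exact: nbhsx_ballx.
by rewrite -ball_normE.
Unshelve. all: by end_near. Qed.

Lemma continuous_cre : continuous (@cre R).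
Proof.
by apply: cmod_lipschitz_continuous => z w; rewrite -creN -creD; exact: normr_cre_le.
Qed.

Lemma continuous_cmod : continuous (@cmod R).
Proof.
apply: cmod_lipschitz_continuous => z w; rewrite ler_norml; apply/andP; split.
  by have := cmodD (w - z) z; rewrite subrK -(cmodN (w - z)) opprB; lra.
by have := cmodD (z - w) w; rewrite subrK; lra.
Qed.

Lemma compact_lower K f : compact K -> continuous f -> (forall z, K z -> 0 < f z) ->
  exists2 d, 0 < d & forall z, K z -> d <= f z.
Proof.
move=> cK cf f0; have [->|K0] := eqVneq K set0; first by exists 1.
have Kn : K !=set0 by exact/set0P.
have [c cin hc] := compact_EVT_min Kn cK (continuous_subspaceT cf).
exists (f c); first by apply: f0; rewrite inE in cin.
by move=> z Kz; apply: hc; rewrite inE.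
Qed.

Lemma compact_cmod_le K : compact K -> exists2 D, 1 <= D & forall z, K z -> cmod z <= D.
Proof.
move=> cK; have [->|K0] := eqVneq K set0; first by exists 1.
have Kn : K !=set0 by exact/set0P.
have [c cin hc] := compact_EVT_max Kn cK (continuous_subspaceT continuous_cmod).
exists (1 + cmod c); first by rewrite lerDl cmod_ge0.
by move=> z Kz; rewrite ler_wpDl// hc// inE.
Qed.

End Compactness.

(** * Uniform expansion on compact subsets of A *)

Section PartA.
Variables (R : realType) (a : R).
Hypothesis a0 : 0 < a.
Local Notation C := (Cplx R).

(** A defining function of region A that is continuous everywhere: exponentiating removes the
    singularity of the logarithm at 0. On a compact set it has a positive minimum. *)
Definition psiA (z : C) : R := Num.max (1 - cre z) (cmod z ^+ 2 - expR (2 * (cre z - 1))).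

Lemma continuous_psiA : continuous psiA.
Proof.
have hexp : continuous (fun z : C => expR (2 * (cre z - 1))).
  move=> z; have FF : Filter (nbhs z) := nbhs_filter z.
  apply: (@continuous_comp _ _ _ (fun z : C => 2 * (cre z - 1)) (@expR R)).
    apply: (@cvgM _ _ (nbhs z) FF); first exact: cvg_cst.
    by apply: (@cvgB _ _ _ (nbhs z) FF); [exact: continuous_cre|exact: cvg_cst].
  exact: continuous_expR.
move=> z; have FF : Filter (nbhs z) := nbhs_filter z.
apply: (@continuous_max _ _ (fun z : C => 1 - cre z)).
  by apply: (@cvgB _ _ _ (nbhs z) FF); [exact: cvg_cst|exact: continuous_cre].
apply: (@cvgB _ _ _ (nbhs z) FF); last exact: hexp.
by apply: (@cvgM _ _ (nbhs z) FF); exact: continuous_cmod.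
Qed.

Lemma psiA_gt0 z : regA z -> 0 < psiA z.
Proof.
rewrite /regA /psiA /= lt_max subr_gt0 subr_gt0 => -[->//|h].
have [x1|x1] := ltP (cre z) 1; first by [].
rewrite -sqr_cmod in h; rewrite /=.
have m0 : 0 < cmod z ^+ 2.
  rewrite exprn_gt0//; apply: lt_le_trans (le_trans (ler_norm _) (normr_cre_le z)).
  exact: lt_le_trans x1.
by rewrite -[ltRHS](@lnK _ (cmod z ^+ 2)) ?posrE// ltr_expR; lra.
Qed.

Lemma partA_uniform (K : set C) : compact K -> K `<=` @regA R ->
  exists M b0, forall b, b0 <= b -> 0 < b /\ forall xi, K xi -> cmod (eA a b xi) <= M * b ^- 3.
Proof.
move=> cK KA.
have [d d0 hd] := compact_lower cK continuous_psiA (fun z Kz => psiA_gt0 (KA z Kz)).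
have [D D1 hD] := compact_cmod_le cK.
pose dl := Num.min d (1/2).
have dl0 : 0 < dl by rewrite lt_min d0 divr_gt0.
have dl1 : dl <= 1 / 2 by rewrite /dl ge_min lexx orbT.
have dld : dl <= d by rewrite /dl ge_min lexx.
(* Chosen so that exp (4 kp) = 1 + dl exp (- 2 D). Since exp (2 (x - 1)) exp (- 2 D) <= 1, the
   additive gap |xi|^2 >= exp (2 (x - 1)) + dl becomes the multiplicative one required by
   [A_leg2]. *)
pose kp := ln (1 + dl * expR (- (2 * D))) / 4.
have y0 : 0 < dl * expR (- (2 * D)) by rewrite mulr_gt0// expR_gt0.
have y1 : dl * expR (- (2 * D)) <= 1 / 2.
  by rewrite -[leRHS]mulr1 ler_pM ?expR_ge0 ?(ltW dl0)// -[leRHS]expR0 ler_expR; lra.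
have kp0 : 0 < kp by rewrite /kp divr_gt0// ln_gt0//; lra.
have kp1 : kp <= 1.
  have : ln (1 + dl * expR (- (2 * D))) <= dl * expR (- (2 * D)) by apply: le_ln1Dx; lra.
  by rewrite /kp; lra.
have [||M1 [b1 leg1]] := @A_leg1 R a a0 dl D dl0; [by lra|by lra|].
have [M2 [b2 leg2]] := A_leg2 a0 kp0 kp1 D1.
exists (`|M1| + `|M2|), (Num.max b1 b2) => b; rewrite ge_max => /andP[hb1 hb2].
have [b0 {}leg1] := leg1 b hb1; have [_ {}leg2] := leg2 b hb2.
have b3 : 0 <= b ^- 3 by rewrite invr_ge0 exprn_ge0 ?ltW.
split => // xi Kxi; have xiD := hD _ Kxi.
have := hd _ Kxi; rewrite /psiA le_max => /orP h.
(* To the left of 1 - dl the segment alone suffices. To the right, 1 - Re xi < dl <= d rules out the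
   first alternative in [psiA], so the gap in |xi|^2 is available. *)
have [x1|x1] := leP (cre xi) (1 - dl).
  have h2 : cmod (eA a b xi) ^+ 2 <= (M1 * b ^- 3) ^+ 2.
    apply: le_trans (leg1 xi xiD x1); rewrite lerDl mulr_ge0 ?sqr_ge0//.
    by rewrite invr_ge0 ltW.
  have h3 : cmod (eA a b xi) <= `|M1 * b ^- 3|.
    rewrite -(@ler_pXn2r _ 2%N) ?nnegrE ?cmod_ge0//; apply: le_trans h2 _.
    by rewrite real_normK ?num_real.
  apply: le_trans h3 _; rewrite normrM (ger0_norm b3) ler_wpM2r// lerDl//.
case: h => [h|h]; first by lra.
have x0 : 0 <= cre xi by lra.
have xD : cre xi <= D by apply: le_trans xiD; apply: le_trans (ler_norm _) (normr_cre_le _).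
have m0 : 0 <= cmod xi := cmod_ge0 xi.
apply: (@le_trans _ _ (M2 * b ^- 3)); last first.
  by rewrite ler_wpM2r// (le_trans (ler_norm _))// lerDr.
apply: leg2 => //.
rewrite -(@ler_pXn2r _ 2%N) ?nnegrE ?expR_ge0//.
have -> : expR (cre xi - 1 + 2 * kp) ^+ 2 = expR (2 * (cre xi - 1)) * expR (4 * kp).
  by rewrite -expRM_natl -expRD; congr expR; ring.
have -> : expR (4 * kp) = 1 + dl * expR (- (2 * D)).
  by rewrite /kp mulrC divfK// lnK// posrE; lra.
have : expR (2 * (cre xi - 1)) * expR (- (2 * D)) <= 1.
  by rewrite -expRD -[leRHS]expR0 ler_expR; lra.
by nra.
Qed.

(** The bound on [eA] is absolute; it becomes relative because 0 < |1 - xi| <= 1 + D gives |P| >= (1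
    + D)^(-a). The point 1 lies outside A. *)
Lemma theorem_partA (K : set C) : compact K -> K `<=` @regA R ->
   exists (M b0 : R), forall b : R, b0 <= b -> forall xi : Cplx R, K xi ->
     let w := xi / (1 - xi) in
     let P := cpow (1 - xi) (cofR (- a)) in
     let S := 1 - cofR (a * (a + 1) / 2) * w ^+ 2 * cofR (b^-1)
              + (cofR (a * (a + 1) * (a + 2) * (a + 3) / 8) * w ^+ 4
                 + cofR (2 * a * (a + 1) * (a + 2) / 3) * w ^+ 3
                 + cofR (a * (a + 1) / 2) * w ^+ 2) * cofR (b ^- 2) in
     `|F11 a b (cofR b * xi) - P * S| <= cofR (M * b ^- 3) * `|P|.
Proof.
move=> cK KA; have [M [b0 h]] := partA_uniform cK KA.
have [D D1 hD] := compact_cmod_le cK.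
have c0 : 0 < (1 + D) `^ (- a) by rewrite powR_gt0//; lra.
exists (`|M| / (1 + D) `^ (- a)), b0 => b /h[bp {}h] xi Kxi.
rewrite -[X in is_true X]/(`|F11 a b (cofR b * xi) - AA a b xi| <=
  cofR (`|M| / (1 + D) `^ (- a) * b ^- 3) * `|PA a xi|).
have xi1 : 0 < cmod (1 - xi).
  rewrite cmod_gt0 subr_eq0; apply/eqP => x1; have := KA _ Kxi; rewrite -x1.
  move=> []; rewrite ?cre1 ?cim1 ?ltxx// expr1n expr0n addr0 ln1 mulr0 !subrr ltxx //.
have P1 : (1 + D) `^ (- a) <= cmod (PA a xi).
  apply: cmod_PA_ge => //; apply: le_trans (cmodB _ _) _; rewrite cmod1 lerD2l.
  exact: hD.
rewrite F11_kf// !normE -rmorphM /= ler_cofR.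
apply: le_trans (h xi Kxi) _.
have b3 : 0 <= b ^- 3 by rewrite invr_ge0 exprn_ge0 ?ltW.
rewrite mulrAC ler_wpM2r//.
apply: le_trans (ler_norm _) _; rewrite -mulrA ler_peMr//.
by rewrite mulrC ler_pdivlMr// mul1r.
Qed.

End PartA.

(** * The Gamma function and Stirling's formula *)

Section GammaIntegral.
Variable R : realType.
Implicit Types (x t : R) (n : nat).
Local Notation mu := (@lebesgue_measure R).

Definition gammaf x t : R := t `^ (x - 1) * expR (- t).
(** Compact intervals exhausting the open half-line, on which the fundamental theorem of calculus
    applies. The squared endpoints serve the substitution t = u^2 in [Gamma_half]. *)
Definition Igam n : set R := `[(n.+1%:R^-1) ^+ 2, n.+1%:R ^+ 2].

Lemma gammaf_ge0 x t : 0 <= gammaf x t.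
Proof. by rewrite mulr_ge0 ?powR_ge0 ?expR_ge0. Qed.

Lemma measurable_gammaf x : measurable_fun setT (gammaf x).
Proof.
apply: measurable_funM; first exact: measurable_powR.
by apply: measurableT_comp => //; exact: measurableT_comp.
Qed.

Lemma Igam_gt0 n t : Igam n t -> 0 < t.
Proof.
rewrite /Igam /= in_itv /= => /andP[+ _]; apply: lt_le_trans.
by rewrite exprn_gt0// invr_gt0.
Qed.

Lemma nondecreasing_Igam : nondecreasing_seq Igam.
Proof.
move=> m n mn; rewrite subsetEset => t; rewrite /Igam /= !in_itv /= => /andP[h1 h2].
apply/andP; split.
  apply: le_trans h1; rewrite lerXn2r ?nnegrE// lef_pV2 ?posrE// ler_nat ltnS//.
by apply: le_trans h2 _; rewrite lerXn2r ?nnegrE// ler_nat ltnS.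
Qed.

Lemma bigcup_Igam : \bigcup_n Igam n = `]0, +oo[%classic.
Proof.
apply/seteqP; split => t /=.
  by move=> [n _ /Igam_gt0 h]; rewrite in_itv /= h.
rewrite in_itv /= andbT => t0.
exists (Num.truncn (Num.max t t^-1)) => //; rewrite /Igam /= in_itv /=.
set m := (Num.truncn _).+1.
have h : Num.max t t^-1 < m%:R by exact: truncnS_gt.
have m1 : 1 <= m%:R :> R by rewrite ler1n.
have [h1 h2] : t < m%:R /\ t^-1 < m%:R.
  by move: h; rewrite gt_max => /andP[].
have m0 : 0 < m%:R :> R by apply: lt_le_trans m1.
have h3 : m%:R^-1 < t by rewrite -[t]invrK ltf_pV2 ?posrE ?invr_gt0.
apply/andP; split; rewrite expr2.
  by apply: le_trans (ltW h3); rewrite ler_piMl ?invr_ge0 ?(ltW m0)// invf_le1.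
by apply: le_trans (ltW h1) _; rewrite ler_peMl ?(ltW m0).
Qed.

Lemma rder_gammaf x t : 0 < t ->
  rder (fun u => u `^ x * expR (- u)) t (x * gammaf x t - gammaf (x + 1) t).
Proof.
move=> t0.
have h : rder (fun u : R => expR (x * ln u) * expR (- u)) t
   (x * gammaf x t - gammaf (x + 1) t).
  refine (rder_eq (rderM (rder_exp (rderM (rder_cst x t) (rder_ln (rder_id t) t0)))
     (rder_exp (rderN (rder_id t)))) _).
  have tx : t `^ (x - 1) = t `^ x / t.
    by rewrite powRB ?(gt_eqF t0) ?implybT// powRr1// ltW.
  rewrite /= /gammaf addrK tx /powR (gt_eqF t0).
  by field; rewrite gt_eqF.
apply: rder_near h _; near=> u; rewrite /powR gt_eqF//.
by near: u; exact: lt_nbhsr.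
Unshelve. all: by end_near. Qed.

Lemma continuous_gammaf x t : 0 < t -> {for t, continuous (gammaf x)}.
Proof. by move=> t0; have := rder_cont (rder_gammaf (x - 1) t0). Qed.

Lemma within_Igam_gammaf x n : {within Igam n, continuous (gammaf x)}.
Proof.
apply: continuous_in_subspaceT => t; rewrite inE => /Igam_gt0.
exact: continuous_gammaf.
Qed.

Lemma measurable_Igam n : measurable (Igam n).
Proof. exact: measurable_itv. Qed.
#[local] Hint Resolve measurable_Igam : core.

Lemma integrable_gammaf x n : mu.-integrable (Igam n) (EFin \o gammaf x).
Proof.
by apply: continuous_compact_integrable; [exact: segment_compact|exact: within_Igam_gammaf].
Qed.

Definition jgam n x : R := \int[mu]_(t in Igam n) gammaf x t.

Lemma EFin_Rintegral (D : set R) (f : R -> R) : measurable D -> mu.-integrable D (EFin \o f) ->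
  (\int[mu]_(t in D) f t)%:E = (\int[mu]_(t in D) (f t)%:E)%E.
Proof. by move=> mD h; rewrite /Rintegral fineK//; exact: integrable_fin_num. Qed.

Lemma EFin_jgam n x : (jgam n x)%:E = (\int[mu]_(t in Igam n) (gammaf x t)%:E)%E.
Proof. by rewrite /jgam EFin_Rintegral; [|exact: measurable_Igam|exact: integrable_gammaf]. Qed.

Lemma jgam_cvg x : (jgam n x)%:E @[n --> \oo] --> (\int[mu]_(t in `[0%R, +oo[) (gammaf x t)%:E)%E.
Proof.
rewrite -integral_itv_obnd_cbnd; last first.
  by apply/measurable_EFinP; exact: measurable_funS (measurable_gammaf x).
rewrite -bigcup_Igam; under eq_fun do rewrite EFin_jgam.
apply: ge0_nondecreasing_set_cvg_integral.
- exact: nondecreasing_Igam.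
- by move=> n; exact: measurable_itv.
- by move=> n; apply/measurable_EFinP; exact: measurable_funS (measurable_gammaf x).
- by move=> n t _; rewrite lee_fin gammaf_ge0.
Qed.

(** Integration by parts on a compact interval: t^x exp (-t) is a primitive of
    [x * gammaf x - gammaf (x + 1)]. *)
Lemma jgamS n x : jgam n (x + 1) = x * jgam n x -
  ((n.+1%:R ^+ 2) `^ x * expR (- n.+1%:R ^+ 2)
   - ((n.+1%:R^-1) ^+ 2) `^ x * expR (- (n.+1%:R^-1) ^+ 2)).
Proof.
pose F t := t `^ x * expR (- t).
pose f t := x * gammaf x t - gammaf (x + 1) t.
(* For n = 0 the interval is the single point 1, so both integrals and the boundary term vanish. *)
have [E|lt] := eqVneq n 0%N.
  rewrite E invr1 !expr1n subrr subr0 /jgam /Igam invr1 expr1n set_itv1.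
  by rewrite !Rintegral_set1 mulr0.
have ab : (n.+1%:R^-1) ^+ 2 < (n.+1%:R : R) ^+ 2.
  rewrite ltrXn2r ?nnegrE// (@le_lt_trans _ _ 1)// ?invf_le1// ?ler1n//.
  by rewrite ltr1n ltnS lt0n.
have cf : {within Igam n, continuous f}.
  apply: continuous_in_subspaceT => t; rewrite inE => /Igam_gt0 t0.
  apply: cvgB; last exact: continuous_gammaf.
  by apply: cvgM; [exact: cvg_cst|exact: continuous_gammaf].
have dF t : 0 < t -> rder F t (f t) by exact: rder_gammaf.
have a0 : 0 < (n.+1%:R^-1) ^+ 2 :> R by rewrite exprn_gt0// invr_gt0.
have b0 : 0 < n.+1%:R ^+ 2 :> R by rewrite exprn_gt0.
have h := @continuous_FTC2 R f F _ _ ab cf.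
have {h} : (\int[mu]_(t in Igam n) (f t)%:E)%E = (F (n.+1%:R ^+ 2) - F ((n.+1%:R^-1) ^+ 2))%:E.
  apply: h.
  - split.
    + move=> t; rewrite in_itv /= => /andP[h _]; have [+ _] := dF t (lt_trans a0 h); exact.
    + by apply: cvg_at_right_filter; exact: rder_cont (dF _ a0).
    + by apply: cvg_at_left_filter; exact: rder_cont (dF _ b0).
  - move=> t; rewrite in_itv /= => /andP[h _]; rewrite derive1E.
    by have [_ +] := dF t (lt_trans a0 h); exact.
rewrite -EFin_Rintegral; [|exact: measurable_Igam|]; last first.
  by apply: continuous_compact_integrable; [exact: segment_compact|exact: cf].
move=> [h]; have ig y := integrable_gammaf y n.
have igx : mu.-integrable (Igam n) (EFin \o (fun t => x * gammaf x t)).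
  apply: (continuous_compact_integrable (f := fun t => x * gammaf x t)).
    exact: segment_compact.
  apply: continuous_in_subspaceT => t; rewrite inE => /Igam_gt0 t0.
  by apply: cvgM; [exact: cvg_cst|exact: continuous_gammaf].
rewrite /f RintegralB in h; [|exact: measurable_Igam|exact: igx|exact: ig].
rewrite RintegralZl in h; [|exact: measurable_Igam|exact: ig].
rewrite -/(jgam n x) -/(jgam n (x + 1)) in h.
have -> : jgam n (x + 1) = x * jgam n x - (x * jgam n x - jgam n (x + 1)) by ring.
by rewrite h.
Qed.

End GammaIntegral.

(** * Convergence of the Gamma integral and its functional equation *)

Section GammaFunction.
Variable R : realType.
Implicit Types (x t : R) (n : nat).
Local Notation mu := (@lebesgue_measure R).

(** The inequality ln v <= v at v = t / (2 p) gives t^p <= (2 p)^p exp (t / 2) for p > 0. The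
    summand 1 in the witness secures [1 <= D]. *)
Lemma powR_exp_bound (p : R) : 0 <= p -> exists2 D, 1 <= D &
  forall t, 0 < t -> t `^ p * expR (- t) <= D * expR (- (t / 2)).
Proof.
move=> p0; exists (1 + expR (p * ln (2 * p))); first by rewrite lerDl expR_ge0.
move=> t t0.
have h : t `^ p <= (1 + expR (p * ln (2 * p))) * expR (t / 2).
  have [->|pn0] := eqVneq p 0.
    rewrite powRr0 mul0r expR0; have := expR_ge1Dx (t / 2); lra.
  have pp : 0 < p by rewrite lt_def pn0.
  have l : p * ln t <= p * ln (2 * p) + t / 2.
    have h1 : 0 < t / (2 * p) by rewrite divr_gt0 ?mulr_gt0.
    have := ln_sublinear h1; rewrite ln_div ?posrE ?mulr_gt0// => h2.
    have : p * (ln t - ln (2 * p)) <= p * (t / (2 * p)) by rewrite ler_pM2l// ltW.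
    have -> : p * (t / (2 * p)) = t / 2 by field.
    lra.
  rewrite /powR (gt_eqF t0); apply: (@le_trans _ _ (expR (p * ln (2 * p)) * expR (t / 2))).
    by rewrite -expRD ler_expR.
  by rewrite ler_wpM2r ?expR_ge0// lerDr.
have -> : expR (- t) = expR (- (t / 2)) * expR (- (t / 2)) by rewrite -expRD; congr expR; lra.
rewrite mulrA ler_wpM2r ?expR_ge0//.
apply: le_trans (ler_wpM2r (expR_ge0 _) h) _.
by rewrite -mulrA -expRD addrN expR0 mulr1.
Qed.

Lemma integral_exp_half (D : R) : 0 <= D ->
  (\int[mu]_(t in `[0%R, +oo[) (D * expR (- (t / 2)))%:E = (2 * D)%:E)%E.
Proof.
move=> D0.
pose F (t : R) := - (2 * D) * expR (- (t / 2)).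
have dF t : rder F t (D * expR (- (t / 2))).
  refine (rder_eq (rderM (rder_cst _ t) (rder_exp (rderN (rderM (rder_id t) (rder_cst _ t))))) _).
  by rewrite /=; field.
rewrite (@ge0_continuous_FTC2y R _ F 0 0).
- by rewrite /F mul0r oppr0 expR0 mulr1 -EFinB sub0r opprK.
- by move=> t _; rewrite mulr_ge0 ?expR_ge0.
- apply: continuous_in_subspaceT => t _.
  by have := rder_cont (rderM (rder_cst D t)
      (rder_exp (rderN (rderM (rder_id t) (rder_cst (2^-1) t))))).
- rewrite -[X in _ --> X](mulr0 (- (2 * D))); apply: cvgM; first exact: cvg_cst.
  apply: (cvg_comp (fun t : R => t / 2) (fun u : R => expR (- u))); last exact: cvgr_expR.
  by apply: gt0_cvgMly => //; exact: cvg_id.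
- by move=> t _; have [+ _] := dF t; exact.
- by apply: cvg_at_right_filter; exact: rder_cont (dF 0).
- by move=> t _; rewrite derive1E; have [_ +] := dF t; exact.
Qed.

Lemma jgam_cvg_ge1 x : 1 <= x -> jgam n x @[n --> \oo] --> Gamma x.
Proof.
move=> x1; have [D D1 hD] : exists2 D, 1 <= D &
  forall t, 0 < t -> t `^ (x - 1) * expR (- t) <= D * expR (- (t / 2)).
  by apply: powR_exp_bound; rewrite subr_ge0.
have D0 : 0 <= D by apply: le_trans D1.
have fin : (\int[mu]_(t in `[0%R, +oo[) (gammaf x t)%:E < +oo)%E.
  apply: (@le_lt_trans _ _ (2 * D)%:E); last exact: ltry.
  rewrite -integral_exp_half//; apply: ge0_le_integral => //.
  - by move=> t _; rewrite lee_fin gammaf_ge0.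
  - by apply/measurable_EFinP; exact: measurable_funS (measurable_gammaf x).
  - apply/measurable_EFinP; apply: (measurable_funS measurableT) => //.
    apply: measurable_funM => //; apply: measurableT_comp => //.
    by apply: measurableT_comp => //; apply: measurable_funM.
  - move=> t; rewrite /= in_itv /= andbT le_eqVlt lee_fin => /predU1P[<-|]; last exact: hD.
    rewrite /gammaf mul0r oppr0 expR0 !mulr1; apply: le_trans D1.
    by rewrite /powR eqxx; case: (_ == _).
have h := @jgam_cvg R x.
rewrite -[X in _ --> X](@fineK _ (\int[mu]_(t in `[0%R, +oo[) (gammaf x t)%:E)%E) in h; last first.
  rewrite ge0_fin_numE//; apply: integral_ge0 => t _; rewrite lee_fin; exact: gammaf_ge0.
by move/fine_cvgP : h => [_].
Qed.

Lemma jgam_boundary x : 0 < x ->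
  ((n.+1%:R ^+ 2) `^ x * expR (- n.+1%:R ^+ 2)
   - ((n.+1%:R^-1) ^+ 2) `^ x * expR (- (n.+1%:R^-1) ^+ 2) : R) @[n --> \oo] --> (0 : R).
Proof.
move=> x0; have [D D1 hD] := powR_exp_bound (ltW x0).
have D0 : 0 <= D by apply: le_trans D1.
rewrite -[X in _ --> X](subrr 0); apply: cvgB.
  apply: (squeeze_cvgr (f := fun=> 0) (h := fun n => 2 * D * n.+1%:R^-1)); last 2 first.
  - exact: cvg_cst.
  - rewrite -[X in _ --> X](mulr0 (2 * D)); apply: cvgM; first exact: cvg_cst.
    exact: cvg_harmonic.
  near=> n; rewrite mulr_ge0 ?powR_ge0 ?expR_ge0//=.
  have m1 : 1 <= n.+1%:R :> R by rewrite ler1n.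
  have t0 : 0 < n.+1%:R ^+ 2 :> R by rewrite exprn_gt0.
  apply: le_trans (hD _ t0) _.
  have hh : expR (- (n.+1%:R ^+ 2 / 2)) <= 2 / n.+1%:R :> R.
    rewrite expRN -[leRHS]invrK lef_pV2 ?posrE ?expR_gt0 ?invr_gt0 ?divr_gt0//.
    rewrite invfM invrK; apply: le_trans (ltW (expR_gt1Dx _)); last by rewrite gt_eqF// divr_gt0.
    have : n.+1%:R <= n.+1%:R ^+ 2 :> R by rewrite expr2 ler_peMr.
    by lra.
  apply: le_trans (ler_wpM2l D0 hh) _; rewrite le_eqVlt; apply/orP; left; apply/eqP; ring.
have h := @powR_cvg0 R x x0.
apply/cvgrPdist_lt => e e0.
move/cvgrPdist_lt/(_ e e0) : h => [d /= d0 hd].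
have /cvgrPdist_lt/(_ d d0) hh := @cvg_harmonic R.
near=> n; rewrite sub0r normrN ger0_norm ?mulr_ge0 ?powR_ge0 ?expR_ge0//.
have n0 : 0 < (n.+1%:R^-1) ^+ 2 :> R by rewrite exprn_gt0// invr_gt0.
apply: (@le_lt_trans _ _ (((n.+1%:R^-1) ^+ 2) `^ x)).
  by rewrite ler_piMr ?powR_ge0// -[leRHS]expR0 ler_expR oppr_le0 ltW.
have := hd ((n.+1%:R^-1) ^+ 2).
rewrite /ball_ /= !sub0r !normrN !ger0_norm ?powR_ge0 ?(ltW n0)//; apply => //.
have : `|0 - harmonic n| < d by near: n.
rewrite sub0r normrN ger0_norm ?invr_ge0// => hn; apply: le_lt_trans hn.
by rewrite expr2 ler_piMl// invf_le1// ler1n.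
Unshelve. all: by end_near. Qed.

(** [Gamma] is the finite part of an extended integral, so finiteness has to be shown. For x >= 1 an
    exponential dominates; for x < 1 the integrand is singular at 0, and finiteness is inherited
    from x + 1 through [jgamS]. *)
Lemma jgam_cvg_Gamma x : 0 < x -> jgam n x @[n --> \oo] --> Gamma x.
Proof.
move=> x0; have [/jgam_cvg_ge1//|x1] := leP 1 x.
have h1 : jgam n (x + 1) @[n --> \oo] --> Gamma (x + 1).
  by apply: jgam_cvg_ge1; rewrite lerDr ltW.
have h2 : jgam n x @[n --> \oo] --> x^-1 * (Gamma (x + 1) + 0).
  rewrite (_ : (fun n => jgam n x) = (fun n => x^-1 * (jgam n (x + 1) +
   ((n.+1%:R ^+ 2) `^ x * expR (- n.+1%:R ^+ 2)
   - ((n.+1%:R^-1) ^+ 2) `^ x * expR (- (n.+1%:R^-1) ^+ 2))))); last first.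
    by apply/funext => n; rewrite jgamS subrK mulKf// gt_eqF.
  by apply: cvgM; [exact: cvg_cst|apply: cvgD => //; exact: jgam_boundary].
have h3 : (\int[mu]_(t in `[0%R, +oo[) (gammaf x t)%:E)%E = (x^-1 * (Gamma (x + 1) + 0))%:E.
  rewrite -(cvg_lim (@ereal_hausdorff R) (@jgam_cvg R x)); apply: cvg_lim => //.
  by apply: cvg_EFin; [exact: nearW|exact: h2].
have -> : Gamma x = x^-1 * (Gamma (x + 1) + 0) by rewrite /Gamma /Rintegral h3.
exact: h2.
Qed.

Lemma GammaS x : 0 < x -> Gamma (x + 1) = x * Gamma x.
Proof.
move=> x0; have x10 : 0 < x + 1 by rewrite addr_gt0.
rewrite -(cvg_lim (@Rhausdorff R) (jgam_cvg_Gamma x10)); apply: cvg_lim => //.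
rewrite -[X in _ --> X]subr0.
under eq_fun do rewrite jgamS.
apply: cvgB; last exact: jgam_boundary.
by apply: cvgM; [exact: cvg_cst|exact: jgam_cvg_Gamma].
Qed.

Lemma Gamma1 : Gamma 1 = 1 :> R.
Proof.
pose F (t : R) := - expR (- t).
have dF t : rder F t (expR (- t)).
  refine (rder_eq (rderN (rder_exp (rderN (rder_id t)))) _); rewrite /=; ring.
rewrite /Gamma (_ : \int[mu]_(t in _) _ = \int[mu]_(t in `[0%R, +oo[) (expR (- t)))%R; last first.
  by apply: eq_Rintegral => t _; rewrite subrr powRr0 mul1r.
rewrite (@Rintegral_ge0_continuous_FTC2y R _ F 0 0).
- by rewrite /F oppr0 expR0 sub0r opprK.
- by move=> t _; exact: expR_ge0.
- apply: continuous_in_subspaceT => t _.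
  by have := rder_cont (rder_exp (rderN (rder_id t))).
- by rewrite -oppr0; apply: cvgN; exact: cvgr_expR.
- by move=> t _; have [+ _] := dF t; exact.
- by apply: cvg_at_right_filter; exact: rder_cont (dF 0).
- by move=> t _; rewrite derive1E; have [_ +] := dF t; exact.
Qed.

End GammaFunction.

(** * Wendel's inequality and special values of Gamma *)

Section GammaInequalities.
Variable R : realType.
Implicit Types (x s t : R) (n : nat).
Local Notation mu := (@lebesgue_measure R).

Lemma ln_le_sub1 t : 0 < t -> ln t <= t - 1.
Proof. by move=> t0; have := @le_ln1Dx R (t - 1); rewrite (_ : 1 + (t - 1) = t); [apply; lra|ring]. Qed.

(** Weighted arithmetic-geometric mean inequality for u and 1: the tangent bound ln v <= v - 1 is
    applied at u / m and 1 / m, where m is the mean. *)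
Lemma powR_tangent s u : 0 <= s -> s <= 1 -> 0 < u -> u `^ s <= (1 - s) + s * u.
Proof.
move=> s0 s1 u0; set m := (1 - s) + s * u.
have m0 : 0 < m.
  rewrite /m; have [->|sn] := eqVneq s 1; first by rewrite subrr add0r mul1r.
  by rewrite ltr_wpDr ?mulr_ge0 ?(ltW u0)// subr_gt0 lt_neqAle sn.
have h1 := ln_le_sub1 (divr_gt0 u0 m0); have h2 : ln m^-1 <= m^-1 - 1.
  by apply: ln_le_sub1; rewrite invr_gt0.
rewrite ln_div ?posrE// in h1; rewrite lnV ?posrE// in h2.
have e : s * (u / m) + (1 - s) * m^-1 = 1.
  by rewrite /m in m0 *; field; rewrite gt_eqF.
have k1 : s * (ln u - ln m) <= s * (u / m - 1) by rewrite ler_wpM2l.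
have k2 : (1 - s) * - ln m <= (1 - s) * (m^-1 - 1) by rewrite ler_wpM2l// subr_ge0.
rewrite /powR gt_eqF// -[leRHS]lnK ?posrE// ler_expR.
by lra.
Qed.

Lemma jgam_tangent n x s : 0 < x -> 0 <= s -> s <= 1 ->
  jgam n (x + s) <= x `^ s * ((1 - s) * jgam n x + s / x * jgam n (x + 1)).
Proof.
move=> x0 s0 s1.
have ig y := @integrable_gammaf R y n.
have cg y k : mu.-integrable (Igam n) (EFin \o (fun t => k * gammaf y t)).
  apply: (continuous_compact_integrable (f := fun t => k * gammaf y t)).
    exact: segment_compact.
  apply: continuous_in_subspaceT => t; rewrite inE => /Igam_gt0 t0.
  by apply: cvgM; [exact: cvg_cst|exact: continuous_gammaf].
pose k1 := x `^ s * (1 - s); pose k2 := x `^ s * (s / x).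
have -> : x `^ s * ((1 - s) * jgam n x + s / x * jgam n (x + 1)) =
   \int[mu]_(t in Igam n) (k1 * gammaf x t + k2 * gammaf (x + 1) t).
  rewrite RintegralD; [|exact: measurable_Igam|exact: cg|exact: cg].
  rewrite RintegralZl; [|exact: measurable_Igam|exact: ig].
  rewrite RintegralZl; [|exact: measurable_Igam|exact: ig].
  by rewrite -/(jgam n x) -/(jgam n (x + 1)) /k1 /k2; ring.
apply: le_Rintegral; [exact: measurable_Igam|exact: ig| |].
  apply: (continuous_compact_integrable (f := fun t => k1 * gammaf x t + k2 * gammaf (x + 1) t)).
    exact: segment_compact.
  apply: continuous_in_subspaceT => t; rewrite inE => /Igam_gt0 t0.
  apply: cvgD; (apply: cvgM; [exact: cvg_cst|exact: continuous_gammaf]).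
move=> t /Igam_gt0 t0.
have -> : gammaf (x + s) t = x `^ s * (t / x) `^ s * gammaf x t.
  rewrite -powRM ?(ltW x0) ?divr_ge0 ?(ltW t0) ?(ltW x0)//.
  have -> : x * (t / x) = t by field; rewrite gt_eqF.
  rewrite /gammaf mulrA -powRD ?(gt_eqF t0) ?implybT//; congr (_ `^ _ * _); ring.
have -> : gammaf (x + 1) t = t * gammaf x t.
  rewrite /gammaf mulrA -[X in X * t `^ _](powRr1 (ltW t0)) -powRD ?(gt_eqF t0) ?implybT//.
  by congr (_ `^ _ * _); ring.
have h := powR_tangent s0 s1 (divr_gt0 t0 x0).
have -> : k1 * gammaf x t + k2 * (t * gammaf x t) =
   x `^ s * ((1 - s) + s * (t / x)) * gammaf x t by rewrite /k1 /k2; ring.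
by rewrite ler_wpM2r ?gammaf_ge0// ler_wpM2l ?powR_ge0.
Qed.

(** Wendel's inequality. The pointwise bound (t / x)^s <= (1 - s) + s t / x is integrated, and the
    right side collapses because Gamma(x + 1) = x Gamma(x). *)
Lemma Gamma_tangent x s : 0 < x -> 0 <= s -> s <= 1 -> Gamma (x + s) <= x `^ s * Gamma x.
Proof.
move=> x0 s0 s1.
have h1 : jgam n (x + s) @[n --> \oo] --> Gamma (x + s).
  by apply: jgam_cvg_Gamma; rewrite ltr_wpDr.
have h2 : x `^ s * ((1 - s) * jgam n x + s / x * jgam n (x + 1)) @[n --> \oo] -->
   x `^ s * ((1 - s) * Gamma x + s / x * Gamma (x + 1)).
  apply: cvgM; first exact: cvg_cst.
  apply: cvgD; (apply: cvgM; first exact: cvg_cst); apply: jgam_cvg_Gamma => //.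
  by rewrite addr_gt0.
have -> : Gamma x = (1 - s) * Gamma x + s / x * Gamma (x + 1).
  by rewrite GammaS//; field; rewrite gt_eqF.
by apply: ler_cvg_to h1 h2 _; near=> n; exact: jgam_tangent.
Unshelve. all: by end_near. Qed.

Lemma GammaDn x n : 0 < x -> Gamma (x + n%:R) = poch x n * Gamma x.
Proof.
move=> x0; elim: n => [|n IH]; first by rewrite addr0 /poch big_ord0 mul1r.
rewrite (_ : x + n.+1%:R = x + n%:R + 1); last by rewrite -addrA natr1.
rewrite GammaS; last by rewrite ltr_wpDr.
rewrite IH /poch big_ord_recr /=.
by rewrite mulrA (mulrC (x + n%:R)).
Qed.

Lemma Gamma_natS n : Gamma (n.+1%:R) = n`!%:R :> R.
Proof.
elim: n => [|n IH]; first by rewrite Gamma1 fact0.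
by rewrite -natr1 GammaS// IH factS natrM.
Qed.

(** Wendel's inequality from x up to the next integer m + 1 bounds m! above by a positive multiple
    of Gamma(x). *)
Lemma Gamma_gt0 x : 0 < x -> 0 < Gamma x.
Proof.
move=> x0; set m := Num.truncn x.
have /andP[m1 m2] := truncn_itv (ltW x0).
have h : 0 < Gamma (m.+1%:R : R) by rewrite Gamma_natS ltr0n fact_gt0.
have := @Gamma_tangent x (m.+1%:R - x) x0.
rewrite (addrC x) subrK => hh.
have : Gamma (m.+1%:R : R) <= x `^ (m.+1%:R - x) * Gamma x.
  apply: hh; first by rewrite subr_ge0 ltW.
  by rewrite lerBlDr -natr1 addrC lerD2l.
by move/(lt_le_trans h); rewrite pmulr_rgt0// powR_gt0.
Qed.

(** The substitution t = u^2 turns the truncated integral into twice the Gaussian integral over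
    [1 / (n + 1), n + 1]. *)
Lemma Gamma_half : Gamma (1 / 2) = Num.sqrt pi :> R.
Proof.
pose S n : set R := `[n.+1%:R^-1, n.+1%:R]%classic.
have S0 n t : S n t -> 0 < t.
  by rewrite /S /= in_itv /= => /andP[+ _]; apply: lt_le_trans; rewrite invr_gt0.
have jE n : (jgam n (1 / 2))%:E = (\int[mu]_(t in S n) (2 * gauss_fun t)%:E)%E.
  rewrite EFin_jgam /Igam.
  have ab : n.+1%:R^-1 <= n.+1%:R :> R by rewrite (@le_trans _ _ 1)// ?invf_le1// ler1n.
  have dsq (t : R) : rder (fun u => u ^+ 2) t (2 * t).
    by apply: (rder_eq (rderX 2 (rder_id t))); rewrite /= expr1 mulr1.
  have dsqE : derive1 (fun u : R => u ^+ 2) = (fun t => 2 * t).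
    by apply/funext => t; rewrite derive1E; have [_ +] := dsq t; exact.
  have c2 : continuous (fun t : R => 2 * t).
    by move=> t; exact: rder_cont (rderM (rder_cst 2 t) (rder_id t)).
  rewrite (@integration_by_substitution_increasing R (fun u => u ^+ 2) _ _ _ ab).
  - apply: eq_integral => t; rewrite inE => /S0 t0; congr (_%:E).
    rewrite dsqE /= /gammaf /gauss_fun /=.
    rewrite -[LHS]/((t ^+ 2) `^ (1 / 2 - 1) * expR (- t ^+ 2) * (2 * t)).
    have -> : (t ^+ 2) `^ (1 / 2 - 1) = t^-1.
      rewrite /powR gt_eqF ?exprn_gt0// lnXn// -[RHS]lnK ?posrE ?invr_gt0//.
      by rewrite lnV ?posrE//; congr expR; rewrite mulr2n; field.
    by rewrite /=; field; rewrite gt_eqF.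
  - move=> u v; rewrite !in_itv /= => /andP[u0 _] /andP[v0 _] uv.
    have p0 : 0 < n.+1%:R^-1 :> R by rewrite invr_gt0.
    by rewrite ltrXn2r ?nnegrE// ltW// (lt_le_trans p0).
  - by rewrite dsqE => t _; exact: c2.
  - rewrite dsqE; apply/cvg_ex; exists (2 * n.+1%:R^-1); apply: cvg_at_right_filter; exact: c2.
  - rewrite dsqE; apply/cvg_ex; exists (2 * n.+1%:R); apply: cvg_at_left_filter; exact: c2.
  - split.
    + by move=> t _; have [+ _] := dsq t; exact.
    + by apply: cvg_at_right_filter; exact: rder_cont (dsq _).
    + by apply: cvg_at_left_filter; exact: rder_cont (dsq _).
  - exact: within_Igam_gammaf.
have mg : measurable_fun [set: R] (fun t : R => 2 * gauss_fun t).
  by apply: measurable_funM => //; exact: measurable_gauss_fun.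
have h : (jgam n (1 / 2 : R))%:E @[n --> \oo] --> (Num.sqrt pi : R)%:E.
  have -> : (Num.sqrt pi)%:E = (\int[mu]_(t in `[0%R, +oo[) (2 * gauss_fun t)%:E)%E :> \bar R.
    under eq_integral do rewrite EFinM.
    rewrite ge0_integralZl_EFin//.
    - by rewrite integral0y_gauss -EFinM; congr (_%:E); field.
    - by move=> t _; rewrite lee_fin gauss_fun_ge0.
    - by apply/measurable_EFinP; apply: measurable_funS measurable_gauss_fun.
  under eq_fun do rewrite jE.
  rewrite -integral_itv_obnd_cbnd; last first.
    by apply/measurable_EFinP; exact: measurable_funS mg.
  have -> : `]0, +oo[%classic = \bigcup_n S n.
    apply/seteqP; split => t /=; last first.
      by move=> [n _ /S0 h]; rewrite in_itv /= h.
    rewrite in_itv /= andbT => t0.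
    exists (Num.truncn (Num.max t t^-1)) => //; rewrite /S /= in_itv /=.
    set m := (Num.truncn _).+1.
    have h : Num.max t t^-1 < m%:R by exact: truncnS_gt.
    have [h1 h2] : t < m%:R /\ t^-1 < m%:R by move: h; rewrite gt_max => /andP[].
    by rewrite (ltW h1) andbT -[t]invrK lef_pV2 ?posrE ?invr_gt0// ltW.
  apply: ge0_nondecreasing_set_cvg_integral.
  - move=> m n mn; rewrite subsetEset => t; rewrite /S /= !in_itv /= => /andP[h1 h2].
    apply/andP; split; first by apply: le_trans h1; rewrite lef_pV2 ?posrE// ler_nat ltnS.
    by apply: le_trans h2 _; rewrite ler_nat ltnS.
  - by move=> n; exact: measurable_itv.
  - by move=> n; apply/measurable_EFinP; exact: measurable_funS mg.
  - by move=> n t _; rewrite lee_fin mulr_ge0// gauss_fun_ge0.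
have g := @jgam_cvg_Gamma R (1 / 2) (divr_gt0 ltr01 (ltr0n _ 2)).
have g' : (jgam n (1 / 2 : R))%:E @[n --> \oo] --> (Gamma (1 / 2 : R))%:E.
  by apply: cvg_EFin; [exact: nearW|exact: g].
have e : (Gamma (1 / 2 : R))%:E = (Num.sqrt pi : R)%:E.
  by rewrite -(cvg_lim (@ereal_hausdorff R) h) -(cvg_lim (@ereal_hausdorff R) g').
by case: e.
Qed.

End GammaInequalities.

(** * Stirling's remainder up to a constant *)

Section Stirling.
Variable R : realType.
Implicit Types (x y s t : R) (n : nat).

Lemma ln1D_upper y : 0 <= y -> ln (1 + y) <= y - y ^+ 2 / 2 + y ^+ 3 / 3.
Proof.
move=> y0.
pose f (u : R) := (u - u ^+ 2 / 2 + u ^+ 3 / 3) - ln (1 + u).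
have := @rder_ge0_ndecr R f (fun u => u ^+ 3 / (1 + u)) 0 y y0.
have -> : f 0 = 0 by rewrite /f addr0 ln1; ring.
rewrite {2}/f subr_ge0; apply => u /andP[u0 _].
  have u1 : 0 < 1 + u by rewrite ltr_pwDl.
  refine (rder_eq (rderB (rderD (rderB (rder_id u) (rderM (rderX 2 (rder_id u)) (rder_cst _ u)))
     (rderM (rderX 3 (rder_id u)) (rder_cst _ u)))
     (rder_ln (rderD (rder_cst 1 u) (rder_id u)) u1)) _).
  by rewrite /=; field; rewrite gt_eqF.
by rewrite divr_ge0 ?exprn_ge0// addr_ge0.
Qed.

Lemma ln1D_lower y : 0 <= y -> y - y ^+ 2 / 2 + y ^+ 3 / 3 - y ^+ 4 / 4 <= ln (1 + y).
Proof.
move=> y0.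
pose f (u : R) := ln (1 + u) - (u - u ^+ 2 / 2 + u ^+ 3 / 3 - u ^+ 4 / 4).
have := @rder_ge0_ndecr R f (fun u => u ^+ 4 / (1 + u)) 0 y y0.
have -> : f 0 = 0 by rewrite /f addr0 ln1; ring.
rewrite {2}/f subr_ge0; apply => u /andP[u0 _].
  have u1 : 0 < 1 + u by rewrite ltr_pwDl.
  refine (rder_eq (rderB (rder_ln (rderD (rder_cst 1 u) (rder_id u)) u1)
     (rderB (rderD (rderB (rder_id u) (rderM (rderX 2 (rder_id u)) (rder_cst _ u)))
     (rderM (rderX 3 (rder_id u)) (rder_cst _ u))) (rderM (rderX 4 (rder_id u)) (rder_cst _ u)))) _).
  by rewrite /=; field; rewrite gt_eqF.
by rewrite divr_ge0 ?exprn_ge0// addr_ge0.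
Qed.

Lemma ln1D_lower2 y : 0 <= y -> y - y ^+ 2 / 2 <= ln (1 + y).
Proof.
move=> y0.
pose f (u : R) := ln (1 + u) - (u - u ^+ 2 / 2).
have := @rder_ge0_ndecr R f (fun u => u ^+ 2 / (1 + u)) 0 y y0.
have -> : f 0 = 0 by rewrite /f addr0 ln1; ring.
rewrite {2}/f subr_ge0; apply => u /andP[u0 _].
  have u1 : 0 < 1 + u by rewrite ltr_pwDl.
  refine (rder_eq (rderB (rder_ln (rderD (rder_cst 1 u) (rder_id u)) u1)
     (rderB (rder_id u) (rderM (rderX 2 (rder_id u)) (rder_cst _ u)))) _).
  by rewrite /=; field; rewrite gt_eqF.
by rewrite divr_ge0 ?exprn_ge0// addr_ge0.
Qed.

(* The error term of Stirling's formula, corrected by its leading part 1/(12 x). *)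
Definition binet x : R := ln (Gamma x) - (x - 1 / 2) * ln x + x - (12 * x)^-1.

(** One step of the recurrence costs (x + 1/2) ln (1 + 1/x) - 1 - 1 / (12 x (x + 1)). The logarithm
    expanded to fourth order leaves at most x^-3, and the telescoping right-hand side dominates
    that. *)
Lemma binet_step x : 1 <= x -> `|binet x - binet (x + 1)| <= 2 * (x ^- 2 - (x + 1) ^- 2).
Proof.
move=> x1; have x0 : 0 < x by apply: lt_le_trans x1.
have y0 : 0 < x^-1 by rewrite invr_gt0.
have y1 : x^-1 <= 1 by rewrite invf_le1.
have E : binet x - binet (x + 1) = (x + 1 / 2) * ln (1 + x^-1) - 1 - (12 * x * (x + 1))^-1.
  rewrite /binet GammaS// lnM ?posrE ?Gamma_gt0//.
  have -> : x + 1 = x * (1 + x^-1) by field; rewrite gt_eqF.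
  rewrite [ln (x * _)]lnM ?posrE ?addr_gt0//.
  by field; rewrite !gt_eqF ?addr_gt0.
have F : x ^- 3 <= 2 * (x ^- 2 - (x + 1) ^- 2).
  rewrite -(ler_pM2r (_ : 0 < x ^+ 3 * (x + 1) ^+ 2)); last by rewrite mulr_gt0 ?exprn_gt0 ?addr_gt0.
  have -> : x ^- 3 * (x ^+ 3 * (x + 1) ^+ 2) = (x + 1) ^+ 2 by field; rewrite gt_eqF.
  have -> : 2 * (x ^- 2 - (x + 1) ^- 2) * (x ^+ 3 * (x + 1) ^+ 2) = 2 * x * (2 * x + 1).
    by field; rewrite !gt_eqF ?addr_gt0.
  nra.
apply: le_trans F; rewrite E.
have := ln1D_upper (ltW y0); have := ln1D_lower (ltW y0).
set y := x^-1 in y0 y1 *; have xy : x = y^-1 by rewrite /y invrK.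
rewrite xy; set l := ln _; move=> l1 l2.
have -> : (12 * y^-1 * (y^-1 + 1))^-1 = y ^+ 2 / (12 * (1 + y)).
  by field; rewrite !gt_eqF ?addr_gt0.
have -> : y^-1 ^- 3 = y ^+ 3 by rewrite exprVn invrK.
have p1 : 0 < y^-1 + 1 / 2 by rewrite addr_gt0 ?invr_gt0// divr_gt0.
have b1 : (y^-1 + 1 / 2) * l <= (y^-1 + 1 / 2) * (y - y ^+ 2 / 2 + y ^+ 3 / 3) by rewrite ler_pM2l.
have b2 : (y^-1 + 1 / 2) * (y - y ^+ 2 / 2 + y ^+ 3 / 3 - y ^+ 4 / 4) <= (y^-1 + 1 / 2) * l.
  by rewrite ler_pM2l.
have e1 : (y^-1 + 1 / 2) * (y - y ^+ 2 / 2 + y ^+ 3 / 3) = 1 + y ^+ 2 / 12 + y ^+ 3 / 6.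
  by field; rewrite gt_eqF.
have e2 : (y^-1 + 1 / 2) * (y - y ^+ 2 / 2 + y ^+ 3 / 3 - y ^+ 4 / 4) =
   1 + y ^+ 2 / 12 + y ^+ 3 / 6 - y ^+ 3 / 4 - y ^+ 4 / 8.
  by field; rewrite gt_eqF.
have q0 : 0 <= y ^+ 2 by rewrite sqr_ge0.
have c1 : y ^+ 2 / (12 * (1 + y)) <= y ^+ 2 / 12.
  by rewrite ler_wpM2l// lef_pV2 ?posrE ?mulr_gt0 ?addr_gt0//; lra.
have c2 : y ^+ 2 / 12 - y ^+ 3 / 12 <= y ^+ 2 / (12 * (1 + y)).
  have -> : y ^+ 2 / 12 - y ^+ 3 / 12 = y ^+ 2 / (12 * (1 + y)) * ((1 - y) * (1 + y)).
    by field; rewrite gt_eqF// addr_gt0.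
  rewrite ler_piMr ?divr_ge0 ?mulr_ge0 ?addr_ge0 ?(ltW y0)//; nra.
have d3 : 0 <= y ^+ 3 by rewrite exprn_ge0 ?ltW.
have d4 : y ^+ 4 <= y ^+ 3 by rewrite exprS ler_piMl.
rewrite ler_norml; apply/andP; split; lra.
Qed.

Lemma binet_dist x n : 1 <= x -> `|binet x - binet (x + n%:R)| <= 2 * (x ^- 2 - (x + n%:R) ^- 2).
Proof.
move=> x1; elim: n => [|n IH]; first by rewrite addr0 !subrr normr0 mulr0.
have h := @binet_step (x + n%:R).
rewrite (_ : x + n%:R + 1 = x + n.+1%:R) in h; last by rewrite -addrA natr1.
have -> : binet x - binet (x + n.+1%:R) =
  (binet x - binet (x + n%:R)) + (binet (x + n%:R) - binet (x + n.+1%:R)) by ring.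
apply: le_trans (ler_normD _ _) _.
have := h (ler_wpDr (ler0n R n) x1); lra.
Qed.

(** Wendel's inequality is used twice: from x to x + s, and from x + s to x + 1. It shows that the
    limit of [binet] is the same along all translates of the integers. *)
Lemma binet_shift x s : 1 <= x -> 0 <= s -> s <= 1 -> `|binet (x + s) - binet x| <= 2 / x.
Proof.
move=> x1 s0 s1; have x0 : 0 < x by apply: lt_le_trans x1.
have xs0 : 0 < x + s by rewrite ltr_wpDr.
have y0 : 0 <= s / x by rewrite divr_ge0// ltW.
have lE : ln (x + s) = ln x + ln (1 + s / x).
  rewrite -lnM ?posrE ?ltr_pwDl//; congr ln; by field; rewrite gt_eqF.
suff key (g0 g1 : R) : g1 <= s * ln x + g0 -> ln x + g0 <= (1 - s) * ln (x + s) + g1 ->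
    `|g1 - (x + s - 1 / 2) * ln (x + s) + (x + s) - (12 * (x + s))^-1
      - (g0 - (x - 1 / 2) * ln x + x - (12 * x)^-1)| <= 2 / x.
  apply: key.
  - rewrite -ln_powR -lnM ?posrE ?powR_gt0 ?Gamma_gt0// ler_ln ?posrE ?mulr_gt0 ?powR_gt0 ?Gamma_gt0//.
    exact: Gamma_tangent.
  - have e1 : ln x + ln (Gamma x) = ln (x * Gamma x) by rewrite lnM ?posrE ?Gamma_gt0.
    have e2 : ln ((x + s) `^ (1 - s)) + ln (Gamma (x + s)) =
        ln ((x + s) `^ (1 - s) * Gamma (x + s)) by rewrite lnM ?posrE ?powR_gt0 ?Gamma_gt0.
    rewrite -ln_powR e1 e2 ler_ln ?posrE ?mulr_gt0 ?powR_gt0 ?Gamma_gt0//.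
    rewrite -GammaS// (_ : x + 1 = (x + s) + (1 - s)); last by ring.
    by apply: Gamma_tangent; rewrite ?subr_ge0// lerBlDr lerDl.
move=> u1 u2.
have l1 := ln1D_lower2 y0.
have l2 : ln (1 + s / x) <= s / x by apply: le_ln1Dx; rewrite (lt_le_trans _ y0)// ltrN10.
have xi : 0 < x^-1 by rewrite invr_gt0.
have i1 : (12 * (x + s))^-1 <= (12 * x)^-1 by rewrite lef_pV2 ?posrE ?mulr_gt0//; lra.
have i2 : 0 < (12 * (x + s))^-1 by rewrite invr_gt0 mulr_gt0.
have i3 : (12 * x)^-1 = x^-1 / 12 by field; rewrite gt_eqF.
have k1 : (x + s - 1 / 2) * (s / x - (s / x) ^+ 2 / 2) <= (x + s - 1 / 2) * ln (1 + s / x).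
  by rewrite ler_wpM2l//; lra.
have k2 : (x + 1 / 2) * ln (1 + s / x) <= (x + 1 / 2) * (s / x) by rewrite ler_wpM2l//; lra.
have k3 : (x + 1 / 2) * (s / x) = s + s * x^-1 / 2 by field; rewrite gt_eqF.
have k4 : s - x^-1 <= (x + s - 1 / 2) * (s / x - (s / x) ^+ 2 / 2).
  have -> : (x + s - 1 / 2) * (s / x - (s / x) ^+ 2 / 2) =
     s - s * x^-1 / 2 + s ^+ 2 * x^-1 / 2 - (s - 1 / 2) * s ^+ 2 * x^-1 ^+ 2 / 2.
    by field; rewrite gt_eqF.
  have xi1 : x^-1 <= 1 by rewrite invf_le1.
  have s2 : s ^+ 2 <= s by rewrite expr2 ler_piMl.
  have s20 : 0 <= s ^+ 2 by rewrite sqr_ge0.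
  have t1 : s ^+ 2 * x^-1 ^+ 2 <= s ^+ 2 * x^-1 by rewrite ler_wpM2l// expr2 ler_piMl// ltW.
  have t0 : 0 <= s ^+ 2 * x^-1 ^+ 2 by rewrite mulr_ge0 ?sqr_ge0.
  have t2 : (s - 1 / 2) * s ^+ 2 * x^-1 ^+ 2 <= s ^+ 2 * x^-1 ^+ 2.
    by rewrite -mulrA ler_piMl//; lra.
  have t3 : s * x^-1 <= x^-1 by rewrite ler_piMl// ltW.
  have t4 : 0 <= s ^+ 2 * x^-1 by rewrite mulr_ge0// ltW.
  lra.
have k5 : s * x^-1 <= x^-1 by rewrite ler_piMl// ltW.
move: u1 u2; rewrite lE; move: k1 k2; move: (ln (1 + _)) (ln x) => L1 L0 k1 k2 u1 u2.
rewrite ler_norml; apply/andP; split; lra.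
Qed.

Lemma binet_limit : exists L : R, forall x, 1 <= x -> `|binet x - L| <= 2 / x ^+ 2.
Proof.
(* Adding the telescoping bound of [binet_step] makes the sequence nonincreasing; [binet_dist]
   bounds it below. *)
pose u n := binet (1 + n%:R) + 2 * (1 + n%:R) ^- 2.
have uS n : u n.+1 <= u n.
  have := @binet_step (1 + n%:R).
  rewrite (_ : 1 + n%:R + 1 = 1 + n.+1%:R); last by rewrite -addrA natr1.
  rewrite lerDl ler0n => /(_ isT).
  by rewrite ler_norml => /andP[+ _]; rewrite /u; lra.
have ub n : binet 1 - 2 <= u n.
  have := @binet_dist 1 n (lexx 1); rewrite expr1n invr1.
  have : 0 <= (1 + n%:R) ^- 2 :> R by rewrite invr_ge0 sqr_ge0.
  by rewrite ler_norml => p /andP[_]; rewrite /u; lra.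
have cu : cvgn u.
  apply: nonincreasing_is_cvgn; first exact/nonincreasing_seqP.
  by exists (binet 1 - 2) => _ [n _ <-].
set L := limn u; exists L => x x1.
have x0 : 0 < x by apply: lt_le_trans x1.
have c1 : binet (x + n%:R) @[n --> \oo] --> L.
  apply/cvgrPdist_lt => e e0.
  have h : (fun n => u n) @ \oo --> L by exact: cu.
  have e3 : 0 < e / 3 by rewrite divr_gt0.
  have e6 : 0 < e / 6 by rewrite divr_gt0.
  have /cvgrPdist_lt/(_ _ e3) h1 := h.
  have /cvgrPdist_lt/(_ _ e6) h2 := @cvg_harmonic R.
  case: h1 => N1 _ h1; case: h2 => N2 _ h2.
  exists (N1 + N2)%N => // n /= hn.
  have /andP[m1 m2] := truncn_itv (ltW x0); set m := Num.truncn x in m1 m2.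
  have mp : (0 < m)%N.
    by rewrite lt0n; apply/eqP => m0; move: m2; rewrite m0 ltNge x1.
  (* The sequence [u] samples [binet] at 1 + k, so the integer m + n below x + n has index m - 1 +
     n. *)
  pose k := (m.-1 + n)%N.
  have kE : (1 + k%:R : R) = m%:R + n%:R by rewrite /k natrD addrA nat1r prednK.
  have hk : 1 <= 1 + k%:R :> R by rewrite lerDl.
  have s0 : 0 <= x - m%:R by lra.
  have s1 : x - m%:R <= 1 by move: m2; rewrite -(@natr1 _ m); lra.
  have := binet_shift hk s0 s1; rewrite {1}kE (_ : m%:R + n%:R + (x - m%:R) = x + n%:R); last by ring.
  have kN1 : (N1 <= k)%N by rewrite (leq_trans (leq_addr N2 N1))// (leq_trans hn)// leq_addl.
  have kN2 : (N2 <= k)%N by rewrite (leq_trans (leq_addl N1 N2))// (leq_trans hn)// leq_addl.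
  have := h1 k kN1; have := h2 k kN2 => /=.
  rewrite nat1r /u sub0r normrN ger0_norm ?invr_ge0// => a2 a1 a3.

  have v0 : 0 < k.+1%:R^-1 :> R by rewrite invr_gt0.
  have v1 : k.+1%:R^-1 <= 1 :> R by rewrite invf_le1// ler1n.
  have v2 : k.+1%:R ^- 2 <= k.+1%:R^-1 :> R by rewrite -exprVn expr2 ler_piMl// ltW.
  have v3 : 0 <= k.+1%:R ^- 2 :> R by rewrite -exprVn sqr_ge0.
  move: a1 a3; rewrite nat1r !ltr_norml !ler_norml => /andP[a1 a1'] /andP[a3 a3'].
  move: v2 v3 a2 a1 a1' a3 a3' e0 {e3 e6 h1 h2}.
  move: (binet (x + n%:R)) (binet k.+1%:R) (k.+1%:R ^- 2) (k.+1%:R^-1) => p q r v.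
  by move=> *; apply/andP; split; lra.
have c2 : `|binet x - binet (x + n%:R)| @[n --> \oo] --> `|binet x - L|.
  by apply: cvg_norm; apply: cvgB => //; exact: cvg_cst.
apply: (cvgr_to_le c2); near=> n.
have := binet_dist n x1; move/le_trans; apply.
by rewrite ler_pM2l// lerBlDr lerDl invr_ge0 sqr_ge0.
Unshelve. all: by end_near. Qed.

End Stirling.

(** * The constant in Stirling's formula and ratios of Gamma functions *)

Section StirlingConstant.
Variable R : realType.
Implicit Types (x y s t : R) (n : nat).

Lemma lnGammaE x : ln (Gamma x) = binet x + (x - 1 / 2) * ln x - x + (12 * x)^-1.
Proof. by rewrite /binet; ring. Qed.

Lemma poch_half n : poch (1 / 2 : R) n * 4 ^+ n * n`!%:R = (2 * n)`!%:R.
Proof.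
elim: n => [|n IH]; first by rewrite poch0 expr0 !mulr1 muln0 fact0.
rewrite pochS (_ : (2 * n.+1)%N = (2 * n).+2); last by rewrite mulnS.
rewrite !factS !natrM -IH exprS.
have -> : (2 * n).+2%:R = 2 * (n.+1%:R : R) by rewrite -natrM mulnS.
have -> : (2 * n).+1%:R = 2 * (1 / 2 + n%:R : R) by rewrite -natr1 natrM; field.
move: (poch _ n) (4 ^+ n) (n`!%:R) (n.+1%:R : R) (n%:R : R) => p q r u v.
by field.
Qed.

(** Legendre's duplication formula at the half-integer h, obtained from (1/2)_N 4^N N! = (2 N)! and
    Gamma(1/2) = sqrt pi. Its logarithm relates three values of [binet] and so determines their
    common limit. *)
Lemma binet_duplication n : let h := n.+1%:R + 1 / 2 : R in
  binet h + binet (h + 1 / 2) - binet (2 * h) =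
  ln (2 * pi) / 2 + 1 / 2 - h * ln (1 + (2 * h)^-1) - ((12 * h)^-1 + (12 * (h + 1 / 2))^-1 - (12 * (2 * h))^-1).
Proof.
set N := n.+1; move=> h.
have h0 : 0 < h by rewrite addr_gt0// divr_gt0.
have pi0 : 0 < pi :> R := pi_gt0 R.
have E : Gamma h * 4 ^+ N * Gamma (h + 1 / 2) = Num.sqrt pi * Gamma (2 * h).
  have -> : h + 1 / 2 = N.+1%:R by rewrite /h -[in RHS]natr1; field.
  have -> : 2 * h = (2 * N).+1%:R by rewrite /h -[in RHS]natr1 natrM; field.
  rewrite !Gamma_natS /h addrC GammaDn ?divr_gt0// Gamma_half -(poch_half N).
  by move: (poch _ _) (4 ^+ _) (Num.sqrt _) => p q r; ring.
have hh0 : 0 < h + 1 / 2 by rewrite addr_gt0// divr_gt0.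
have h20 : 0 < 2 * h by rewrite mulr_gt0.
have q0 : 0 < 4 ^+ N :> R by rewrite exprn_gt0.
have s0 : 0 < Num.sqrt pi :> R by rewrite sqrtr_gt0.
have lE (p q r s t : R) : 0 < p -> 0 < q -> 0 < r -> 0 < s -> 0 < t ->
    p * q * r = s * t -> ln p + ln q + ln r = ln s + ln t.
  move=> p0 q0' r0 s0' t0 e.
  by rewrite -!lnM ?posrE ?mulr_gt0// e.
have := lE _ _ _ _ _ (Gamma_gt0 h0) q0 (Gamma_gt0 hh0) s0 (Gamma_gt0 h20) E.
clear E; rewrite (lnGammaE h) (lnGammaE (h + 1 / 2)) (lnGammaE (2 * h)).
have -> : ln (4 ^+ N) = 2 * (h - 1 / 2) * ln 2 :> R.
  have -> : h - 1 / 2 = N%:R by rewrite /h addrK.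
  have -> : 4 = 2 ^+ 2 :> R by ring.
  by rewrite -exprM lnXn// -[LHS]mulr_natl natrM.
have -> : ln (Num.sqrt pi) = ln pi / 2 :> R.
  by rewrite -[X in _ = ln X / 2](sqr_sqrtr (ltW pi0)) lnXn ?sqrtr_gt0// -mulr_natl; field.
have -> : ln (2 * h) = ln 2 + ln h by rewrite lnM ?posrE.
have -> : ln (2 * pi) = ln 2 + ln pi :> R by rewrite lnM ?posrE.
have -> : ln (1 + (2 * h)^-1) = ln (h + 1 / 2) - ln h.
  by rewrite -ln_div ?posrE//; congr ln; field; rewrite gt_eqF.
move: (binet h) (binet (h + 1 / 2)) (binet (2 * h)) (ln h) (ln (h + 1 / 2)) (ln 2) (ln pi).
clear h0 hh0 h20 lE; move: ((12 * h)^-1) ((12 * (h + 1 / 2))^-1) ((12 * (2 * h))^-1) => i1 i2 i3.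
move: h => h b1 b2 b3 l1 l2 l3 l4 E.
by lra.
Qed.

Lemma eq_of_le_inv (z K : R) : (forall n, `|z| <= K / n.+1%:R) -> z = 0.
Proof.
move=> h; apply/eqP; rewrite -normr_eq0 eq_le normr_ge0 andbT.
have c : K / n.+1%:R @[n --> \oo] --> K * 0.
  by apply: cvgM; [exact: cvg_cst|exact: cvg_harmonic].
rewrite mulr0 in c; apply: (cvgr_to_ge c); near=> n; exact: h.
Unshelve. all: by end_near. Qed.

Lemma binet_bound x : 1 <= x -> `|binet x - ln (2 * pi) / 2| <= 2 / x ^+ 2.
Proof.
have [L hL] := binet_limit R; suff <- : L = ln (2 * pi) / 2 by exact: hL.
(* As h grows, the duplication formula becomes L + L - L = ln (2 pi) / 2 + 1/2 - 1/2; each deviation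
   is at most a multiple of 1 / (n + 1), and 8 exceeds their sum. *)
apply/eqP; rewrite -subr_eq0; apply/eqP; apply: (@eq_of_le_inv _ 8) => n.
have := binet_duplication n; set h := n.+1%:R + 1 / 2 => /=.
have n1 : 1 <= n.+1%:R :> R by rewrite ler1n.
have h1 : n.+1%:R <= h by rewrite /h lerDl divr_ge0.
set v := n.+1%:R^-1.
have v0 : 0 < v by rewrite /v invr_gt0; lra.
have v1 : v <= 1 by rewrite /v invf_le1; lra.
have inv_le (y : R) : n.+1%:R <= y -> 0 < y^-1 <= v.
  move=> ny; have y0 : 0 < y by apply: lt_le_trans ny; lra.
  by rewrite invr_gt0 y0 /v lef_pV2 ?posrE//; lra.
have sq (y : R) : n.+1%:R <= y -> `|binet y - L| <= 2 * v.
  move=> ny; apply: le_trans (hL _ (le_trans n1 ny)) _.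
  have /andP[y0 yv] := inv_le y ny.
  rewrite ler_pM2l// -exprVn expr2; apply: le_trans (yv); rewrite ler_piMr ?(ltW y0)//.
  exact: le_trans yv v1.
have b1 := sq h h1.
have b2 : `|binet (h + 1 / 2) - L| <= 2 * v by apply: sq; lra.
have b3 : `|binet (2 * h) - L| <= 2 * v by apply: sq; lra.
have /andP[i10 i1] : 0 < (2 * h)^-1 <= v by apply: inv_le; lra.
have /andP[j10 j1] : 0 < (12 * h)^-1 <= v by apply: inv_le; lra.
have /andP[j20 j2] : 0 < (12 * (h + 1 / 2))^-1 <= v by apply: inv_le; lra.
have /andP[j30 j3] : 0 < (12 * (2 * h))^-1 <= v by apply: inv_le; lra.
have h0 : 0 < h by lra.
have l1 := ln1D_lower2 (ltW i10).
have l2 : ln (1 + (2 * h)^-1) <= (2 * h)^-1 by apply: le_ln1Dx; lra.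
have k1 : h * ((2 * h)^-1 - (2 * h)^-1 ^+ 2 / 2) <= h * ln (1 + (2 * h)^-1) by rewrite ler_pM2l.
have k2 : h * ln (1 + (2 * h)^-1) <= h * (2 * h)^-1 by rewrite ler_pM2l.
have e1 : h * (2 * h)^-1 = 1 / 2 by field; rewrite gt_eqF.
have e2 : h * ((2 * h)^-1 - (2 * h)^-1 ^+ 2 / 2) = 1 / 2 - (2 * h)^-1 / 4 by field; rewrite gt_eqF.
rewrite e1 in k2; rewrite e2 in k1.
move: b1 b2 b3 k1 k2 i10 i1 j10 j1 j20 j2 j30 j3 v0; clear.
move: (h * ln _) (binet h) (binet (h + 1 / 2)) (binet (2 * h)) (ln (2 * pi)).
move: (2 * h)^-1 (12 * h)^-1 (12 * (h + 1 / 2))^-1 (12 * (2 * h))^-1 v.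
move=> i j1 j2 j3 v l B1 B2 B3 P; rewrite !ler_norml => /andP[? ?] /andP[? ?] /andP[? ?].
by move=> *; apply/andP; split; lra.
Qed.

Lemma stirling x : 1 <= x -> exists2 th, `|th| <= 2 / x ^+ 2 &
  Gamma x = Num.sqrt (2 * pi) * x `^ (x - 1 / 2) * expR (- x) * expR ((12 * x)^-1 + th).
Proof.
move=> x1; have x0 : 0 < x by apply: lt_le_trans x1.
have pi0 : 0 < 2 * pi :> R by rewrite mulr_gt0 ?pi_gt0.
exists (binet x - ln (2 * pi) / 2); first exact: binet_bound.
rewrite -[LHS]lnK ?posrE ?Gamma_gt0// lnGammaE.
have -> : Num.sqrt (2 * pi) = expR (ln (2 * pi) / 2) :> R.
  have s0 : 0 < Num.sqrt (2 * pi) :> R by rewrite sqrtr_gt0.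
  have e : ln (2 * pi) = 2 * ln (Num.sqrt (2 * pi)) :> R.
    by rewrite [RHS]mulr_natl -lnXn// sqr_sqrtr// ltW.
  by rewrite e -mulrA mulrCA mulfV// mulr1 lnK.
rewrite /powR gt_eqF// -!expRD; congr expR.
by move: (binet x) (ln (2 * pi)) (ln x) ((12 * x)^-1) => *; ring.
Qed.

(** In Stirling's formula for both arguments, the terms beyond - d ln (k + m) are O(1 / k). The
    shift m prepares the comparison of (k + m)^(-d) with k! / (k + m)!. *)
Lemma Gamma_ratio_asymptotic (a d : R) (m : nat) : 0 < a -> 0 < d ->
  exists C, forall k : nat, (0 < k)%N -> 1 <= a + k%:R ->
  `|ln (Gamma (a + k%:R) / Gamma (a + d + k%:R)) + d * ln ((k + m)%:R)| <= C / k%:R.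
Proof.
move=> a0 d0; exists (5 + d ^+ 2 + d + d * `|a + d - m%:R|) => k kp yk.
set y := a + k%:R in yk *; have yd : a + d + k%:R = y + d by rewrite /y; ring.
have y0 : 0 < y by apply: lt_le_trans yk.
have k0 : 0 < k%:R :> R by rewrite ltr0n.
have k1 : 1 <= k%:R :> R by rewrite ler1n.
have yd0 : 0 < y + d by rewrite addr_gt0.
set v := k%:R^-1; have v0 : 0 < v by rewrite invr_gt0.
have v1 : v <= 1 by rewrite invf_le1.
have yv : y^-1 <= v by rewrite lef_pV2 ?posrE// /y lerDr ltW.
have ydv : (y + d)^-1 <= v by rewrite lef_pV2 ?posrE// /y; lra.
have sqv (z : R) : 0 < z -> z^-1 <= v -> 2 / z ^+ 2 <= 2 * v.
  move=> z0 zv; rewrite -exprVn ler_pM2l// expr2; apply: le_trans _ (zv).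
  by rewrite ler_piMr ?invr_ge0 ?(ltW z0)// (le_trans zv).
have b1 := le_trans (binet_bound yk) (sqv _ y0 yv).
have ydk : 1 <= y + d by rewrite ler_wpDr// ltW.
have b2 := le_trans (binet_bound ydk) (sqv _ yd0 ydv).
have lnr : `|ln ((k + m)%:R) - ln (y + d)| <= `|a + d - m%:R| * v.
  have K0 : 0 < (k + m)%:R :> R by rewrite ltr0n addn_gt0 kp.
  have Kv : (k + m)%:R^-1 <= v by rewrite lef_pV2 ?posrE// ler_nat leq_addr.
  have z (p q : R) : 0 < p -> 0 < q -> q^-1 <= v -> ln p - ln q <= `|p - q| * v.
    move=> p0 q0 qv; rewrite -ln_div ?posrE//.
    apply: le_trans (ln_le_sub1 _) _; first by rewrite divr_gt0.
    have -> : p / q - 1 = (p - q) / q by field; rewrite gt_eqF.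
    apply: le_trans (ler_norm _) _; rewrite normrM ler_wpM2l// normfV gtr0_norm//.
  have dE : `|(k + m)%:R - (y + d)| = `|a + d - m%:R|.
    by rewrite -normrN; congr `|_|; rewrite /y natrD; ring.
  have dE' : `|(y + d) - (k + m)%:R| = `|a + d - m%:R|.
    by congr `|_|; rewrite /y natrD; ring.
  rewrite ler_norml; apply/andP; split; last by rewrite -dE; exact: z.
  by rewrite lerNl opprB -dE'; exact: z.
have y1 : 0 <= d / y by rewrite divr_ge0 ?ltW.
have l1 := ln1D_lower2 y1.
have l2 : ln (1 + d / y) <= d / y by apply: le_ln1Dx; rewrite (lt_le_trans _ y1)// ltrN10.
have l0 : 0 <= ln (1 + d / y) by apply: ln_ge0; rewrite lerDl.
have lE : ln (y + d) = ln y + ln (1 + d / y).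
  by rewrite -lnM ?posrE ?ltr_pwDl//; congr ln; field; rewrite gt_eqF.
have p1 : y * (d / y - (d / y) ^+ 2 / 2) <= y * ln (1 + d / y) by rewrite ler_pM2l.
have p2 : y * ln (1 + d / y) <= y * (d / y) by rewrite ler_pM2l.
have e1 : y * (d / y) = d by field; rewrite gt_eqF.
have e2 : y * (d / y - (d / y) ^+ 2 / 2) = d - d ^+ 2 * y^-1 / 2 by field; rewrite gt_eqF.
have q1 : d ^+ 2 * y^-1 <= d ^+ 2 * v by rewrite ler_wpM2l ?sqr_ge0.
have q2 : d / y <= d * v by rewrite ler_pM2l.
have i1 : (12 * y)^-1 = y^-1 / 12 by field; rewrite gt_eqF.
have i2 : (12 * (y + d))^-1 = (y + d)^-1 / 12 by field; rewrite gt_eqF.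
have yi : 0 < y^-1 by rewrite invr_gt0.
have ydi : 0 < (y + d)^-1 by rewrite invr_gt0.
have dl : `|d * (ln ((k + m)%:R) - ln (y + d))| <= d * (`|a + d - m%:R| * v).
  by rewrite normrM (gtr0_norm d0) ler_pM2l.
have -> : ln (Gamma y / Gamma (a + d + k%:R)) + d * ln ((k + m)%:R) =
   (binet y - ln (2 * pi) / 2) - (binet (y + d) - ln (2 * pi) / 2)
   + (d * (ln ((k + m)%:R) - ln (y + d)))
   + (d - y * ln (1 + d / y)) + ln (1 + d / y) / 2 + (y^-1 / 12 - (y + d)^-1 / 12).
  rewrite yd ln_div ?posrE ?Gamma_gt0// !lnGammaE i1 i2 lE.
  by move: (binet y) (binet (y + d)) (ln y) (ln (1 + d / y)) (ln ((k + m)%:R)) (y^-1) ((y + d)^-1) (ln (2 * pi)) => *; field.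
rewrite e2 in p1; rewrite e1 in p2.
move: b1 b2 dl p1 p2 l0 l2 q1 q2 yi ydi yv ydv v0; clear.
move: (binet y - _) (binet (y + d) - _) (d * (ln _ - _)) (ln (1 + d / y)) => B1 B2 D l.
move: (y * l) (y^-1) ((y + d)^-1) `|a + d - m%:R| => yl i1 i2 A.
rewrite !ler_norml => /andP[? ?] /andP[? ?] /andP[? ?] *.
by apply/andP; split; lra.
Qed.

End StirlingConstant.

(** * Kummer's function on the positive real axis *)

Section KummerAtInfinity.
Variable R : realType.
Implicit Types (a d t x e : R) (n m k : nat).

Let pw x k : R := x ^+ k / k`!%:R.

Lemma pw_ge0 x k : 0 <= x -> 0 <= pw x k.
Proof. by move=> x0; rewrite divr_ge0// exprn_ge0. Qed.

Lemma sum_pw_cvg x : (fun n => \sum_(k < n) pw x k) @ \oo --> expR x.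
Proof.
rewrite (_ : (fun n => _) = series (exp_coeff x)); first exact: is_cvg_series_exp_coeff.
by apply/funext => n; rewrite /series /= big_mkord.
Qed.

Lemma sum_pw_le x n : 0 <= x -> \sum_(k < n) pw x k <= expR x.
Proof.
move=> x0; rewrite -(cvg_lim (@Rhausdorff R) (@sum_pw_cvg x)).
apply: nondecreasing_cvgn_le; last by apply/cvg_ex; exists (expR x); exact: sum_pw_cvg.
apply/nondecreasing_seqP => k; rewrite big_ord_recr /= lerDl; exact: pw_ge0.
Qed.

(** With d = b - a this is (a)_k / (b)_k times Gamma(a) / Gamma(b). *)
Definition gamma_ratio a d k := Gamma (a + k%:R) / Gamma (a + d + k%:R).

Lemma gamma_ratio_gt0 a d k : 0 < a -> 0 < d -> 0 < gamma_ratio a d k.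
Proof. by move=> a0 d0; rewrite divr_gt0 ?Gamma_gt0// ltr_wpDr// addr_gt0. Qed.

Lemma gamma_ratio_equiv a d m e : 0 < a -> 0 < d -> 0 < e -> exists n0, forall k, (n0 <= k)%N ->
  (1 - e) * (k + m)%:R `^ (- d) <= gamma_ratio a d k <= (1 + e) * (k + m)%:R `^ (- d).
Proof.
move=> a0 d0 e0; have [C hC] := Gamma_ratio_asymptotic m a0 d0.
have l0 : 0 < ln (1 + e) by rewrite ln_gt0// ltrDl.
set q := Num.min e (ln (1 + e)); have q0 : 0 < q by rewrite lt_min e0.
exists (Num.truncn (`|C| / q)).+1 => k nk.
have kC : `|C| / q < k%:R by apply: lt_le_trans (truncnS_gt _) _; rewrite ler_nat.
have k0 : 0 < k%:R :> R by apply: le_lt_trans kC; rewrite divr_ge0// ltW.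
have kp : (0 < k)%N by rewrite -(ltr0n R).
have ak : 1 <= a + k%:R by rewrite ler_wpDl ?(ltW a0)// ler1n.
have hq : C / k%:R <= q.
  rewrite ler_pdivrMr// mulrC -ler_pdivrMr//; apply: le_trans (ltW kC).
  by rewrite ler_pM2r ?invr_gt0// ler_norm.
have := le_trans (hC k kp ak) hq; rewrite -/(gamma_ratio a d k).
have g0 := gamma_ratio_gt0 k a0 d0; set g := gamma_ratio a d k in g0 *.
have K0 : 0 < (k + m)%:R :> R by rewrite ltr0n addn_gt0 kp.
have gE : g = expR (ln g + d * ln (k + m)%:R) * (k + m)%:R `^ (- d).
  by rewrite /powR gt_eqF// -expRD mulNr addrK lnK.
move: (ln g + _) gE => s -> hs.
have /andP[s1 s2] : - q <= s <= q by rewrite -ler_norml.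
have qe : q <= e by rewrite ge_min lexx.
have ql : q <= ln (1 + e) by rewrite ge_min lexx orbT.
rewrite !ler_pM2r ?powR_gt0//; apply/andP; split.
  by apply: le_trans (expR_ge1Dx s); rewrite lerD2l lerNl; lra.
by rewrite -[leRHS]lnK ?posrE ?addr_gt0// ler_expR; lra.
Qed.

Lemma fact_ratio_bound m k : ((k + m)`! <= k`! * (k + m) ^ m)%N.
Proof.
elim: m => [|m IH]; first by rewrite addn0 expn0 muln1.
rewrite addnS factS expnS mulnCA leq_mul//.
by apply: leq_trans IH _; rewrite leq_mul//; case: m => // m; rewrite leq_exp2r.
Qed.

(* Weighted AM-GM for [k! / (k + m)!], which has an explicit Poisson mean;
   its power [d / m] dominates [(k + m)^-d]. *)
Lemma powR_le_fact a d m k x : 0 < d -> d <= m%:R -> 0 < x -> (0 < k + m)%N ->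
  (k + m)%:R `^ (- d) <=
  x `^ (- d) * ((1 - d / m%:R) + d / m%:R * (x ^+ m * (k`!%:R / (k + m)`!%:R))).
Proof.
move=> d0 dm x0 km; have m0 : 0 < m%:R :> R by apply: lt_le_trans dm.
have f0 : 0 < k`!%:R :> R by rewrite ltr0n fact_gt0.
have f1 : 0 < (k + m)`!%:R :> R by rewrite ltr0n fact_gt0.
have K0 : 0 < (k + m)%:R :> R by rewrite ltr0n.
set y := k`!%:R / (k + m)`!%:R; have y0 : 0 < y by rewrite divr_gt0.
have z0 : 0 < x ^+ m * y by rewrite mulr_gt0// exprn_gt0.
have s0 : 0 <= d / m%:R by rewrite divr_ge0// ltW.
have s1 : d / m%:R <= 1 by rewrite ler_pdivrMr// mul1r.
apply: le_trans (_ : x `^ (- d) * (x ^+ m * y) `^ (d / m%:R) <= _); last first.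
  by rewrite ler_wpM2l ?powR_ge0// powR_tangent.
have yK : - (m%:R * ln (k + m)%:R) <= ln y.
  rewrite lerNl -lnV ?posrE// /y invf_div mulr_natl -lnXn// ler_ln ?posrE ?divr_gt0 ?exprn_gt0//.
  by rewrite ler_pdivrMr// mulrC -natrX -natrM ler_nat fact_ratio_bound.
have lE : ln (x ^+ m * y) = m%:R * ln x + ln y.
  by rewrite lnM ?posrE ?exprn_gt0// lnXn// -[ln x *+ m]mulr_natl.
rewrite /powR !gt_eqF// -expRD ler_expR lE.
have := ler_wpM2l s0 yK.
have -> : d / m%:R * - (m%:R * ln (k + m)%:R) = - d * ln (k + m)%:R.
  by field; rewrite gt_eqF.
have -> : - d * ln x + d / m%:R * (m%:R * ln x + ln y) = d / m%:R * ln y.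
  by field; rewrite gt_eqF.
by [].
Qed.

(** The convex function y^(-d) lies above its tangent at x. Averaging this over a Poisson law gives
    the lower bound. *)
Lemma powR_neg_tangent d x y : 0 <= d -> 0 < x -> 0 < y ->
  x `^ (- d) * (1 - d * ((y - x) / x)) <= y `^ (- d).
Proof.
move=> d0 x0 y0; rewrite mulrC -ler_pdivlMr ?powR_gt0//.
have -> : y `^ (- d) / x `^ (- d) = expR (- (d * ln (y / x))).
  by rewrite /powR !gt_eqF// -expRN -expRD ln_div ?posrE//; congr expR; ring.
apply: le_trans (expR_ge1Dx _); rewrite lerD2l lerN2 ler_wpM2l//.
have := ln_le_sub1 (divr_gt0 y0 x0); congr (_ <= _).
by field; rewrite gt_eqF.
Qed.

(** After cancellation the k-th term is x^(k + m) / (k + m)!, so the sum is a piece of the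
    exponential series. In Poisson terms, the mean of x^m k! / (k + m)! is at most 1. *)
Lemma sum_shift_pw_le x m n : 0 < x ->
  \sum_(k < n) (x ^+ m * (k`!%:R / (k + m)`!%:R)) * pw x k <= expR x.
Proof.
move=> x0; apply: le_trans (sum_pw_le (n + m) (ltW x0)).
rewrite [in leRHS]addnC big_split_ord /= ler_wpDl//.
  by apply: sumr_ge0 => k _; apply: pw_ge0; exact: ltW.
apply: ler_sum => k _; rewrite /pw (addnC m) exprD.
have h1 : k`!%:R != 0 :> R by rewrite pnatr_eq0 -lt0n fact_gt0.
have h2 : (k + m)`!%:R != 0 :> R by rewrite pnatr_eq0 -lt0n fact_gt0.
by rewrite le_eqVlt; apply/orP; left; apply/eqP; field; rewrite h1 h2.
Qed.

(** Since k x^k / k! = x x^(k-1) / (k-1)!, only the last term is left over, with a negative sign.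
    The truncated centred mean thus has the favourable sign for the lower bound. *)
Lemma sum_pw_center_le x n : 0 <= x -> \sum_(k < n) (k%:R - x) * pw x k <= 0.
Proof.
move=> x0; case: n => [|n]; first by rewrite big_ord0.
have E k : k.+1%:R * pw x k.+1 = x * pw x k.
  have h1 : k`!%:R != 0 :> R by rewrite pnatr_eq0 -lt0n fact_gt0.
  have h2 : k.+1%:R != 0 :> R by rewrite pnatr_eq0.
  rewrite /pw exprS factS natrM; move: h1 h2; move: (k.+1%:R : R) (k`!%:R : R) => r s h1 h2.
  by field; rewrite ?h1 ?h2.
under eq_bigr do rewrite mulrBl.
rewrite sumrB subr_le0 -mulr_sumr big_ord_recl mul0r add0r.
under eq_bigr do rewrite E.
by rewrite -mulr_sumr ler_wpM2l// big_ord_recr /= lerDl pw_ge0.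
Qed.

(** A finite head of the series is a polynomial in x, negligible against exp x; it contains the
    indices where the Gamma ratio is not yet close to its asymptotics. *)
Lemma sum_head_small (c : nat -> R) d n0 : 0 < d -> (forall k, 0 <= c k) ->
  exists2 D, 0 <= D & forall x, 0 < x ->
  x `^ d * expR (- x) * \sum_(k < n0) c k * pw x k <= D / x.
Proof.
move=> d0 c0; elim: n0 => [|n [D D0 hD]].
  by exists 0 => // x x0; rewrite big_ord0 mulr0 mul0r.
have p0 : 0 <= d + n%:R by rewrite addr_ge0// ltW.
have [D1 D11 hD1] := powR_exp_bound p0.
have D10 : 0 <= D1 by apply: le_trans D11.
exists (D + c n * D1 * 2) => [|x x0]; first by rewrite addr_ge0 ?mulr_ge0.
rewrite big_ord_recr /= mulrDr [leRHS]mulrDl; apply: lerD; first exact: hD.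
have f1 : 1 <= n`!%:R :> R by rewrite ler1n fact_gt0.
have f0 : 0 < n`!%:R :> R by rewrite ltr0n fact_gt0.
apply: le_trans (_ : c n * (x `^ (d + n%:R) * expR (- x)) <= _).
  have -> : x `^ (d + n%:R) = x `^ d * x ^+ n by rewrite powRD ?(gt_eqF x0) ?implybT// powR_mulrn// ltW.
  rewrite (_ : _ * _ = c n * (x `^ d * x ^+ n * expR (- x)) / n`!%:R); last by rewrite /pw; ring.
  rewrite ler_pdivrMr// ler_peMr// mulr_ge0 ?c0// !mulr_ge0 ?powR_ge0 ?expR_ge0//.
  by rewrite exprn_ge0// ltW.
rewrite -!mulrA ler_wpM2l ?c0//; apply: le_trans (hD1 x x0) _.
rewrite ler_wpM2l// -[2 / x]invf_div expRN lef_pV2 ?posrE ?expR_gt0 ?divr_gt0//.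
by apply: le_trans (expR_ge1Dx _); rewrite lerDr.
Qed.

(** Under Poisson weights of mean x the index k concentrates near x, so the average of (k + m)^(-d)
    is close to x^(-d). The upper bound comes from the mean of k! / (k + m)!, the lower one from the
    tangent at x + m. *)
Lemma kummer_series_limit a d (h : R -> R) e : 0 < a -> 0 < d -> 0 < e -> e < 1 ->
  (forall x, 0 < x -> (fun n => \sum_(k < n) gamma_ratio a d k * pw x k) @ \oo --> h x) ->
  exists X, forall x, X <= x -> 0 < x -> `|expR (- x) * x `^ d * h x - 1| <= 2 * e.
Proof.
move=> a0 d0 e0 e1 hh; set c := gamma_ratio a d.
have c0 k : 0 < c k by exact: gamma_ratio_gt0.
(* A shift m >= d makes d / m an admissible weight in [powR_le_fact], and m > 0 keeps k + m positive
   at k = 0. *)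
set m := (Num.truncn d).+1; have dm : d <= m%:R by rewrite ltW ?truncnS_gt.
have m0 : 0 < m%:R :> R by apply: lt_le_trans dm.
have [n0 hn] := gamma_ratio_equiv m a0 d0 e0.
have [D1 D10 hD1] := sum_head_small n0 d0 (fun k => ltW (c0 k)).
have [D2 D20 hD2] := sum_head_small n0 d0 (fun k => ler01).
exists ((D1 + D2 + d * m%:R) / e) => x Xx x0.
have dm0 : 0 <= d * m%:R by rewrite mulr_ge0// ltW.
have xe : (D1 + D2 + d * m%:R) / x <= e by rewrite ler_pdivrMr// [leRHS]mulrC -ler_pdivrMr.
have xd0 : 0 < x `^ d by rewrite powR_gt0.
have ex0 : 0 < expR (- x) by exact: expR_gt0.
have eK : expR (- x) * expR x = 1 by rewrite -expRD addNr expR0.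
have dK : x `^ d * x `^ (- d) = 1 by rewrite powRN mulfV// gt_eqF.
have xV0 : 0 <= x `^ (- d) by exact: powR_ge0.
have up : h x <= (1 + e) * (x `^ (- d) * expR x) + \sum_(k < n0) c k * pw x k.
  have cv := hh x x0.
  apply: (cvgr_to_le cv); near=> n.
  apply: le_trans (_ : \sum_(k < n) ((1 + e) * (x `^ (- d) *
     ((1 - d / m%:R) * pw x k + d / m%:R * (x ^+ m * (k`!%:R / (k + m)`!%:R) * pw x k)))
     + (if (k < n0)%N then c k * pw x k else 0)) <= _).
    apply: ler_sum => k _.
    have km : (0 < k + m)%N by rewrite addnS.
    have T := powR_le_fact a d0 dm x0 km; have P0 := pw_ge0 k (ltW x0).
    have T' := ler_wpM2r P0 (le_trans (powR_ge0 _ _) T).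
    have e10 : 0 <= 1 + e by rewrite addr_ge0// ltW.
    have TT := ler_wpM2r P0 (ler_wpM2l e10 T).
    rewrite mul0r in T'.
    case: ltnP => kn.
      rewrite lerDr mulr_ge0//; move: T'; congr (_ <= _); ring.
    have /andP[_ ck] := hn k kn.
    rewrite addr0; apply: le_trans (ler_wpM2r P0 ck) _.
    apply: le_trans TT _; rewrite le_eqVlt; apply/orP; left; apply/eqP; ring.
  rewrite big_split /=; apply: lerD.
    rewrite -mulr_sumr ler_pM2l ?addr_gt0// -mulr_sumr ler_wpM2l//.
    rewrite big_split /= -!mulr_sumr.
    have l1 := sum_pw_le n (ltW x0); have l2 := sum_shift_pw_le m n x0.
    have s0 : 0 <= d / m%:R by rewrite divr_ge0// ltW.
    have s1 : 0 <= 1 - d / m%:R by rewrite subr_ge0 ler_pdivrMr// mul1r.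
    have := lerD (ler_wpM2l s1 l1) (ler_wpM2l s0 l2).
    by rewrite -mulrDl subrK mul1r.
  rewrite (big_ord_widen n (fun k => c k * pw x k)); last by near: n; exact: nbhs_infty_ge.
  by rewrite [leRHS]big_mkcond.
have X0 : 0 < x + m%:R by rewrite addr_gt0.
(* The tangent is taken at x + m, the Poisson mean of k + m. For k < n0 the estimate is paid for by
   adding 1 to the coefficient, since (k + m)^(-d) <= 1. *)
have lo : (1 - e) * ((x + m%:R) `^ (- d) * expR x) - \sum_(k < n0) 1 * pw x k <= h x.
  set H := \sum_(k < n0) _; set q := (x + m%:R) `^ (- d).
  have q0 : 0 <= q by exact: powR_ge0.
  have s1 : 0 <= 1 - e by rewrite subr_ge0 ltW.
  have cv : (fun n => \sum_(k < n) c k * pw x k + H - (1 - e) * (q * \sum_(k < n) pw x k)) @ \oo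
      --> h x + H - (1 - e) * (q * expR x).
    apply: cvgB; first by apply: cvgD; [exact: hh|exact: cvg_cst].
    by apply: cvgM; [exact: cvg_cst|apply: cvgM; [exact: cvg_cst|exact: sum_pw_cvg]].
  rewrite lerBlDr -subr_ge0; apply: (cvgr_to_ge cv); near=> n; rewrite subr_ge0.
  have -> : H = \sum_(k < n) (if (k < n0)%N then 1 * pw x k else 0).
    rewrite /H (big_ord_widen n (fun k => 1 * pw x k)); last by near: n; exact: nbhs_infty_ge.
    by rewrite [LHS]big_mkcond.
  rewrite -big_split /=.
  apply: le_trans (_ : \sum_(k < n) (1 - e) * (q * (1 - d * (((k + m)%:R - (x + m%:R)) / (x + m%:R)))) * pw x k <= _).
    have -> : \sum_(k < n) (1 - e) * (q * (1 - d * (((k + m)%:R - (x + m%:R)) / (x + m%:R)))) * pw x k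
      = (1 - e) * (q * \sum_(k < n) pw x k)
        - (1 - e) * (q * (d / (x + m%:R))) * \sum_(k < n) (k%:R - x) * pw x k.
      rewrite !mulr_sumr -sumrB; apply: eq_bigr => k _.
      by rewrite natrD; field; rewrite gt_eqF.
    have n1 : \sum_(k < n) (k%:R - x) * pw x k <= 0 by apply: sum_pw_center_le; exact: ltW.
    rewrite lerDl oppr_ge0 mulr_ge0_le0// mulr_ge0// mulr_ge0//.
    by rewrite divr_ge0// ltW.
  apply: ler_sum => k _; have P0 := pw_ge0 k (ltW x0).
  have km : (0 < k + m)%N by rewrite addnS.
  have K0 : 0 < (k + m)%:R :> R by rewrite ltr0n.
  have T := ler_wpM2l s1 (powR_neg_tangent (ltW d0) X0 K0).
  case: ltnP => kn.
    rewrite -mulrDl; apply: ler_wpM2r => //; apply: le_trans T _.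
    have K1 : (k + m)%:R `^ (- d) <= 1.
      rewrite /powR gt_eqF// -[leRHS]expR0 ler_expR mulNr oppr_le0.
      by rewrite mulr_ge0 ?ln_ge0 ?ler1n// ltW.
    have Kp : 0 <= (k + m)%:R `^ (- d) by exact: powR_ge0.
    have := c0 k; nra.
  have /andP[ck _] := hn k kn.
  by rewrite addr0; apply: ler_wpM2r => //; exact: le_trans T ck.
have t1 := powR_neg_tangent (ltW d0) x0 X0.
have {t1} t1 : 1 - d * m%:R / x <= x `^ d * (x + m%:R) `^ (- d).
  have := ler_wpM2l (ltW xd0) t1; rewrite mulrA dK mul1r.
  by congr (_ <= _); field; rewrite gt_eqF.
have exd0 : 0 < expR (- x) * x `^ d by rewrite mulr_gt0.
have u1 := ler_wpM2l (ltW exd0) up; have u2 := ler_wpM2l (ltW exd0) lo.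
have u3 := hD1 x x0; have u4 := hD2 x x0.
have E1 : expR (- x) * x `^ d * ((1 + e) * (x `^ (- d) * expR x) + \sum_(k < n0) c k * pw x k)
  = (1 + e) * ((expR (- x) * expR x) * (x `^ d * x `^ (- d)))
    + x `^ d * expR (- x) * \sum_(k < n0) c k * pw x k by ring.
have E2 : expR (- x) * x `^ d * ((1 - e) * ((x + m%:R) `^ (- d) * expR x) - \sum_(k < n0) 1 * pw x k)
  = (1 - e) * ((expR (- x) * expR x) * (x `^ d * (x + m%:R) `^ (- d)))
    - x `^ d * expR (- x) * \sum_(k < n0) 1 * pw x k by ring.
rewrite E1 eK dK !mulr1 in u1; rewrite E2 eK mul1r in u2.
have xe' : D1 / x + D2 / x + d * m%:R / x <= e by rewrite -!mulrDl.
have D1x : 0 <= D1 / x by rewrite divr_ge0// ltW.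
have D2x : 0 <= D2 / x by rewrite divr_ge0// ltW.
have dmx : 0 <= d * m%:R / x by rewrite divr_ge0// ltW.
have s1 : 0 <= 1 - e by rewrite subr_ge0 ltW.
have u5 := ler_wpM2l s1 t1.
move: u1 u2 u3 u4 u5 xe' D1x D2x dmx s1 e0; clear.
move: (expR _ * _ * h x) (\sum_(k < n0) c k * _) (\sum_(k < n0) 1 * _) => p S1 S2.
move: (x `^ d * _ * S1) (x `^ d * _ * S2) (x `^ d * (x + m%:R) `^ (- d)) (D1 / x) (D2 / x) (d * m%:R / x).
move=> A B T p1 p2 p3 u1 u2 u3 u4 u5 xe' D1x D2x dmx s1 e0.
by rewrite ler_norml; apply/andP; split; nra.
Unshelve. all: by end_near. Qed.

Lemma kf_real_cvg a b t : 0 < a -> 0 < b ->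
  (fun n => \sum_(k < n) kc a b k * t ^+ k) @ \oo --> cre (kf a b (cofR t)).
Proof.
move=> a0 b0; have [h1 _] := expbnd_cvg (cbnd_expbnd (cbnd_kc a0 b0) (lexx (cmod (cofR t)))).
rewrite (_ : (fun n => _) = series (fun k => cre (cofR (kc a b k) * cofR t ^+ k))); first exact: h1.
apply/funext => n; rewrite /series /= big_mkord; apply: eq_bigr => k _.
by rewrite -rmorphXn -rmorphM.
Qed.

(** With x = b t and d = b - a, the Kummer series times Gamma(a) / Gamma(b) is the series of
    [kummer_series_limit]. *)
Lemma kf_at_infinity a b e : 0 < a -> a < b -> 0 < e -> e < 1 ->
  exists X, forall t, X <= t -> 0 < t ->
  `|expR (- (b * t)) * (b * t) `^ (b - a) * (cre (kf a b (cofR t)) * (Gamma a / Gamma b)) - 1| <= 2 * e.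
Proof.
move=> a0 ab e0 e1; have b0 : 0 < b := lt_trans a0 ab.
have d0 : 0 < b - a by rewrite subr_gt0.
have [|X hX] := @kummer_series_limit a (b - a)
    (fun x => cre (kf a b (cofR (x / b))) * (Gamma a / Gamma b)) e a0 d0 e0 e1.
  move=> x x0.
  rewrite (_ : (fun n => _) = fun n => (\sum_(k < n) kc a b k * (x / b) ^+ k) * (Gamma a / Gamma b)).
    by apply: cvgM; [exact: kf_real_cvg|exact: cvg_cst].
  apply/funext => n /=; rewrite mulr_suml; apply: eq_bigr => k _.
  rewrite /gamma_ratio /kc /pw addrCA subrr addr0 !GammaDn//.
  have g1 : Gamma a != 0 by rewrite gt_eqF// Gamma_gt0.
  have g2 : Gamma b != 0 by rewrite gt_eqF// Gamma_gt0.
  have f0 : k`!%:R != 0 :> R by rewrite pnatr_eq0 -lt0n fact_gt0.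
  have p0 : poch b k != 0 by rewrite gt_eqF// poch_gt0.
  rewrite exprMn exprVn; have bk : b ^+ k != 0 by rewrite expf_neq0// gt_eqF.
  move: (Gamma a) (Gamma b) (k`!%:R : R) (poch b k) (poch a k) (b ^+ k) (x ^+ k) g1 g2 f0 p0 bk.
  by move=> p q r s u v w *; field; do ?[apply/andP; split].
exists (X / b) => t Xt t0.
have := hX (b * t); rewrite (mulrC b t) mulfK ?gt_eqF//; apply.
  by rewrite -ler_pdivrMr.
by rewrite mulr_gt0.
Qed.

End KummerAtInfinity.

(* With [u = (z - 1)^-1] the approximant in region B is [(z - 1)^(a - 1) * Bq a b u]; here
   [BT1] is its [b^-1] coefficient, without the constant [1 / 12] of Stirling's formula,
   and [Bres a u * u ^+ 2 / b] is the residual in the differential equation. *)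
Definition BT1 (K : fieldType) (a u : K) : K := a * (a - 1) * u + (a - 1) * (a - 2) / 2 * u ^+ 2.
Definition BT1d (K : fieldType) (a u : K) : K := a * (a - 1) + (a - 1) * (a - 2) * u.
Definition Bres (K : fieldType) (a u : K) : K :=
  let p := a * (a - 1) * (a - 2) in let s := (a - 1) * (a - 2) * (a - 3) / 2 in
  (1 + u) * ((a - 3) * p + (a - 4) * s * u) + 2 * (p + s * u).

(** * The Riccati equation on the real axis *)

Section RealAxis.
Variable R : realType.
Implicit Types (a b t u : R).

Lemma linear_barrier (N dN P dP : R -> R) t0 t1 : t0 <= t1 ->
  (forall t, t0 <= t <= t1 -> rder N t (dN t)) ->
  (forall t, t0 <= t <= t1 -> rder P t (dP t)) ->
  (forall t, t0 <= t <= t1 -> 0 <= dN t + dP t * N t) -> 0 <= N t0 -> 0 <= N t1.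
Proof.
move=> t01 hN hP h N0.
have le : N t0 * expR (P t0) <= N t1 * expR (P t1).
  apply: (@rder_ge0_ndecr R (fun t => N t * expR (P t))
    (fun t => (dN t + dP t * N t) * expR (P t)) t0 t1 t01) => t ht.
    refine (rder_eq (rderM (hN t ht) (rder_exp (hP t ht))) _); ring.
  by rewrite mulr_ge0 ?expR_ge0// h.
have : 0 <= N t1 * expR (P t1) by apply: le_trans le; rewrite mulr_ge0 ?expR_ge0.
by rewrite pmulr_lge0 ?expR_gt0.
Qed.

Let f a b t := cre (kf a b (cofR t)).
Let f1 a b t := cre (kf1 a b (cofR t)).
Let f2 a b t := cre (kf2 a b (cofR t)).

Lemma rder_kf a b t : 0 < a -> 0 < b -> rder (f a b) t (f1 a b t).
Proof.
move=> a0 b0; have [h _] := @cdiff_kf R a b (cofR t) a0 b0 _ _ _ erefl (cder_cofR (rder_id t)).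
by refine (rder_eq h _); rewrite rmorph1 mulr1.
Qed.

Lemma rder_kf1 a b t : 0 < a -> 0 < b -> rder (f1 a b) t (f2 a b t).
Proof.
move=> a0 b0; have [h _] := @cdiff_kf1 R a b (cofR t) a0 b0 _ _ _ erefl (cder_cofR (rder_id t)).
by refine (rder_eq h _); rewrite rmorph1 mulr1.
Qed.

Lemma kummer_ode_real a b t : 0 < a -> 0 < b ->
  t * f2 a b t = b * (t - 1) * f1 a b t + a * b * f a b t.
Proof.
move=> a0 b0; have := congr1 (@cre R) (@kummer_ode R a b (cofR t) a0 b0).
rewrite /f /f1 /f2 !cE => h; lra.
Qed.

Lemma kf_gt0 a b t : 0 < a -> 0 < b -> 0 <= t -> 0 < f a b t.
Proof. by move=> a0 b0 t0; apply: lt_le_trans (kf_ge1 a0 b0 t0). Qed.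

(** Barrier argument from t = 1, where the right side vanishes and f' >= 0. With k = min (1, a),
    both a t - k and 1 - k are nonnegative, which gives the sign of the differential inequality. The
    resulting growth of f' / f, linear in b, is the restoring force in the Riccati equation. *)
Lemma kf1_lower a b t : 0 < a -> 0 < b -> 1 <= t ->
  b * Num.min 1 a * (1 - t^-1) * f a b t <= f1 a b t.
Proof.
move=> a0 b0 t1; set k := Num.min 1 a.
have k0 : 0 < k by rewrite lt_min ltr01.
have k1 : k <= 1 by rewrite ge_min lexx.
have ka : k <= a by rewrite ge_min lexx orbT.
rewrite -subr_ge0.
apply: (@linear_barrier (fun t => f1 a b t - b * k * (1 - t^-1) * f a b t)
   (fun t => f2 a b t - (b * k * (t ^- 2) * f a b t + b * k * (1 - t^-1) * f1 a b t))
   (fun t => - (b * (1 - k)) * (t - ln t)) (fun t => - (b * (1 - k)) * (1 - t^-1)) 1 t t1).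
- move=> x /andP[x1 _]; have x0 : 0 < x by apply: lt_le_trans x1.
  refine (rder_eq (rderB (rder_kf1 x a0 b0) (rderM (rderM (rder_cst (b * k) x)
    (rderB (rder_cst 1 x) (rderV (rder_id x) (lt0r_neq0 x0)))) (rder_kf x a0 b0))) _).
  rewrite /=; field; exact: lt0r_neq0.
- move=> x /andP[x1 _]; have x0 : 0 < x by apply: lt_le_trans x1.
  refine (rder_eq (rderM (rder_cst _ x) (rderB (rder_id x) (rder_ln (rder_id x) x0))) _).
  rewrite /=; field; exact: lt0r_neq0.
- move=> x /andP[x1 _]; have x0 : 0 < x by apply: lt_le_trans x1.
  have ode := kummer_ode_real x a0 b0.
  have fx := kf_gt0 a0 b0 (ltW x0).
  have -> : f2 a b x = (b * (x - 1) * f1 a b x + a * b * f a b x) / x.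
    by rewrite -ode mulrC mulKf// gt_eqF.
  rewrite [leRHS](_ : _ = b * f a b x / x ^+ 2 * ((a * x - k) + b * k * (1 - k) * (x - 1) ^+ 2)); last first.
    move: (f a b x) (f1 a b x) (k) => F F1 K; rewrite /=.
    by field; rewrite gt_eqF.
  apply: mulr_ge0; first by rewrite divr_ge0 ?sqr_ge0// ltW// mulr_gt0.
  have k1' : 0 <= 1 - k by rewrite subr_ge0.
  apply: addr_ge0; first by rewrite subr_ge0 (le_trans ka)// ler_peMr// ltW.
  by rewrite mulr_ge0 ?sqr_ge0// mulr_ge0// ltW// mulr_gt0.
- by rewrite invr1 subrr mulr0 mul0r subr0 kf1_ge0.
Qed.

Definition Bq (K : fieldType) (a b u : K) : K := 1 + BT1 a u / b.
(** Logarithmic derivative in t of the approximant (t - 1)^(a - 1) Bq, where u = 1 / (t - 1) and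
    du/dt = - u^2. *)
Definition Balpha (K : fieldType) (a b u : K) : K := (a - 1) * u - u ^+ 2 * (BT1d a u / b) / Bq a b u.

Let uu t := (t - 1)^-1.
Let y a b t := f1 a b t / f a b t.
(* [klnG] is the logarithm of [f t * exp (- b t) * t^(b - 1)] divided by the approximant,
   and [kgam] is its derivative, which satisfies a Riccati equation. *)
Definition kgam a b t := y a b t - b + (b - 1) / t - Balpha a b (uu t).
Definition klnG a b t := ln (f a b t) - b * t + (b - 1) * ln t - (a - 1) * ln (t - 1) - ln (Bq a b (uu t)).

Lemma rder_uu t : 1 < t -> rder uu t (- uu t ^+ 2).
Proof.
move=> t1; have t0 : t - 1 != 0 by rewrite subr_eq0 gt_eqF.
refine (rder_eq (rderV (rderB (rder_id t) (rder_cst 1 t)) t0) _).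
by rewrite /uu /=; field.
Qed.

Lemma rder_BT1 a t : 1 < t -> rder (fun t => BT1 a (uu t)) t (- uu t ^+ 2 * BT1d a (uu t)).
Proof.
move=> t1; have d := rder_uu t1; rewrite /BT1 /BT1d.
refine (rder_eq (rderD (rderM (rder_cst _ t) d) (rderM (rder_cst _ t) (rderX 2 d))) _).
by rewrite /=; field.
Qed.

Lemma rder_BT1d a t : 1 < t -> rder (fun t => BT1d a (uu t)) t (- uu t ^+ 2 * ((a - 1) * (a - 2))).
Proof.
move=> t1; have d := rder_uu t1; rewrite /BT1d.
refine (rder_eq (rderD (rder_cst _ t) (rderM (rder_cst _ t) d)) _).
by rewrite /=; ring.
Qed.

Lemma rder_klnG a b t : 0 < a -> 0 < b -> 1 < t -> 0 < Bq a b (uu t) ->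
  rder (klnG a b) t (kgam a b t).
Proof.
move=> a0 b0 t1 q0; have t0 : 0 < t by apply: lt_trans t1.
have t10 : 0 < t - 1 by rewrite subr_gt0.
have fx := kf_gt0 a0 b0 (ltW t0).
have dq : rder (fun t => Bq a b (uu t)) t (- uu t ^+ 2 * BT1d a (uu t) / b).
  refine (rder_eq (rderD (rder_cst 1 t) (rderM (rder_BT1 a t1) (rder_cst b^-1 t))) _).
  by rewrite /=; ring.
refine (rder_eq (rderB (rderB (rderD (rderB (rder_ln (rder_kf t a0 b0) fx)
  (rderM (rder_cst b t) (rder_id t))) (rderM (rder_cst (b - 1) t) (rder_ln (rder_id t) t0)))
  (rderM (rder_cst (a - 1) t) (rder_ln (rderB (rder_id t) (rder_cst 1 t)) t10)))
  (rder_ln dq q0)) _).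
rewrite /kgam /y /Balpha /uu /=; rewrite -/(uu t); move: (Bq a b (uu t)) q0 (BT1d a (uu t)) => q q0 B.
rewrite /uu; move: (f a b t) (f1 a b t) fx => F F1 F0.
by field; rewrite !gt_eqF.
Qed.

(** The logarithmic derivatives of solution and approximant satisfy the same Riccati equation up to
    the residual. The difference of their squares factors, so [kgam] multiplies a coefficient
    containing f' / f. *)
Lemma rder_kgam a b t : 0 < a -> 0 < b -> 1 < t -> 0 < Bq a b (uu t) ->
  rder (kgam a b) t (- kgam a b t * (y a b t + Balpha a b (uu t) + t^-1)
    - Bres a (uu t) * uu t ^+ 2 / (b * Bq a b (uu t) * t)).
Proof.
move=> a0 b0 t1 q0; have t0 : 0 < t by apply: lt_trans t1.
have t10 : 0 < t - 1 by rewrite subr_gt0.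
have fx := kf_gt0 a0 b0 (ltW t0).
have ode := kummer_ode_real t a0 b0.
have f2E : f2 a b t = (b * (t - 1) * f1 a b t + a * b * f a b t) / t.
  by rewrite -ode mulrC mulKf// gt_eqF.
have dq : rder (fun t => Bq a b (uu t)) t (- uu t ^+ 2 * BT1d a (uu t) / b).
  refine (rder_eq (rderD (rder_cst 1 t) (rderM (rder_BT1 a t1) (rder_cst b^-1 t))) _).
  by rewrite /=; ring.
have dal : rder (fun t => Balpha a b (uu t)) t
  (- (a - 1) * uu t ^+ 2 + 2 * uu t ^+ 3 * (BT1d a (uu t) / b) / Bq a b (uu t)
   + uu t ^+ 4 * ((a - 1) * (a - 2) / b) / Bq a b (uu t)
   - uu t ^+ 4 * (BT1d a (uu t) / b) ^+ 2 / Bq a b (uu t) ^+ 2).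
  refine (rder_eq (rderB (rderM (rder_cst (a - 1) t) (rder_uu t1))
    (rderM (rderM (rderX 2 (rder_uu t1)) (rderM (rder_BT1d a t1) (rder_cst b^-1 t)))
     (rderV dq (lt0r_neq0 q0)))) _).
  rewrite /=; move: (Bq a b (uu t)) q0 (BT1d a (uu t)) => q q0 B; move: (uu t) => u.
  by field; rewrite !gt_eqF.
refine (rder_eq (rderB (rderD (rderB (rderM (rder_kf1 t a0 b0) (rderV (rder_kf t a0 b0) (lt0r_neq0 fx)))
  (rder_cst b t)) (rderM (rder_cst (b - 1) t) (rderV (rder_id t) (lt0r_neq0 t0)))) dal) _).
rewrite /= f2E /kgam /y.
have tE : t = 1 + (uu t)^-1 by rewrite /uu invrK addrC subrK.
have u0 : 0 < uu t by rewrite invr_gt0.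
move: (uu t) u0 q0 tE t0 t1 fx => u u0 q0 tE t0 t1.
move: (f a b t) (f1 a b t) => F F1 F0.
have qE : b * Bq a b u = b + BT1 a u by rewrite /Bq; field; rewrite gt_eqF.
have bT : 0 < b + BT1 a u by rewrite -qE mulr_gt0.
have E : Bq a b u = (b + BT1 a u) / b by rewrite -qE mulrC mulKf// gt_eqF.
have u1 : 1 + u != 0 by rewrite gt_eqF// addr_gt0.
have -> : t = (1 + u) / u by rewrite tE; field; rewrite gt_eqF.
rewrite /Balpha E; move: bT; rewrite /BT1 /BT1d /Bres => bT.
field; rewrite ?u1 !gt_eqF//; lra.
Qed.

Lemma quad_bounded (c0 c1 c2 U : R) : 0 <= U -> exists2 K, 1 <= K &
  forall u, 0 <= u -> u <= U -> `|c0 + c1 * u + c2 * u ^+ 2| <= K.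
Proof.
move=> U0; exists (1 + `|c0| + `|c1| * U + `|c2| * U ^+ 2).
  by rewrite -!addrA lerDl !addr_ge0 ?(mulr_ge0 (normr_ge0 _)) ?sqr_ge0.
move=> u u0 uU; have u2 : u ^+ 2 <= U ^+ 2 by rewrite ler_sqr ?nnegrE.
have h1 : `|c1 * u| <= `|c1| * U by rewrite normrM (ger0_norm u0) ler_wpM2l.
have h2 : `|c2 * u ^+ 2| <= `|c2| * U ^+ 2 by rewrite normrM (ger0_norm (sqr_ge0 u)) ler_wpM2l.
have := ler_normD (c0 + c1 * u) (c2 * u ^+ 2); have := ler_normD c0 (c1 * u).
lra.
Qed.

Lemma ln_near1 (q : R) : `|q - 1| <= 1 / 2 -> `|ln q| <= 2 * `|q - 1|.
Proof.
move=> h; have := h; rewrite ler_norml => /andP[h1 h2].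
have q0 : 0 < q by lra.
have l1 := ln_le_sub1 q0.
have qi0 : 0 < q^-1 by rewrite invr_gt0.
have := ln_le_sub1 qi0; rewrite lnV ?posrE// => l3.
have e : q^-1 - 1 = (1 - q) / q by field; rewrite gt_eqF.
have l4 : q^-1 - 1 <= 2 * `|q - 1|.
  rewrite e ler_pdivrMr//; have := ler_norm (1 - q); rewrite distrC => h3.
  have := normr_ge0 (q - 1); nra.
have h3 := ler_norm (q - 1); have h4 := normr_ge0 (q - 1).
by rewrite ler_norml; apply/andP; split; lra.
Qed.

Lemma expR_neg_cube (s : R) : 0 < s -> expR (- s) <= 27 / s ^+ 3.
Proof.
move=> s0; have h : s / 3 <= expR (s / 3) by apply: le_trans (expR_ge1Dx _); rewrite lerDr.
rewrite expRN -[27 / _]invf_div lef_pV2 ?posrE ?expR_gt0 ?divr_gt0 ?exprn_gt0//.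
have -> : expR s = expR (s / 3) ^+ 3 by rewrite -expRM_natl; congr expR; field.
have -> : s ^+ 3 / 27 = (s / 3) ^+ 3 by field.
by rewrite lerXn2r ?nnegrE ?expR_ge0// divr_ge0// ltW.
Qed.

Section Asymptotics.
Variables (a x0 : R).
Hypotheses (a0 : 0 < a) (x1 : 1 < x0).
(** The Riccati estimate starts at the midpoint of 1 and x0; over the distance x0 - t2 the transient
    of its crude initial value decays exponentially in b. *)
Let t2 := (1 + x0) / 2.
Let U := uu t2.

Lemma t2_gt1 : 1 < t2. Proof. have := x1; rewrite /t2; lra. Qed.
Lemma t2_lt : t2 < x0. Proof. have := x1; rewrite /t2; lra. Qed.

Lemma uu_bnd t : t2 <= t -> 0 < uu t <= U.
Proof.
have h := t2_gt1 => tt; have t1 : 1 < t by apply: lt_le_trans tt.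
by rewrite invr_gt0 subr_gt0 t1 /U /uu lef_pV2 ?posrE ?subr_gt0// lerD2r.
Qed.

(** Half of the rate given by [kf1_lower] at t2, where 1 - 1/t is smallest; the other half absorbs
    [Balpha] for large b. *)
Let k := Num.min 1 a * (1 - t2^-1) / 2.

Lemma k_gt0 : 0 < k.
Proof.
have h := t2_gt1; rewrite /k divr_gt0// mulr_gt0// ?lt_min ?ltr01// subr_gt0 invf_lt1//.
exact: lt_trans h.
Qed.

Lemma real_axis_coeffs : exists C b0, [/\ 1 <= C, 1 <= b0, a <= b0 &
  forall b, b0 <= b -> forall t, t2 <= t ->
  [/\ `|BT1 a (uu t) / b| <= C * uu t, `|BT1 a (uu t) / b| <= 1 / 2,
    `|Balpha a b (uu t)| <= C, k * b <= y a b t + Balpha a b (uu t) + t^-1 &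
    `|Bres a (uu t) * uu t ^+ 2 / (b * Bq a b (uu t) * t)| <= C * uu t ^+ 2 / b]].
Proof.
have h2 := t2_gt1; have k0 := k_gt0.
have U0 : 0 < U by have [] := andP (uu_bnd (lexx t2)).
have [KT KT1 hT] := quad_bounded (a * (a - 1)) ((a - 1) * (a - 2) / 2) 0 (ltW U0).
have [KD KD1 hD] := quad_bounded (a * (a - 1)) ((a - 1) * (a - 2)) 0 (ltW U0).
pose p := a * (a - 1) * (a - 2); pose s := (a - 1) * (a - 2) * (a - 3) / 2.
have [KR KR1 hR] := quad_bounded ((a - 3) * p + 2 * p)
   ((a - 3) * p + (a - 4) * s + 2 * s) ((a - 4) * s) (ltW U0).
pose Ka := `|a - 1| * U + 2 * KD * U ^+ 2.
have Ka0 : 0 <= Ka by rewrite /Ka addr_ge0 ?mulr_ge0 ?sqr_ge0 ?(ltW U0)//; lra.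
exists (KT + 2 * KR + Ka), (1 + a + 2 * KT * U + Ka / k).
have Kk : 0 <= Ka / k by rewrite divr_ge0// ltW.
have KTU : 0 <= KT * U by rewrite mulr_ge0//; lra.
have a0' := a0; split; [lra|lra|lra|].
move=> b bb t tt; have b1 : 1 <= b by lra.
have b0 : 0 < b by lra.
have [u0 uU] := andP (uu_bnd tt).
have bi1 : b^-1 <= 1 by rewrite invf_le1.
have bi0 : 0 < b^-1 by rewrite invr_gt0.
have t1 : 1 < t by apply: lt_le_trans tt.
have t0 : 0 < t by lra.
have T1 : `|BT1 a (uu t)| <= KT * uu t.
  rewrite (_ : BT1 a (uu t) = (a * (a - 1) + (a - 1) * (a - 2) / 2 * uu t + 0 * uu t ^+ 2) * uu t).
    by rewrite normrM (gtr0_norm u0) ler_pM2r// hT// ltW.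
  by rewrite /BT1; ring.
have T2 : `|BT1 a (uu t) / b| <= KT * uu t / b.
  by rewrite normrM (gtr0_norm bi0) ler_pM2r.
have KTu0 : 0 <= KT * uu t by rewrite mulr_ge0 ?(ltW u0)//; lra.
have T3 : `|BT1 a (uu t) / b| <= 1 / 2.
  apply: le_trans T2 _; rewrite ler_pdivrMr//.
  have : KT * uu t <= KT * U by rewrite ler_wpM2l//; lra.
  lra.
have q2 : 1 / 2 <= Bq a b (uu t).
  by move: T3; rewrite /Bq ler_norml => /andP[? ?]; lra.
have q0 : 0 < Bq a b (uu t) by lra.
have qi0 : 0 < (Bq a b (uu t))^-1 by rewrite invr_gt0.
have qi : (Bq a b (uu t))^-1 <= 2.
  by rewrite -[2]invrK lef_pV2 ?posrE ?invr_gt0//; lra.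
have u2 : uu t ^+ 2 <= U ^+ 2 by rewrite ler_sqr ?nnegrE// ltW.
have D1 : `|BT1d a (uu t)| <= KD.
  by have := hD _ (ltW u0) uU; rewrite mul0r addr0.
have al : `|Balpha a b (uu t)| <= Ka.
  apply: le_trans (ler_normB _ _) _; apply: lerD.
    by rewrite normrM (gtr0_norm u0) ler_wpM2l.
  rewrite -[X in `|X|]mulrA normrM (ger0_norm (sqr_ge0 (uu t))) normrM (gtr0_norm qi0).
  rewrite normrM (gtr0_norm bi0) mulrA.
  apply: le_trans (_ : U ^+ 2 * (KD * 1) * 2 <= _); last by lra.
  have Db : 0 <= `|BT1d a (uu t)| * b^-1 by rewrite mulr_ge0// ltW.
  apply: (ler_pM (mulr_ge0 (sqr_ge0 _) Db) (ltW qi0) _ qi).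
  exact: (ler_pM (sqr_ge0 _) Db u2 (ler_pM (normr_ge0 _) (ltW bi0) D1 bi1)).
split.
- apply: le_trans T2 _; apply: le_trans (_ : KT * uu t <= _).
    by rewrite ler_piMr.
  rewrite ler_pM2r//; lra.
- exact: T3.
- by apply: le_trans al _; lra.
- have yk : 2 * k * b <= y a b t.
    rewrite ler_pdivlMr; last exact: kf_gt0 (ltW t0).
    apply: le_trans (kf1_lower a0 b0 (ltW t1)).
    apply: ler_wpM2r; first exact/ltW/kf_gt0/ltW.
    rewrite /k mulrCA mulfV// mulr1 mulrC -mulrA ler_pM2l// ler_wpM2l//.
      by rewrite le_min ler01 ltW.
    by rewrite lerD2l lerN2 lef_pV2 ?posrE//; lra.
  have kb : Ka <= k * b by rewrite mulrC -ler_pdivrMr//; lra.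
  have ti : 0 < t^-1 by rewrite invr_gt0.
  move: al; rewrite ler_norml => /andP[? ?]; lra.
- rewrite (_ : Bres a (uu t) = (a - 3) * p + 2 * p + ((a - 3) * p + (a - 4) * s + 2 * s) * uu t + ((a - 4) * s) * uu t ^+ 2); last first.
    by rewrite /Bres /p /s; field.
  have ti : 0 < t^-1 by rewrite invr_gt0.
  have ti1 : t^-1 <= 1 by rewrite invf_le1// ltW.
  have i1 : (b * Bq a b (uu t) * t)^-1 <= b^-1 * 2 * 1.
    rewrite !invfM; apply: ler_pM => //; rewrite ?mulr_ge0 ?(ltW bi0) ?(ltW qi0) ?(ltW ti)//.
    by apply: ler_pM; rewrite // ?(ltW bi0) ?(ltW qi0).
  have i0 : 0 <= (b * Bq a b (uu t) * t)^-1 by rewrite invr_ge0 !mulr_ge0// ltW.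
  rewrite -[X in `|X|]mulrA normrM (ger0_norm (mulr_ge0 (sqr_ge0 (uu t)) i0)) mulrA.
  apply: le_trans (_ : KR * uu t ^+ 2 * (b^-1 * 2 * 1) <= _).
    apply: (ler_pM (mulr_ge0 (normr_ge0 _) (sqr_ge0 _)) i0 _ i1).
    by apply: (ler_wpM2r (sqr_ge0 (uu t))); apply: hR => //; exact: ltW.
  have ub : 0 <= uu t ^+ 2 / b by rewrite mulr_ge0 ?sqr_ge0// ltW.
  rewrite (_ : KR * _ * _ = 2 * KR * (uu t ^+ 2 / b)); last by ring.
  by rewrite -[leRHS]mulrA; apply: ler_wpM2r => //; lra.
Qed.

Section Fixed.
Variables (b C : R).
Hypotheses (C1 : 1 <= C) (b1 : 1 <= b) (ab : a <= b) (Ub : 4 * U <= k * b).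
Hypothesis hc : forall t, t2 <= t ->
  [/\ `|BT1 a (uu t) / b| <= C * uu t, `|BT1 a (uu t) / b| <= 1 / 2,
    `|Balpha a b (uu t)| <= C, k * b <= y a b t + Balpha a b (uu t) + t^-1 &
    `|Bres a (uu t) * uu t ^+ 2 / (b * Bq a b (uu t) * t)| <= C * uu t ^+ 2 / b].

Lemma Bq_gt0 t : t2 <= t -> 0 < Bq a b (uu t).
Proof. by move=> /hc[_ + _ _ _]; rewrite /Bq ler_norml => /andP[? ?]; lra. Qed.

(** Barrier for |kgam|: the transient of the initial value plus a quasi-stationary part. Source C
    u^2 / b over rate k b gives C u^2 / (k b^2); the factor 2 pays for the decay of u^2, as
    [4 * U <= k * b]. *)
Let M t := (1 + C) * b * expR (- (k * b * (t - t2))) + 2 * C / k / b ^+ 2 * uu t ^+ 2.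

Lemma kgam_init : `|kgam a b t2| <= (1 + C) * b.
Proof.
have h2 := t2_gt1; have [_ _ al _ _] := hc (lexx t2).
have b0 : 0 < b by apply: lt_le_trans b1.
have t0 : 0 <= t2 by lra.
have y0 : 0 <= y a b t2 by apply: divr_ge0; [exact: kf1_ge0|exact/ltW/kf_gt0].
have yb : y a b t2 <= b by rewrite ler_pdivrMr; [exact: kf1_le|exact: kf_gt0].
have b1' := b1; have C1' := C1.
have z0 : 0 <= (b - 1) / t2 by rewrite divr_ge0// subr_ge0.
have z1 : (b - 1) / t2 <= b by rewrite ler_pdivrMr; [nra|lra].
move: al; rewrite ler_norml /kgam => /andP[? ?].
by rewrite ler_norml; apply/andP; split; nra.
Qed.

(** The sign s = 1 or -1 treats both halves of the bound on |kgam| at once. *)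
Lemma kgam_signed_bound s t : s ^+ 2 = 1 -> t2 <= t -> 0 <= M t + s * kgam a b t.
Proof.
move=> s1 tt; have b0 : 0 < b by apply: lt_le_trans b1.
have C0 : 0 < C by apply: lt_le_trans C1.
have h2 := t2_gt1; have k0 := k_gt0.
have s1' : `|s| = 1 by apply/eqP; rewrite -sqrp_eq1// -normrX s1 normr1.
have sle (x : R) : - `|x| <= s * x <= `|x| by rewrite -ler_norml normrM s1' mul1r.
have cc0 : 0 <= 2 * C / k / b ^+ 2.
  by apply: divr_ge0 (sqr_ge0 _); apply: divr_ge0 (ltW k0); rewrite mulr_ge0// ltW.
have c10 : 0 <= (1 + C) * b by apply: mulr_ge0; lra.
pose r t := Bres a (uu t) * uu t ^+ 2 / (b * Bq a b (uu t) * t).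
pose Q t := y a b t + Balpha a b (uu t) + t^-1.
have D0 t' : t2 <= t' -> 1 < t' by apply: lt_le_trans.
(* The integrating factor needs a primitive of [Q = y + Balpha + 1/t]. As y and [kgam] are the
   derivatives of ln f and [klnG], the combination 2 ln f - klnG - b t + b ln t is one. *)
apply: (@linear_barrier (fun t => M t + s * kgam a b t)
  (fun t => (- (k * b) * ((1 + C) * b * expR (- (k * b * (t - t2)))) - 4 * C / k / b ^+ 2 * uu t ^+ 3)
     + s * (- kgam a b t * Q t - r t))
  (fun t => 2 * ln (f a b t) - klnG a b t - b * t + b * ln t) Q t2 t tt).
- move=> u /andP[tu _]; have u1 := D0 _ tu.
  refine (rder_eq (rderD (rderD (rderM (rder_cst ((1 + C) * b) u) (rder_exp (rderN (rderM (rder_cst (k * b) u)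
    (rderB (rder_id u) (rder_cst t2 u)))))) (rderM (rder_cst (2 * C / k / b ^+ 2) u) (rderX 2 (rder_uu u1))))
    (rderM (rder_cst s u) (rder_kgam a0 b0 u1 (Bq_gt0 tu)))) _).
  rewrite /= /Q /r; move: (Bres _ _ * _ / _) (kgam _ _ _) (y _ _ _ + _ + _) => p q w.
  by ring.
- move=> u /andP[tu _]; have u1 := D0 _ tu; have u0 : 0 < u by lra.
  have fu := kf_gt0 a0 b0 (ltW u0).
  refine (rder_eq (rderD (rderB (rderB (rderM (rder_cst 2 u) (rder_ln (rder_kf u a0 b0) fu))
   (rder_klnG a0 b0 u1 (Bq_gt0 tu))) (rderM (rder_cst b u) (rder_id u)))
   (rderM (rder_cst b u) (rder_ln (rder_id u) u0))) _).
  rewrite /kgam /Q -/(y a b u) /=; move: (Balpha _ _ _) (y a b u) => p q.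
  by field; rewrite gt_eqF.
- move=> u /andP[tu _]; have [_ _ _ hQ hr] := hc tu.
  rewrite -/(r u) in hr; rewrite -/(Q u) in hQ.
  have [v0 vU] := andP (uu_bnd tu).
  rewrite [leRHS](_ : _ = (Q u - k * b) * M u + 2 * C / k / b ^+ 2 * uu u ^+ 2 * (k * b - 2 * uu u) - s * r u); last first.
    by rewrite /M; ring.
  have [_ sr] := andP (sle (r u)).
  have M0 : 0 <= M u.
    apply: addr_ge0; first exact: mulr_ge0 c10 (expR_ge0 _).
    exact: mulr_ge0 cc0 (sqr_ge0 _).
  have Qk : 0 <= Q u - k * b by rewrite subr_ge0.
  have h1 : 0 <= (Q u - k * b) * M u := mulr_ge0 Qk M0.
  have h3 : C * uu u ^+ 2 / b <= 2 * C / k / b ^+ 2 * uu u ^+ 2 * (k * b - 2 * uu u).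
    have -> : C * uu u ^+ 2 / b = 2 * C / k / b ^+ 2 * uu u ^+ 2 * (k * b / 2).
      by field; rewrite !gt_eqF.
    apply: ler_wpM2l; last by have := Ub; lra.
    exact: mulr_ge0 cc0 (sqr_ge0 _).
  lra.
- have := sle (kgam a b t2) => /andP[sl _].
  have := kgam_init => ki.
  have : (1 + C) * b <= M t2.
    rewrite /M subrr mulr0 oppr0 expR0 mulr1 lerDl.
    exact: mulr_ge0 cc0 (sqr_ge0 _).
  lra.
Qed.

Lemma kgam_bound t : t2 <= t -> `|kgam a b t| <= M t.
Proof.
move=> tt; have h1 := @kgam_signed_bound 1 t; have h2 := @kgam_signed_bound (-1) t.
rewrite sqrrN !expr1n in h1 h2.
have := h1 erefl tt; have := h2 erefl tt; rewrite mulN1r mul1r => ? ?.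
by rewrite ler_norml; apply/andP; split; lra.
Qed.

(** The barrier [M] has the explicit primitive [Psi], which stays nonpositive; hence its integral
    over [x0, t] is at most - Psi x0, whatever t is. *)
Lemma klnG_oscillation t : x0 <= t -> `|klnG a b t - klnG a b x0| <=
  (1 + C) / k * expR (- (k * b * (x0 - t2))) + 2 * C / k / b ^+ 2 * uu x0.
Proof.
move=> xt; have b0 : 0 < b by apply: lt_le_trans b1.
have C0 : 0 < C by apply: lt_le_trans C1.
have h2 := t2_gt1; have k0 := k_gt0; have tx := t2_lt.
pose Psi t := - ((1 + C) / k * expR (- (k * b * (t - t2)))) - 2 * C / k / b ^+ 2 * uu t.
have dPsi u : 1 < u -> rder Psi u (M u).
  move=> u1; refine (rder_eq (rderB (rderN (rderM (rder_cst _ u) (rder_exp (rderN (rderM (rder_cst (k * b) u)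
    (rderB (rder_id u) (rder_cst t2 u))))))) (rderM (rder_cst _ u) (rder_uu u1))) _).
  rewrite /M /=; move: (expR _) (uu u) => p q; field; rewrite !gt_eqF//.
have hu u : x0 <= u <= t -> [/\ 1 < u, t2 <= u & 0 < Bq a b (uu u)].
  move=> /andP[xu _]; have u2 : t2 <= u by lra.
  by split => //; [lra|exact: Bq_gt0].
have up : Psi x0 - klnG a b x0 <= Psi t - klnG a b t.
  apply: (@rder_ge0_ndecr R (fun t => Psi t - klnG a b t) (fun t => M t - kgam a b t) _ _ xt) => u /hu[u1 u2 uq].
    exact: rderB (dPsi _ u1) (rder_klnG a0 b0 u1 uq).
  by have := kgam_bound u2; rewrite ler_norml => /andP[? ?]; lra.
have lo : Psi x0 + klnG a b x0 <= Psi t + klnG a b t.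
  apply: (@rder_ge0_ndecr R (fun t => Psi t + klnG a b t) (fun t => M t + kgam a b t) _ _ xt) => u /hu[u1 u2 uq].
    exact: rderD (dPsi _ u1) (rder_klnG a0 b0 u1 uq).
  by have := kgam_bound u2; rewrite ler_norml => /andP[? ?]; lra.
have Psi0 : Psi t <= 0.
  have ut : 0 < uu t by have [] := andP (uu_bnd (_ : t2 <= t)) => //; lra.
  have cc0 : 0 <= 2 * C / k / b ^+ 2.
    by apply: divr_ge0 (sqr_ge0 _); apply: divr_ge0 (ltW k0); rewrite mulr_ge0// ltW.
  have c10 : 0 <= (1 + C) / k by apply: divr_ge0; lra.
  rewrite /Psi -opprD oppr_le0; apply: addr_ge0; first exact: mulr_ge0 c10 (expR_ge0 _).
  exact: mulr_ge0 cc0 (ltW ut).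
rewrite [leRHS](_ : _ = - Psi x0); last by rewrite /Psi; ring.
move: (Psi x0) (Psi t) (klnG a b t) (klnG a b x0) up lo Psi0 => p q l m.
by rewrite ler_norml => *; apply/andP; split; lra.
Qed.

Lemma klnG_near_limit e : a < b -> 0 < e -> exists2 t, x0 <= t &
  `|klnG a b t - (ln (Gamma b) - ln (Gamma a) + (a - b) * ln b)| <= e.
Proof.
move=> ab' e0; have b0 : 0 < b by apply: lt_le_trans b1.
have C1' := C1; have K0 : 0 < 4 + `|a - 1| + 2 * C by have := normr_ge0 (a - 1); lra.
set K := 4 + _ + _ in K0.
(* K collects the error contributions: 4 from the limit of f, |a - 1| from ln t - ln (t - 1), and 2
   C from ln Bq. The cap 1/8 keeps the logarithms in the range of [ln_near1]. *)
pose e1 := Num.min (e / K) (1 / 8).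
have e10 : 0 < e1 by rewrite lt_min !divr_gt0.
have e1e : K * e1 <= e by rewrite mulrC -ler_pdivlMr// ge_min lexx.
have e18 : e1 <= 1 / 8 by rewrite ge_min lexx orbT.
have e11 : e1 < 1 by lra.
have ln_near (q : R) : `|q - 1| <= 2 * e1 -> `|ln q| <= 4 * e1.
  by move=> hq; apply: le_trans (ln_near1 _) _; lra.
have [X hX] := kf_at_infinity a0 ab' e10 e11.
pose t := Num.max X (Num.max x0 (1 + e1^-1)).
have tX : X <= t by rewrite le_max lexx.
have tx : x0 <= t by rewrite !le_max lexx orbT.
have te : 1 + e1^-1 <= t by rewrite !le_max lexx !orbT.
exists t => //; move: t tX tx te => t tX tx te.
have h2 := t2_gt1; have x2 := t2_lt; have t1 : 1 < t by lra.
have t0 : 0 < t by lra.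
have t10 : 0 < t - 1 by lra.
have [hq1 hq2 _ _ _] := hc (le_trans (ltW x2) tx).
have q0 := Bq_gt0 (le_trans (ltW x2) tx).
have ue : uu t <= e1.
  by rewrite /uu -[e1]invrK lef_pV2 ?posrE ?invr_gt0//; lra.
have u0 : 0 < uu t by rewrite invr_gt0.
have lq : `|ln (Bq a b (uu t))| <= 2 * C * e1.
  have e3 : Bq a b (uu t) - 1 = BT1 a (uu t) / b by rewrite /Bq addrC addKr.
  apply: le_trans (ln_near1 _) _; rewrite e3//.
  rewrite -mulrA ler_pM2l//; apply: le_trans hq1 _.
  by rewrite ler_wpM2l//; lra.
have lt_ : 0 <= ln t - ln (t - 1) <= e1.
  rewrite -ln_div ?posrE//.
  have -> : t / (t - 1) = 1 + uu t by rewrite /uu; field; rewrite gt_eqF.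
  rewrite ln_ge0/=; last by rewrite lerDl ltW.
  by apply: le_trans ue; apply: le_ln1Dx; lra.
have F0 := kf_gt0 a0 b0 (ltW t0).
have ga := Gamma_gt0 a0; have gb := Gamma_gt0 b0.
have bt0 : 0 < b * t by rewrite mulr_gt0.
have prod_ln (P Q F A B : R) : 0 < P -> 0 < Q -> 0 < F -> 0 < A -> 0 < B ->
    ln (P * Q * (F * (A / B))) = ln P + ln Q + (ln F + (ln A - ln B)).
  move=> ? ? ? ? ?; have AB : 0 < A / B by rewrite divr_gt0.
  have PQ : 0 < P * Q by rewrite mulr_gt0.
  have FAB : 0 < F * (A / B) by rewrite mulr_gt0.
  by rewrite (lnM PQ FAB) (@lnM R P Q) ?posrE// (@lnM R F (A / B)) ?posrE// ln_div ?posrE.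
have := hX t tX t0; set p := (_ * _ * _) => hp.
have lp : `|ln p| <= 4 * e1.
  exact: ln_near.
have lpE : ln p = - (b * t) + (b - a) * (ln b + ln t) + (ln (f a b t) + (ln (Gamma a) - ln (Gamma b))).
  rewrite /p prod_ln ?expR_gt0//; last exact: powR_gt0.
  by rewrite expRK ln_powR lnM ?posrE.
have -> : klnG a b t - (ln (Gamma b) - ln (Gamma a) + (a - b) * ln b) =
   ln p + (a - 1) * (ln t - ln (t - 1)) - ln (Bq a b (uu t)).
  rewrite lpE /klnG; move: (ln (f a b t)) (ln (Gamma a)) (ln (Gamma b)) (ln b) (ln t) (ln (t - 1)) (ln (Bq _ _ _)).
  by move=> ? ? ? ? ? ? ?; ring.
have la : `|(a - 1) * (ln t - ln (t - 1))| <= `|a - 1| * e1.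
  by move: lt_ => /andP[l1 l2]; rewrite normrM (ger0_norm l1) ler_wpM2l.
apply: le_trans e1e; apply: le_trans (ler_normB _ _) _.
apply: le_trans (lerD (ler_normD _ _) lq) _.
apply: le_trans (lerD (lerD lp la) (lexx _)) _.
by rewrite /K !mulrDl.
Qed.

End Fixed.

Lemma real_axis_data : exists C b0, forall b, b0 <= b ->
  [/\ `|klnG a b x0 - (ln (Gamma b) - ln (Gamma a) + (a - b) * ln b)| <= C / b ^+ 2,
      `|kgam a b x0| <= C / b ^+ 2 & 0 < Bq a b (uu x0)].
Proof.
have [C [b0 [C1 b01 ab0 hc]]] := real_axis_coeffs.
have k0 := k_gt0; have tx := t2_lt; have h2 := t2_gt1.
have U0 : 0 < U by have [] := andP (uu_bnd (lexx t2)).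
have xu : 0 < uu x0 by have [] := andP (uu_bnd (ltW tx)).
have s0 : 0 < k * (x0 - t2) by rewrite mulr_gt0// subr_gt0.
set s := k * (x0 - t2) in s0.
pose C2 := 2 * C / k * uu x0; pose C3 := 2 * C / k * uu x0 ^+ 2.
pose C4 := (1 + C) * (27 / s ^+ 3).
have C40 : 0 <= C4 by rewrite /C4; apply: mulr_ge0; [lra|rewrite divr_ge0// exprn_ge0// ltW].
have C20 : 0 <= 2 * C / k by apply: divr_ge0 (ltW k0); lra.
have C30 : 0 <= C3 by rewrite mulr_ge0// sqr_ge0.
have C2' : 0 <= C2 by rewrite mulr_ge0// ltW.
have C5 : 0 <= C4 / k by rewrite divr_ge0// ltW.
exists (C2 + C3 + C4 + C4 / k), (b0 + 4 * U / k) => b bb.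
have Uk : 0 < 4 * U / k by rewrite divr_gt0// mulr_gt0.
have b0b : b0 <= b by lra.
have b1 : 1 <= b by lra.
have b00 : 0 < b by lra.
have ab : a < b by lra.
have Ub : 4 * U <= k * b by rewrite (mulrC k) -ler_pdivrMr//; lra.
have hcb := hc b b0b.
have bi0 : 0 <= b ^- 2 by rewrite invr_ge0 sqr_ge0.
(* A cubic bound on the exponential is used because the transient carries a factor b and must still
   be O(b^-2). *)
have ex : expR (- (k * b * (x0 - t2))) <= 27 / s ^+ 3 * (b^-1 * b ^- 2).
  have -> : k * b * (x0 - t2) = s * b by rewrite /s; ring.
  apply: le_trans (expR_neg_cube _) _; first by rewrite mulr_gt0.
  by rewrite le_eqVlt; apply/orP; left; apply/eqP; field; rewrite !gt_eqF.
have b1' : b^-1 <= 1 by rewrite invf_le1.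
have e27 : 0 <= 27 / s ^+ 3 by rewrite divr_ge0// exprn_ge0// ltW.
split.
(* The distance to the limit value is controlled through a remote point t: the oscillation bound is
   uniform in t, and e is arbitrary. *)
- apply/ler_addgt0Pr => e e0.
  have [t xt ht] := klnG_near_limit C1 b1 hcb ab e0.
  have osc := klnG_oscillation C1 b1 (ltW ab) Ub hcb xt.
  have ex2 : (1 + C) / k * expR (- (k * b * (x0 - t2))) <= C4 / k * b ^- 2.
    have c1 : 0 <= (1 + C) / k by apply: divr_ge0 (ltW k0); lra.
    apply: le_trans (ler_wpM2l c1 ex) _.
    have -> : C4 / k * b ^- 2 = (1 + C) / k * (27 / s ^+ 3 * (1 * b ^- 2)) by rewrite /C4; ring.
    by apply: ler_wpM2l => //; apply: ler_wpM2l => //; apply: ler_wpM2r.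
  have e2 : 2 * C / k / b ^+ 2 * uu x0 = C2 * b ^- 2 by rewrite /C2; ring.
  rewrite e2 in osc.
  have c3 := mulr_ge0 C30 bi0; have c4 := mulr_ge0 C40 bi0.
  have osc' := le_trans osc (lerD ex2 (lexx _)).
  have -> : (C2 + C3 + C4 + C4 / k) / b ^+ 2 = C2 * b ^- 2 + C3 * b ^- 2 + C4 * b ^- 2 + C4 / k * b ^- 2.
    by ring.
  move: ht osc' c3 c4; clear.
  move: (klnG a b t) (klnG a b x0) (_ + (a - b) * ln b) => p q r ht o c3 c4.
  by have := ler_distD p q r; rewrite (distrC q p); lra.
- apply: le_trans (kgam_bound C1 b1 (ltW ab) Ub hcb (ltW tx)) _.
  have ex3 : (1 + C) * b * expR (- (k * b * (x0 - t2))) <= C4 * b ^- 2.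
    have c1 : 0 <= (1 + C) * b by apply: mulr_ge0; lra.
    apply: le_trans (ler_wpM2l c1 ex) _.
    rewrite le_eqVlt; apply/orP; left; apply/eqP; rewrite /C4.
    by field; rewrite !gt_eqF.
  have e3 : 2 * C / k / b ^+ 2 * uu x0 ^+ 2 = C3 * b ^- 2 by rewrite /C3; ring.
  have c2 := mulr_ge0 C2' bi0; have c4 := mulr_ge0 C5 bi0.
  have -> : (C2 + C3 + C4 + C4 / k) / b ^+ 2 = C2 * b ^- 2 + C3 * b ^- 2 + C4 * b ^- 2 + C4 / k * b ^- 2.
    by ring.
  rewrite e3; lra.
- exact: (Bq_gt0 hcb (ltW tx)).
Qed.

End Asymptotics.
End RealAxis.

(** * Region B *)

Section RegionB.
Variables (R : realType) (a : R).
Hypothesis a0 : 0 < a.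
Local Notation C := (Cplx R).
Implicit Types (z u : C) (b l : R).

(* [expR l] is the limit at infinity of the normalised solution, and [1 / WB] is
   [exp (b z) * z^(1 - b) * expR l]. *)
Definition WB b l z : C := cexp (cofR (b - 1) * clog z - cofR b * z - cofR l).
Definition pB b z : C := cofR (b - 1) * z^-1 - cofR b.
Definition vB b l z : C := kf a b z * WB b l z.
Definition vB1 b l z : C := (kf1 a b z + pB b z * kf a b z) * WB b l z.
Definition vB2 b l z : C := (kf2 a b z + 2 * pB b z * kf1 a b z
  + (pB b z ^+ 2 - cofR (b - 1) * z^-1 ^+ 2) * kf a b z) * WB b l z.

Definition QB z : C := cpow (z - 1) (cofR (a - 1)).
Definition uB z : C := (z - 1)^-1.
Definition qB b u : C := Bq (cofR a) (cofR b) u.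
Definition AB b z : C := QB z * qB b (uB z).
Definition qB1 b u : C := (cofR a - 1) * u * qB b u - u ^+ 2 * (BT1d (cofR a) u / cofR b).
Definition AB1 b z : C := QB z * qB1 b (uB z).
Definition qB2 b u : C := (cofR a - 1) * u * qB1 b u
  - u ^+ 2 * ((cofR a - 1) * qB b u + (cofR a - 1) * u * (BT1d (cofR a) u / cofR b)
     - 2 * u * (BT1d (cofR a) u / cofR b) - u ^+ 2 * ((cofR a - 1) * (cofR a - 2) / cofR b)).
Definition AB2 b z : C := QB z * qB2 b (uB z).

Lemma cdiff_WB b l z : slit z -> cdiff (WB b l) z (pB b z * WB b l z).
Proof.
move=> hz; refine (cdiff_eq (cdiff_comp (F := @cexp R)
  (G := fun z => cofR (b - 1) * clog z - cofR b * z - cofR l) (cdiff_cexp _)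
  (cdiffB (cdiffB (cdiffM (cdiff_cst _ z) (cdiff_clog hz)) (cdiffM (cdiff_cst _ z) (cdiff_id z)))
  (cdiff_cst _ z))) _).
by rewrite /pB /WB; ring.
Qed.

Lemma cdiff_vB b l z : 0 < b -> slit z -> cdiff (vB b l) z (vB1 b l z).
Proof.
move=> b0 hz; have dk : cdiff (kf a b) z (kf1 a b z) by exact: cdiff_kf.
refine (cdiff_eq (cdiffM dk (cdiff_WB b l hz)) _); rewrite /vB1; ring.
Qed.

Lemma cdiff_vB1 b l z : 0 < b -> slit z -> cdiff (vB1 b l) z (vB2 b l z).
Proof.
move=> b0 hz; have dk : cdiff (kf a b) z (kf1 a b z) by exact: cdiff_kf.
have dk1 : cdiff (kf1 a b) z (kf2 a b z) by exact: cdiff_kf1.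
have dV : cdiff (fun z : C => z^-1) z (- z^-1 ^+ 2).
  refine (cdiff_eq (cdiffV (slit_neq0 hz)) _); field; exact: slit_neq0.
have dp : cdiff (pB b) z (- cofR (b - 1) * z^-1 ^+ 2).
  refine (cdiff_eq (cdiffB (cdiffM (cdiff_cst _ z) dV) (cdiff_cst _ z)) _); ring.
refine (cdiff_eq (cdiffM (cdiffD dk1 (cdiffM dp dk)) (cdiff_WB b l hz)) _).
rewrite /vB2; ring.
Qed.

(** The factor exp (- b z) z^(b - 1) interchanges fast and slow solutions: the leading coefficient
    of the first-order term changes from b (1 - z) to b (z - 1), which reverses the direction of
    damping. *)
Lemma vB_ode b l z : 0 < b -> slit z ->
  z * vB2 b l z = - (cofR b * (z - 1) + 2) * vB1 b l z + cofR b * (cofR a - 1) * vB b l z.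
Proof.
move=> b0 hz; have z0 := slit_neq0 hz; have h := @kummer_ode R a b z a0 b0.
have e : kf2 a b z = (- (cofR b * (1 - z)) * kf1 a b z + cofR (a * b) * kf a b z) / z.
  by rewrite -h mulrC mulKf.
rewrite /vB2 /vB1 /vB e /pB rmorphM rmorphB rmorph1. rewrite /=.
move: (WB b l z) (kf a b z) (kf1 a b z) (cofR a) (cofR b) => W F F1 A B.
by field.
Qed.

Lemma cdiff_uB z : z - 1 != 0 -> cdiff uB z (- uB z ^+ 2).
Proof.
move=> h; have d1 : cdiff (fun w : C => w - 1) z 1.
  refine (cdiff_eq (cdiffB (cdiff_id z) (cdiff_cst 1 z)) _); ring.
refine (cdiff_eq (cdiff_comp (F := fun w : C => w^-1) (G := fun w : C => w - 1) (cdiffV h) d1) _).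
by rewrite /uB; field.
Qed.

Lemma cdiff_QB z : slit (z - 1) -> cdiff QB z ((cofR a - 1) * uB z * QB z).
Proof.
move=> h; have d1 : cdiff (fun w : C => w - 1) z 1.
  refine (cdiff_eq (cdiffB (cdiff_id z) (cdiff_cst 1 z)) _); ring.
refine (cdiff_eq (cdiff_comp (F := fun w : C => cpow w (cofR (a - 1))) (G := fun w : C => w - 1)
   (cdiff_cpow _ h) d1) _).
by rewrite /QB /uB rmorphB rmorph1 /=; ring.
Qed.

Lemma cdiff_BT1d (u : C) : cdiff (fun u => BT1d (cofR a) u) u ((cofR a - 1) * (cofR a - 2)).
Proof.
refine (cdiff_eq (cdiffD (cdiff_cst _ u) (cdiffM (cdiff_cst _ u) (cdiff_id u))) _); ring.
Qed.

Lemma cdiff_qB b (u : C) : cdiff (qB b) u (BT1d (cofR a) u / cofR b).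
Proof.
refine (cdiff_eq (cdiffD (cdiff_cst 1 u) (cdiffM (cdiffD (cdiffM (cdiff_cst _ u) (cdiff_id u))
  (cdiffM (cdiff_cst _ u) (cdiffXn 2 u))) (cdiff_cst _ u))) _).
rewrite /BT1d /=; move: ((cofR b)^-1) => B; by field.
Qed.

Lemma cdiff_AB b z : slit (z - 1) -> cdiff (AB b) z (AB1 b z).
Proof.
move=> h; have du := cdiff_uB (slit_neq0 h); have dq := @cdiff_qB b (uB z).
refine (cdiff_eq (cdiffM (cdiff_QB h) (cdiff_comp (F := qB b) (G := uB) dq du)) _).
rewrite /AB1 /qB1; ring.
Qed.

Lemma cdiff_AB1 b z : slit (z - 1) -> cdiff (AB1 b) z (AB2 b z).
Proof.
move=> h; have du := cdiff_uB (slit_neq0 h); have dq := @cdiff_qB b (uB z).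
have dq1 : cdiff (qB1 b) (uB z) ((cofR a - 1) * qB b (uB z)
   + (cofR a - 1) * uB z * (BT1d (cofR a) (uB z) / cofR b)
   - 2 * uB z * (BT1d (cofR a) (uB z) / cofR b) - uB z ^+ 2 * ((cofR a - 1) * (cofR a - 2) / cofR b)).
  refine (cdiff_eq (cdiffB (cdiffM (cdiffM (cdiff_cst _ _) (cdiff_id _)) dq)
    (cdiffM (cdiffXn 2 _) (cdiffM (@cdiff_BT1d (uB z)) (cdiff_cst _ _)))) _).
  by rewrite /=; ring.
refine (cdiff_eq (cdiffM (cdiff_QB h) (cdiff_comp (F := qB1 b) (G := uB) dq1 du)) _).
rewrite /AB2 /qB2; ring.
Qed.

(** The polynomial [BT1] is the one for which the orders b and 1 of the equation cancel, so the
    residual is of order b^-1. *)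
Lemma AB_ode b z : b != 0 -> z - 1 != 0 ->
  z * AB2 b z = - (cofR b * (z - 1) + 2) * AB1 b z + cofR b * (cofR a - 1) * AB b z
   + QB z * (Bres (cofR a) (uB z) * uB z ^+ 2 / cofR b).
Proof.
move=> b0 h; have b0' : cofR b != 0 by rewrite cofR_eq0.
rewrite /AB2 /AB1 /AB /qB2 /qB1 /qB /Bq /BT1 /BT1d /Bres.
have u0 : uB z != 0 by rewrite invr_eq0.
have zE : z = 1 + (uB z)^-1 by rewrite /uB invrK addrC subrK.
move: (QB z) => Q.
move: (uB z) u0 zE => u u0 ->; 
move: (cofR a) (cofR b) b0' => A B B0.
by field; rewrite u0 B0.
Qed.

Lemma expR_sub1_le (d : R) : `|d| <= 1 / 2 ->
  [/\ `|expR d - 1| <= 2 * `|d|, `|expR d - 1 - d| <= 2 * d ^+ 2 & expR d <= 2].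
Proof.
move=> hd; have := hd; rewrite ler_norml => /andP[d1 d2].
have l1 := expR_ge1Dx d; have l2 := expR_ge1Dx (- d).
have up : expR d <= (1 - d)^-1.
  by rewrite -[expR d]invrK -expRN lef_pV2 ?posrE ?expR_gt0//; lra.
have e1 : (1 - d)^-1 = 1 + d + d ^+ 2 / (1 - d) by field; rewrite gt_eqF//; lra.
have e2 : d ^+ 2 / (1 - d) <= 2 * d ^+ 2.
  rewrite ler_pdivrMr; last by lra.
  have := sqr_ge0 d; nra.
have e3 : 2 * d ^+ 2 <= `|d|.
  by rewrite -[d ^+ 2]real_normK ?num_real//; have := normr_ge0 d; nra.
have d3 := ler_norm d; have d4 : - d <= `|d| by rewrite -normrN ler_norm.
have d5 := sqr_ge0 d.
split; last by lra.
- by rewrite ler_norml; apply/andP; split; lra.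
- by rewrite ler_norml; apply/andP; split; lra.
Qed.

(** The limit at infinity of [klnG], so that [vB] normalised by it has quotient tending to 1 with
    the approximant. *)
Definition lnc b := ln (Gamma b) - ln (Gamma a) + (a - b) * ln b.
Definition eB b z : C := vB b (lnc b) z - AB b z.
Definition eB1 b z : C := vB1 b (lnc b) z - AB1 b z.

Lemma uB_cofR (x : R) : uB (cofR x) = cofR ((x - 1)^-1).
Proof. by rewrite /uB fmorphV rmorphB rmorph1. Qed.

Lemma qB_cofR b (u : R) : qB b (cofR u) = cofR (Bq a b u).
Proof.
rewrite /qB /Bq /BT1 !(rmorphD, rmorphM, rmorphN, rmorph1, rmorphXn, fmorphV, rmorph_nat) /=.
by [].
Qed.

Lemma qB1_cofR b (u : R) : Bq a b u != 0 ->
  qB1 b (cofR u) = cofR (Bq a b u * Balpha a b u).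
Proof.
move=> q0; rewrite /qB1 qB_cofR.
have -> : Bq a b u * Balpha a b u = (a - 1) * u * Bq a b u - u ^+ 2 * (BT1d a u / b).
  by rewrite /Balpha; move: (Bq a b u) (BT1d a u / b) q0 => q B q0; field.
by rewrite /BT1d !(rmorphD, rmorphM, rmorphN, rmorph1, rmorphXn, fmorphV, rmorph_nat) /=.
Qed.

(** On the axis E is the quotient of [vB] by [AB]; the error is governed by E - 1, and its
    derivative also by [kgam], the logarithmic derivative of that quotient. *)
Lemma B_real_axis b (x : R) : 0 < b -> 1 < x -> 0 < Bq a b ((x - 1)^-1) ->
  let Q := (x - 1) `^ (a - 1) in let q := Bq a b ((x - 1)^-1) in
  let al := Balpha a b ((x - 1)^-1) in
  let E := expR (klnG a b x - lnc b) in
  eB b (cofR x) = cofR (Q * q * (E - 1)) /\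
  eB1 b (cofR x) = cofR (Q * q * E * kgam a b x + (E - 1) * (Q * (q * al))).
Proof.
move=> b0 x1 q0 Q q al E.
have x0 : 0 < x by apply: lt_trans x1.
have x10 : 0 < x - 1 by rewrite subr_gt0.
have F0 : 0 < cre (kf a b (cofR x)) by apply: kf_gt0 => //; exact: ltW.
have kfE : kf a b (cofR x) = cofR (cre (kf a b (cofR x))).
  by apply: ceq => //; rewrite cim_cofR (cim_cps_cofR _ (cbnd_kc a0 b0)).
have kf1E : kf1 a b (cofR x) = cofR (cre (kf1 a b (cofR x))).
  by apply: ceq => //; rewrite cim_cofR (cim_cps_cofR _ (cbnd_dcoef (cbnd_kc a0 b0))).
have WE : WB b (lnc b) (cofR x) = cofR (expR ((b - 1) * ln x - b * x - lnc b)).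
  by rewrite /WB clog_gt0// -!rmorphM -!rmorphB cexp_cofR.
have QE : QB (cofR x) = cofR Q.
  by rewrite /QB -(rmorph1 (@cofR R)) -rmorphB /= cpow_gt0.
have vE : cre (kf a b (cofR x)) * expR ((b - 1) * ln x - b * x - lnc b) = Q * q * E.
  rewrite /Q /q /E /klnG -[in LHS](lnK F0) -[in RHS](lnK q0) /powR gt_eqF// -!expRD.
  rewrite (lnK q0); congr expR.
  move: (ln (cre _)) (ln x) (ln (x - 1)) (ln (Bq _ _ _)) (lnc b) => *; ring.
have pE : pB b (cofR x) = cofR ((b - 1) / x - b).
  by rewrite /pB -fmorphV -rmorphM -rmorphB.
split.
  rewrite /eB /vB /AB uB_cofR qB_cofR kfE WE QE -!rmorphM -rmorphB /= vE.
  by congr cofR; rewrite /q; ring.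
rewrite /eB1 /vB1 /AB1 uB_cofR qB1_cofR ?gt_eqF// kfE kf1E WE QE pE.
rewrite -!rmorphM -rmorphD -rmorphM -rmorphB /=; congr cofR.
have -> : (cre (kf1 a b (cofR x)) + ((b - 1) / x - b) * cre (kf a b (cofR x))) *
  expR ((b - 1) * ln x - b * x - lnc b) = Q * q * E * (kgam a b x + al).
  rewrite -vE /kgam /al.
  move: (cre (kf a b (cofR x))) (cre (kf1 a b (cofR x))) (expR _) (Balpha _ _ _) F0 => F F1 e A F0.
  by field; rewrite !gt_eqF.
by rewrite /al /q; ring.
Qed.

Lemma B_initial (x : R) : 1 < x -> exists2 M, 0 <= M & exists b0, forall b, b0 <= b ->
  cmod (eB b (cofR x)) <= M / b ^+ 2 /\ cmod (eB1 b (cofR x)) <= M / b ^+ 2.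
Proof.
move=> x1; have [C0 [b0 h]] := real_axis_data a0 x1.
set u := (x - 1)^-1 in h; pose Q := (x - 1) `^ (a - 1).
have u0 : 0 < u by rewrite invr_gt0 subr_gt0.
pose K1 := Q * (1 + `|BT1 a u|).
pose K2 := Q * (`|a - 1| * u * (1 + `|BT1 a u|) + u ^+ 2 * `|BT1d a u|).
have Q0 : 0 <= Q by exact: powR_ge0.
have T0 := normr_ge0 (BT1 a u).
have K10 : 0 <= K1 by rewrite mulr_ge0//; lra.
have K20 : 0 <= K2.
  rewrite mulr_ge0// addr_ge0 ?mulr_ge0 ?sqr_ge0 ?(ltW u0)//; lra.
exists (2 * `|C0| * (K1 + K2)); first by rewrite !mulr_ge0 ?addr_ge0.
exists (b0 + `|b0| + 2 * `|C0| + 1) => b hb.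
have n1 := normr_ge0 b0; have n2 := normr_ge0 C0; have n3 := ler_norm b0.
have n4 : - b0 <= `|b0| by rewrite -normrN ler_norm.
have b1 : 1 <= b by lra.
have bp : 0 < b by lra.
have b0b : b0 <= b by lra.
have [hd hg q0] := h b b0b.
have [E1 E2] := B_real_axis bp x1 q0.
rewrite -/u -/Q in E1 E2.
have b2 : 0 < b ^+ 2 by rewrite exprn_gt0.
have bi : 0 < b^-1 by rewrite invr_gt0.
have bi1 : b^-1 <= 1 by rewrite invf_le1.
have C0n : C0 / b ^+ 2 <= `|C0| / b ^+ 2 by rewrite ler_pM2r ?invr_gt0// ler_norm.
set d := klnG a b x - lnc b in E1 E2; rewrite -/(lnc b) -/d in hd.
have hd' := le_trans hd C0n; have hg' := le_trans hg C0n.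
have d12 : `|d| <= 1 / 2.
  apply: le_trans hd' _; rewrite ler_pdivrMr//.
  have : b <= b ^+ 2 by rewrite ler_eXnr.
  lra.
have [e1 _ e3] := expR_sub1_le d12.
have qK : `|Q * Bq a b u| <= K1.
  rewrite normrM (ger0_norm Q0) ler_wpM2l//; apply: le_trans (ler_normD _ _) _.
  rewrite normr1 lerD2l normrM (gtr0_norm bi) ler_piMr//.
have qaK : `|Q * (Bq a b u * Balpha a b u)| <= K2.
  rewrite normrM (ger0_norm Q0) ler_wpM2l//.
  have -> : Bq a b u * Balpha a b u = (a - 1) * u * Bq a b u - u ^+ 2 * (BT1d a u / b).
    rewrite /Balpha; move: (Bq a b u) (BT1d a u / b) (lt0r_neq0 q0) => q B q0'; by field.
  apply: le_trans (ler_normB _ _) _; apply: lerD.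
    rewrite normrM normrM (gtr0_norm u0) ler_wpM2l ?mulr_ge0 ?(ltW u0)//.
    apply: le_trans (ler_normD _ _) _.
    by rewrite normr1 lerD2l normrM (gtr0_norm bi) ler_piMr.
  rewrite normrM (ger0_norm (sqr_ge0 u)) ler_wpM2l ?sqr_ge0//.
  by rewrite normrM (gtr0_norm bi) ler_piMr.
have eC : `|expR d - 1| <= 2 * (`|C0| / b ^+ 2) by apply: le_trans e1 _; rewrite ler_pM2l.
have Cb0 : 0 <= `|C0| / b ^+ 2 by rewrite divr_ge0// ltW.
rewrite E1 E2 !cmod_cofR; split.
  rewrite normrM; apply: le_trans (ler_pM _ _ qK eC) _ => //.
  have K2z := mulr_ge0 K20 Cb0.
  have -> : 2 * `|C0| * (K1 + K2) / b ^+ 2 =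
    K1 * (2 * (`|C0| / b ^+ 2)) + 2 * (K2 * (`|C0| / b ^+ 2)) by ring.
  by rewrite lerDl mulr_ge0.
apply: le_trans (ler_normD _ _) _.
have g1 : `|Q * Bq a b u * expR d * kgam a b x| <= K1 * 2 * (`|C0| / b ^+ 2).
  rewrite normrM; apply: ler_pM => //; rewrite normrM; apply: ler_pM => //.
  by rewrite gtr0_norm// expR_gt0.
have g2 : `|(expR d - 1) * (Q * (Bq a b u * Balpha a b u))| <= 2 * (`|C0| / b ^+ 2) * K2.
  by rewrite normrM; apply: ler_pM.
apply: le_trans (lerD g1 g2) _; rewrite le_eqVlt; apply/orP; left; apply/eqP; ring.
Qed.

Lemma cmod_QB z L : z - 1 != 0 -> `|ln (cmod (z - 1))| <= L ->
  expR (- (`|a - 1| * L)) <= cmod (QB z) <= expR (`|a - 1| * L).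
Proof.
move=> z0 hL; rewrite /QB cmod_cpow// /powR cmod_eq0 (negbTE z0) !ler_expR -ler_norml normrM.
by rewrite ler_wpM2l.
Qed.

End RegionB.

(** * Error estimate along paths in region B *)

Section RegionBEstimate.
Variables (R : realType) (a : R).
Hypothesis a0 : 0 < a.
Local Notation C := (Cplx R).
Implicit Types (z u : C) (b : R).

Lemma bdisc_Bres W : bdisc (fun u : C => Bres (cofR a) u) W.
Proof.
have I := bdisc_id W; have K := @bdisc_cst R ^~ W.
rewrite /Bres; exact: bdiscD (bdiscM (bdiscD (K 1) I) (bdiscD (K _) (bdiscM (K _) I)))
  (bdiscM (K 2) (bdiscD (K _) (bdiscM (K _) I))).
Qed.

(** Here [om = 1] and the damping Re (s' - s' / s) is the derivative of Re s - ln |s|. The initial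
    energy is O(b^-4) by [B_initial], and the residual of order b^-1 also contributes b^-2 to the
    error. *)
Lemma B_path (x0 D ka N : R) : 1 < x0 -> x0 <= D -> 0 < ka -> 0 <= N -> exists M b0,
  forall b, b0 <= b -> forall (s s' : R -> C) t1, x0 <= t1 -> t1 <= D -> s x0 = cofR x0 ->
  (forall t, x0 <= t <= t1 ->
    [/\ cder s t (s' t), x0 <= cre (s t), cmod (s t) <= D, cmod (s' t) <= N &
        ka <= cre (s' t - s' t / s t)]) ->
  cmod (eB a b (s t1)) <= M / b ^+ 2.
Proof.
move=> x01 xD ka0 N0.
have [M1 M10 [b1 hM1]] := B_initial a0 x01.
pose U := (x0 - 1)^-1; have U0 : 0 < U by rewrite invr_gt0 subr_gt0.
have [B0 B00 hB0] := @bdisc_Bres U.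
pose L := D + 1 + `|ln (x0 - 1)|.
pose Q := expR (`|a - 1| * L).
pose M2 := N * (Q * (B0 * U ^+ 2)).
have Q0 : 0 <= Q by exact: expR_ge0.
have U2 : 0 <= U ^+ 2 by exact: sqr_ge0.
have M20 : 0 <= M2 := mulr_ge0 N0 (mulr_ge0 Q0 (mulr_ge0 B00 U2)).
pose N2 := N * (2 + `|a - 1|) + 1.
have an0 := normr_ge0 (a - 1).
have Na : 0 <= N * `|a - 1| by rewrite mulr_ge0.
pose K := expR ((8 * N2 ^+ 2 + 2) / ka * D).
have D0 : 0 < D by lra.
have K1 : 1 <= K.
  rewrite -[leLHS]expR0 ler_expR mulr_ge0 ?(ltW D0)// divr_ge0 ?(ltW ka0)// addr_ge0//.
  by rewrite mulr_ge0// sqr_ge0.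
exists ((2 * M1 + M2) * K), (Num.max b1 (1 + 3 * N2 / ka)) => b.
rewrite ge_max => /andP[hb1 hb2] s s' t1 xt tD sx0 H.
have N20 : 0 <= N2 by move: N0 Na; rewrite /N2 mulrDr; move: (N * `|a - 1|) => X *; lra.
have b1' : 1 <= b.
  by apply: le_trans hb2; rewrite lerDl divr_ge0 ?mulr_ge0 ?(ltW ka0).
have b0 : 0 < b by lra.
have hN : 3 * N2 <= ka * b.
  rewrite (mulrC ka) -ler_pdivrMr//; lra.
have [i1 i2] := hM1 b hb1.
have b2 : 0 < b ^+ 2 by rewrite exprn_gt0.
have eps0 : 0 <= M2 / b by rewrite divr_ge0// ltW.
have := @lyapunov R N2 ka b (M2 / b) x0 t1 (fun t => eB a b (s t)) (fun t => eB1 a b (s t))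
  (fun t => (vB2 a b (lnc a b) (s t) - AB2 a b (s t)) * s' t) (fun t => s' t - s' t / s t)
  (fun t => 2 * (s' t / s t)) (fun t => s' t / s t * cofR (a - 1))
  (fun t => - (s' t / s t * (QB a (s t) * (Bres (cofR a) (uB (s t)) * uB (s t) ^+ 2 / cofR b))))
  s' (fun=> 1) (fun=> 0) ka0 b0 hN eps0 xt.
cbv beta zeta => LY.
have {LY} : cmod (eB a b (s t1)) ^+ 2 + 1 / b * cmod (eB1 a b (s t1)) ^+ 2 + (M2 / b / b) ^+ 2 <=
   (cmod (eB a b (s x0)) ^+ 2 + 1 / b * cmod (eB1 a b (s x0)) ^+ 2 + (M2 / b / b) ^+ 2) *
   expR ((8 * N2 ^+ 2 + 2) / ka * (t1 - x0)).
  apply: LY => t /H[hs hre hD hs' hka].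
  have sre : 0 < cre (s t) by lra.
  have sl := slit_cre sre; have s0 := slit_neq0 sl.
  have s1re : x0 - 1 <= cre (s t - 1) by rewrite !cE; lra.
  have sl1 : slit (s t - 1) by apply: slit_cre; lra.
  have s10 := slit_neq0 sl1.
  have m1 : x0 - 1 <= cmod (s t - 1).
    by apply: le_trans s1re _; apply: le_trans (ler_norm _) (normr_cre_le _).
  have x10 : 0 < x0 - 1 by lra.
  have m0 : 0 < cmod (s t - 1) by lra.
  have m2 : cmod (s t - 1) <= D + 1.
    by apply: le_trans (cmodB _ _) _; rewrite cmod1 lerD2r.
  have lnL : `|ln (cmod (s t - 1))| <= L.
    have l1 : ln (cmod (s t - 1)) <= cmod (s t - 1) by apply/ltW/ln_sublinear.
    have l2 : ln (x0 - 1) <= ln (cmod (s t - 1)) by rewrite ler_ln ?posrE.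
    have l3 := ler_norm (ln (x0 - 1)); have l4 : - ln (x0 - 1) <= `|ln (x0 - 1)| by rewrite -normrN ler_norm.
    by clear -a a0 l1 l2 l3 l4 m2 D0; rewrite /L ler_norml; apply/andP; split; lra.
  have /andP[_ hQ] := cmod_QB a s10 lnL.
  have hu : cmod (uB (s t)) <= U by rewrite /uB cmodV lef_pV2 ?posrE.
  have sm1 : 1 <= cmod (s t).
    by apply: le_trans (le_trans (ler_norm _) (normr_cre_le _)); lra.
  have hm : cmod (s' t / s t) <= N.
    rewrite cmodM cmodV -[leRHS]mulr1 ler_pM ?cmod_ge0 ?invr_ge0 ?cmod_ge0// invf_le1//.
    by lra.
  split; [split|split; split] => //.
  - have d : cdiff (eB a b) (s t) (eB1 a b (s t)).
      by apply: cdiffB; [exact: cdiff_vB|exact: cdiff_AB].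
    exact: d.
  - have d : cdiff (eB1 a b) (s t) (vB2 a b (lnc a b) (s t) - AB2 a b (s t)).
      by apply: cdiffB; [exact: cdiff_vB1|exact: cdiff_AB1].
    exact: d.
  - exact: rder_cst.
  - rewrite rmorph1 mul1r.
    have -> : (vB2 a b (lnc a b) (s t) - AB2 a b (s t)) * s' t =
      s' t / s t * (s t * vB2 a b (lnc a b) (s t) - s t * AB2 a b (s t)) by field.
    rewrite (vB_ode a0 _ b0 sl) (AB_ode a (lt0r_neq0 b0) s10) /eB /eB1 rmorphB rmorph1 /=.
    move: (Bres (cofR a) (uB (s t))) (uB (s t)) ((cofR b)^-1) (QB a (s t)) => X u bi q.
    move: (vB1 a b (lnc a b) (s t)) (vB a b (lnc a b) (s t)) (AB1 a b (s t)) (AB a b (s t)) => ? ? ? ?.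
    by field.
  - have c2 : cmod (2 : C) = 2 by rewrite -(rmorph_nat (@cofR R)) cmod_cofR normr_nat.
    by rewrite cmodM c2 /N2; clear -a a0 hm Na N0 an0; lra.
  - by rewrite normr0.
  - rewrite cmodM cmod_cofR /N2.
    have : cmod (s' t / s t) * `|a - 1| <= N * `|a - 1| by rewrite ler_wpM2r.
    lra.
  - apply: le_trans hs' _; rewrite /N2; lra.
  - rewrite cmodN (cmodM (s' t / s t)) (cmodM (QB _ _)) (cmodM _ (cofR b)^-1) cmodV.
    rewrite cmod_cofR (gtr0_norm b0) (cmodM (Bres _ _)) cmodX.
    rewrite (_ : M2 / b = N * (Q * (B0 * U ^+ 2 / b))); last by rewrite /M2; ring.
    have u2 : cmod (uB (s t)) ^+ 2 <= U ^+ 2.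
      by rewrite lerXn2r ?nnegrE ?cmod_ge0// ltW.
    have bi : 0 <= b^-1 by rewrite invr_ge0 ltW.
    have u20 := sqr_ge0 (cmod (uB (s t))).
    have h1 := ler_pM (cmod_ge0 _) u20 (hB0 _ hu) u2.
    have h2 := ler_wpM2r bi h1.
    have p1 : 0 <= cmod (Bres (cofR a) (uB (s t))) * cmod (uB (s t)) ^+ 2 / b.
      by rewrite !mulr_ge0 ?cmod_ge0.
    have h3 := ler_pM (cmod_ge0 _) p1 hQ h2.
    apply: (ler_pM (cmod_ge0 _) _ hm h3).
    by rewrite mulr_ge0 ?cmod_ge0.
rewrite sx0.
set z := M2 / b / b; set V0 := cmod (eB a b (cofR x0)) ^+ 2 + _.
move=> H1; pose w := b ^- 2.
have w0 : 0 <= w by rewrite invr_ge0 ltW.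
have zE : z = M2 * w by rewrite /z /w; field; rewrite gt_eqF.
have q1 : cmod (eB a b (cofR x0)) ^+ 2 <= (M1 * w) ^+ 2.
  by rewrite lerXn2r ?nnegrE ?cmod_ge0// mulr_ge0.
have q2 : cmod (eB1 a b (cofR x0)) ^+ 2 <= (M1 * w) ^+ 2.
  by rewrite lerXn2r ?nnegrE ?cmod_ge0// mulr_ge0.
have bi1 : 1 / b <= 1 by rewrite ler_pdivrMr// mul1r.
have V0b : V0 <= 2 * (M1 * w) ^+ 2.
  have : 1 / b * cmod (eB1 a b (cofR x0)) ^+ 2 <= cmod (eB1 a b (cofR x0)) ^+ 2.
    by rewrite ler_piMl// sqr_ge0.
  rewrite /V0; lra.
have KK : expR ((8 * N2 ^+ 2 + 2) / ka * (t1 - x0)) <= K.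
  rewrite ler_expR ler_wpM2l ?divr_ge0 ?(ltW ka0)//; last by lra.
  by rewrite addr_ge0// mulr_ge0// sqr_ge0.
have H2 : cmod (eB a b (s t1)) ^+ 2 <= ((2 * M1 + M2) * w) ^+ 2 * K.
  have l1 : V0 + z ^+ 2 <= ((2 * M1 + M2) * w) ^+ 2.
    rewrite zE; apply: le_trans (lerD V0b (lexx _)) _.
    have p1 : 0 <= M1 * w by rewrite mulr_ge0.
    have p2 : 0 <= M2 * w by rewrite mulr_ge0.
    rewrite (_ : (2 * M1 + M2) * w = 2 * (M1 * w) + M2 * w); last by ring.
    nra.
  have l2 : 0 <= V0 + z ^+ 2.
    by rewrite /V0 !addr_ge0 ?sqr_ge0// mulr_ge0 ?sqr_ge0// divr_ge0// ltW.
  have := le_trans H1 (ler_pM l2 (expR_ge0 _) l1 KK).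
  have := sqr_ge0 z; have : 0 <= 1 / b * cmod (eB1 a b (s t1)) ^+ 2.
    by rewrite mulr_ge0 ?sqr_ge0// divr_ge0// ltW.
  lra.
have P0 : 0 <= (2 * M1 + M2) * w by rewrite mulr_ge0//; lra.
rewrite -(@ler_pXn2r _ 2%N) ?nnegrE ?cmod_ge0//; last first.
  by rewrite divr_ge0 ?(ltW b2)// mulr_ge0 ?(le_trans ler01 K1)//; lra.
apply: le_trans H2 _.
rewrite (_ : (2 * M1 + M2) * K / b ^+ 2 = (2 * M1 + M2) * w * K); last by rewrite /w; ring.
by rewrite (exprMn _ _ K) ler_wpM2l ?sqr_ge0// ler_eXnr.
Qed.

End RegionBEstimate.

(** * Paths covering compact subsets of B *)

Section PartB.
Variables (R : realType) (a : R).
Hypothesis a0 : 0 < a.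
Local Notation C := (Cplx R).
Implicit Types (z u xi : C) (b x t : R).

(** Half-height at abscissa t of region B, whose boundary is |z| = exp (t - 1). *)
Definition radB t : R := Num.sqrt (expR (2 * (t - 1)) - t ^+ 2).
(** The function [radB] solves r' = r + (t^2 - t) / r. Subtracting a multiple of exp t makes it
    vanish at x0 and gives phi' = phi + (t^2 - t) / radB, the relation that makes the damping
    explicit. The curves t + i lam phi(t) fan out from x0. *)
Definition phiB (x0 t : R) : R := radB t - radB x0 * expR (- x0) * expR t.

Lemma expR_gt_id t : 1 < t -> t < expR (t - 1).
Proof.
move=> t1; rewrite -[ltLHS](subrK 1) addrC.
by apply: expR_gt1Dx; rewrite subr_eq0 gt_eqF.
Qed.

(** The gap exp (t - 1) - t grows for t >= 1. The bound keeps [radB] away from 0, hence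
    differentiable with bounded derivative on the paths. *)
Lemma radB_arg_ge (x0 t : R) : 1 < x0 -> x0 <= t ->
  (expR (x0 - 1) - x0) ^+ 2 <= expR (2 * (t - 1)) - t ^+ 2.
Proof.
move=> x01 xt; have g0 := expR_gt_id x01.
have h : expR (x0 - 1) * (1 + (t - x0)) <= expR (t - 1).
  have -> : expR (t - 1) = expR (x0 - 1) * expR (t - x0) by rewrite -expRD; congr expR; ring.
  by rewrite ler_wpM2l ?expR_ge0// expR_ge1Dx.
have -> : expR (2 * (t - 1)) = expR (t - 1) ^+ 2 by rewrite expRM_natl.
move: (expR (x0 - 1)) (expR (t - 1)) g0 h => e0 e g0 h.
have h1 : e0 - x0 <= e - t by nra.
have h2 : e0 - x0 <= e + t by nra.
have -> : e ^+ 2 - t ^+ 2 = (e - t) * (e + t) by ring.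
by rewrite expr2; apply: ler_pM => //; lra.
Qed.

(* The path [t + i lam phi(t)] has [Re s' (1 - 1 / s) = t (t - 1) (1 - lam^2 phi / rad) / |s|^2],
   which stays positive as long as [|lam| < 1]. *)
Lemma B_near (x0 D lm : R) : 1 < x0 -> x0 <= D -> 0 <= lm -> lm < 1 -> exists M b0,
  forall b, b0 <= b -> forall xi, x0 <= cre xi -> cre xi <= D ->
  0 < phiB x0 (cre xi) -> `|cim xi| <= lm * phiB x0 (cre xi) ->
  cmod (eB a b xi) <= M / b ^+ 2.
Proof.
move=> x01 xD lm0 lm1.
pose h0 := radB x0 * expR (- x0); pose E := expR D; pose g0 := expR (x0 - 1) - x0.
have g00 : 0 < g0 by rewrite subr_gt0 expR_gt_id.
have h00 : 0 <= h0 by rewrite mulr_ge0 ?sqrtr_ge0 ?expR_ge0.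
have D0 : 0 < D by lra.
have E1 : 1 <= E by rewrite -[leLHS]expR0 ler_expR ltW.
have hE : 0 <= h0 * E by rewrite mulr_ge0 ?expR_ge0.
pose D' := D + (E + h0 * E); pose N := 1 + (E ^+ 2 / g0 + h0 * E).
have D'0 : 0 < D' by rewrite /D'; lra.
have Eg0 : 0 <= E ^+ 2 / g0 by rewrite divr_ge0 ?sqr_ge0// ltW.
have N0 : 0 <= N by rewrite /N; lra.
have lm2 : lm ^+ 2 < 1 by rewrite expr_lt1.
pose ka := x0 * (x0 - 1) * (1 - lm ^+ 2) / D' ^+ 2.
have xx0 : 0 < x0 * (x0 - 1) by rewrite mulr_gt0//; lra.
have num0 : 0 < x0 * (x0 - 1) * (1 - lm ^+ 2) by rewrite mulr_gt0// subr_gt0.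
have ka0 : 0 < ka by rewrite divr_gt0// exprn_gt0.
have xD' : x0 <= D' by rewrite /D'; lra.
have [M [b0 hM]] := B_path a0 x01 xD' ka0 N0.
exists M, b0 => b hb xi xxi xiD ph0 him.
set x := cre xi in xxi xiD ph0 him *.
pose lam := cim xi / phiB x0 x.
have lamn : `|lam| <= lm.
  by rewrite normrM normfV (gtr0_norm ph0) ler_pdivrMr.
have lam2 : lam ^+ 2 <= lm ^+ 2.
  by rewrite -[lam ^+ 2]real_normK ?num_real// lerXn2r ?nnegrE.
have lamn1 : `|lam| <= 1 by lra.
pose dr t := (expR (2 * (t - 1)) - t) / radB t.
pose dphi t := dr t - h0 * expR t.
pose s t : C := Complex t (lam * phiB x0 t).
pose s' t : C := Complex 1 (lam * dphi t).
have sx : s x = xi.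
  by apply: ceq => //; rewrite /s /lam {1}/cim /= divfK// gt_eqF.
have xiD' : x <= D' by rewrite /D'; lra.
rewrite -sx; apply: (hM b hb s s' x xxi xiD').
  apply: ceq => //; rewrite /s {1}/cim /= /phiB -mulrA -expRD addNr expR0 mulr1 subrr mulr0.
  by [].
move=> t /andP[xt tx].
have t1 : 1 < t by lra.
have t0 : 0 < t by lra.
have arg_ge := radB_arg_ge x01 xt.
have arg0 : 0 < expR (2 * (t - 1)) - t ^+ 2 by apply: lt_le_trans arg_ge; rewrite exprn_gt0.
have rg : g0 <= radB t.
  by rewrite -(ger0_norm (ltW g00)) -sqrtr_sqr ler_wsqrtr.
have r0 : 0 < radB t by lra.
have rE2 : radB t ^+ 2 = expR (2 * (t - 1)) - t ^+ 2 by rewrite sqr_sqrtr// ltW.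
have et : expR t <= E by rewrite ler_expR; lra.
have e2 : expR (2 * (t - 1)) <= E ^+ 2.
  by rewrite expRM_natl lerXn2r ?nnegrE ?expR_ge0// ler_expR; lra.
have rE : radB t <= E.
  rewrite -(@ler_pXn2r _ 2%N) ?nnegrE ?(ltW r0) ?(le_trans ler01 E1)// rE2.
  have := sqr_ge0 t; lra.
have het : 0 <= h0 * expR t by rewrite mulr_ge0// expR_ge0.
have hetE : h0 * expR t <= h0 * E by rewrite ler_wpM2l.
have phE : phiB x0 t = radB t - h0 * expR t by [].
have phn : `|phiB x0 t| <= E + h0 * E.
  by rewrite phE ler_norml; clear -a a0 r0 rE het hetE; apply/andP; split; lra.
have phr : phiB x0 t <= radB t by rewrite phE; lra.
have tt2 : t <= expR (2 * (t - 1)) by apply: le_trans (expR_ge1Dx _); lra.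
have drn : `|dr t| <= E ^+ 2 / g0.
  rewrite /dr normrM normfV (gtr0_norm r0) ger0_norm ?subr_ge0//.
  apply: ler_pM; rewrite ?subr_ge0 ?invr_ge0 ?(ltW r0)//; first by lra.
  by rewrite lef_pV2 ?posrE.
have dphn : `|dphi t| <= E ^+ 2 / g0 + h0 * E.
  by apply: le_trans (ler_normB _ _) _; rewrite (ger0_norm het); apply: lerD.
have lamle (p q : R) : `|p| <= q -> `|lam * p| <= q.
  by move=> pq; apply: le_trans pq; rewrite normrM ler_piMl.
have sD : cmod (s t) <= D'.
  apply: le_trans (cmod_le _) _; rewrite {1}/cre {1}/cim /= (gtr0_norm t0) /D'.
  by apply: lerD; [lra|exact: lamle].
split => //.
- have dradB : rder radB t (dr t).
    refine (rder_eq (rder_sqrt (rderB (rder_exp (rderM (rder_cst 2 t) (rderB (rder_id t) (rder_cst 1 t))))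
      (rderX 2 (rder_id t))) arg0) _).
    rewrite /dr -/(radB t) /=; field; exact: lt0r_neq0.
  have dph : rder (phiB x0) t (dphi t).
    refine (rder_eq (rderB dradB (rderM (rder_cst h0 t) (rder_exp (rder_id t)))) _).
    by rewrite /dphi; ring.
  refine (cder_eq (cder_mk (rder_id t) (rderM (rder_cst lam t) dph)) _).
  by apply: ceq; rewrite /s' /cre /cim /=; ring.
- apply: le_trans (cmod_le _) _; rewrite {1}/cre {1}/cim /= normr1 /N lerD2l.
  exact: lamle.
- rewrite creD creN cre_div.
  have cs2 : cmod (s t) ^+ 2 = t ^+ 2 + lam ^+ 2 * phiB x0 t ^+ 2.
    by rewrite sqr_cmod /s /cre /cim /=; ring.
  have cs0 : 0 < cmod (s t) ^+ 2.
    rewrite cs2; apply: ltr_pwDl; first exact: exprn_gt0.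
    exact: mulr_ge0 (sqr_ge0 _) (sqr_ge0 _).
  have -> : cre (s' t) - (cre (s' t) * cre (s t) + cim (s' t) * cim (s t)) / cmod (s t) ^+ 2 =
     (t * (t - 1) * (1 - lam ^+ 2 * (phiB x0 t / radB t))) / cmod (s t) ^+ 2.
    have dE : dphi t = phiB x0 t - (t - t ^+ 2) / radB t.
      have eE : expR (2 * (t - 1)) = radB t ^+ 2 + t ^+ 2 by rewrite rE2 subrK.
      by rewrite /dphi /dr eE phE; field; rewrite gt_eqF.
    rewrite /s' /s /cre /cim /= -/(s t) dE.
    have -> : t * (t - 1) * (1 - lam ^+ 2 * (phiB x0 t / radB t)) = cmod (s t) ^+ 2 -
       (1 * t + lam * (phiB x0 t - (t - t ^+ 2) / radB t) * (lam * phiB x0 t)).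
      by rewrite cs2; field; rewrite gt_eqF.
    by rewrite [RHS]mulrBl mulfV ?gt_eqF.
  have pr1 : lam ^+ 2 * (phiB x0 t / radB t) <= lm ^+ 2.
    have : phiB x0 t / radB t <= 1 by rewrite ler_pdivrMr// mul1r.
    have := sqr_ge0 lam; move: (phiB x0 t / radB t) lam2 => q; nra.
  have tt : x0 * (x0 - 1) <= t * (t - 1) by clear -a a0 x01 xt; apply: ler_pM; lra.
  apply: ler_pM.
  + exact: ltW.
  + by rewrite invr_ge0 sqr_ge0.
  + by apply: ler_pM => //; [exact: ltW|rewrite subr_ge0 ltW|rewrite lerD2l lerN2].
  + have s2 : cmod (s t) ^+ 2 <= D' ^+ 2 by rewrite lerXn2r ?nnegrE ?cmod_ge0// ltW.
    have D2 : 0 < D' ^+ 2 by rewrite exprn_gt0.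
    by rewrite lef_pV2.
Qed.

(** Continuous defining function of region B, the counterpart of [psiA]; its minimum on a compact
    set measures the distance to both parts of the boundary. *)
Definition psiB (z : C) : R := Num.min (cre z - 1) (expR (2 * (cre z - 1)) - cmod z ^+ 2).

Lemma continuous_psiB : continuous psiB.
Proof.
have hexp : continuous (fun z : C => expR (2 * (cre z - 1))).
  move=> z; have FF : Filter (nbhs z) := nbhs_filter z.
  apply: (@continuous_comp _ _ _ (fun z : C => 2 * (cre z - 1)) (@expR R)).
    apply: (@cvgM _ _ (nbhs z) FF); first exact: cvg_cst.
    by apply: (@cvgB _ _ _ (nbhs z) FF); [exact: continuous_cre|exact: cvg_cst].
  exact: continuous_expR.
move=> z; have FF : Filter (nbhs z) := nbhs_filter z.
apply: (@continuous_min _ _ (fun z : C => cre z - 1)).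
  by apply: (@cvgB _ _ _ (nbhs z) FF); [exact: continuous_cre|exact: cvg_cst].
apply: (@cvgB _ _ _ (nbhs z) FF); first exact: hexp.
by apply: (@cvgM _ _ (nbhs z) FF); exact: continuous_cmod.
Qed.

Lemma psiB_gt0 z : regB z -> 0 < psiB z.
Proof.
rewrite /regB /psiB /= => -[z1 h]; rewrite lt_min !subr_gt0 z1 /=.
rewrite -sqr_cmod in h.
have m0 : 0 < cmod z ^+ 2.
  rewrite exprn_gt0//; apply: lt_le_trans (le_trans (ler_norm _) (normr_cre_le z)).
  exact: lt_trans z1.
by rewrite -[ltLHS](@lnK _ (cmod z ^+ 2)) ?posrE// ltr_expR; lra.
Qed.

(** At 1 + h the squared half-height is at most exp (2 h) - 1 <= 2 h exp 1. A start close to 1 makes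
    [phiB] close to [radB], so the fan fills almost all of B. *)
Lemma radB_small e d : 0 < e -> 0 < d -> exists x0, [/\ 1 < x0, x0 <= 1 + d & radB x0 <= e].
Proof.
move=> e0 d0; pose h := Num.min (Num.min (1 / 2) d) (e ^+ 2 / (2 * expR 1)).
have h0 : 0 < h by rewrite !lt_min d0 !divr_gt0 ?mulr_gt0 ?exprn_gt0 ?expR_gt0.
have h1 : h <= 1 / 2 by rewrite !ge_min lexx.
have h2 : h <= d by rewrite !ge_min lexx orbT.
have h3 : h <= e ^+ 2 / (2 * expR 1) by rewrite !ge_min lexx !orbT.
exists (1 + h); split; [lra|lra|].
rewrite -(ger0_norm (ltW e0)) -sqrtr_sqr ler_wsqrtr//.
have -> : 2 * (1 + h - 1) = 2 * h by ring.
have l1 := expR_ge1Dx (- (2 * h)).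
have E2 : expR (2 * h) * expR (- (2 * h)) = 1 by rewrite -expRD subrr expR0.
have l2 : expR (2 * h) - 1 <= 2 * h * expR (2 * h).
  have := ler_wpM2l (expR_ge0 (2 * h)) l1; rewrite E2.
  move: (expR (2 * h)) => E; lra.
have l3 : expR (2 * h) <= expR 1 by rewrite ler_expR; lra.
have l4 : 2 * h * expR (2 * h) <= 2 * h * expR 1 by rewrite ler_pM2l//; lra.
have l5 : 2 * h * expR 1 <= e ^+ 2.
  by move: h3; rewrite ler_pdivlMr ?mulr_gt0 ?expR_gt0// => /(le_trans _); apply; rewrite mulrA (mulrC h).
have := sqr_ge0 h; nra.
Qed.

Lemma partB_uniform (K : set C) : compact K -> K `<=` @regB R ->
  exists M b0, forall b, b0 <= b -> forall xi, K xi -> cmod (eB a b xi) <= M / b ^+ 2.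
Proof.
move=> cK KB.
have [d' d'0 hd'] := compact_lower cK continuous_psiB (fun z Kz => psiB_gt0 (KB z Kz)).
have [D D1 hD] := compact_cmod_le cK.
pose d := Num.min d' 1.
have d0 : 0 < d by rewrite lt_min d'0 ltr01.
have d1 : d <= 1 by rewrite ge_min lexx orbT.
have dd' : d <= d' by rewrite ge_min lexx.
pose E := expR D; have E1 : 1 <= E by rewrite -[leLHS]expR0 ler_expR; lra.
have E0 : 0 < E by lra.
(* The gap d in the squared height becomes the margin [|y| <= radB x - 2 k]; [x0] is chosen so that
   [phiB] loses at most k. The remaining k gives the ratio 1 - k / E, because k / E times the height
   is at most k. *)
pose k := d / (4 * E).
have k0 : 0 < k by rewrite divr_gt0// mulr_gt0.
have kE : 4 * k * E = d by rewrite /k; field; rewrite gt_eqF.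
have k1 : k <= 1 / 4 by nra.
have kE0 : 0 < k / E by rewrite divr_gt0.
have kE1 : k / E <= 1 / 4 by rewrite ler_pdivrMr//; nra.
have [x0 [x01 x0d rx0]] := radB_small kE0 d0.
have xD : x0 <= D + 1 by lra.
have lm0 : 0 <= 1 - k / E by lra.
have lm1 : 1 - k / E < 1 by lra.
have [M [b0 hM]] := B_near x01 xD lm0 lm1.
exists M, b0 => b hb xi Kxi.
have := hd' _ Kxi; rewrite /psiB le_min => /andP[p1 p2].
have xiD := hD _ Kxi; rewrite sqr_cmod in p2.
have xiD' : cre xi <= D.
  by apply: le_trans xiD; apply: le_trans (ler_norm _) (normr_cre_le _).
set x := cre xi in p1 p2 xiD' *.
set y := cim xi in p2 *.
have x1 : 0 <= x - 1 by lra.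
have rE2 : radB x ^+ 2 = expR (2 * (x - 1)) - x ^+ 2.
  by rewrite sqr_sqrtr//; have := sqr_ge0 y; lra.
have r0 : 0 <= radB x := sqrtr_ge0 _.
have rE : radB x <= E.
  rewrite -(@ler_pXn2r _ 2%N) ?nnegrE ?(ltW E0)// rE2.
  have : expR (2 * (x - 1)) <= E ^+ 2.
    rewrite expRM_natl lerXn2r ?nnegrE ?expR_ge0// ler_expR; lra.
  have := sqr_ge0 x; lra.
have ex : expR x <= E by rewrite ler_expR.
have hx : radB x0 * expR (- x0) * expR x <= k.
  have e1 : expR (- x0) <= 1 by rewrite -[leRHS]expR0 ler_expR; lra.
  have r00 : 0 <= radB x0 := sqrtr_ge0 _.
  have h1 : radB x0 * expR (- x0) <= k / E * 1 by apply: ler_pM; rewrite ?expR_ge0.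
  have h2 : radB x0 * expR (- x0) * expR x <= k / E * 1 * E.
    by apply: ler_pM; rewrite ?mulr_ge0 ?expR_ge0.
  by move: h2; rewrite mulr1 divfK// gt_eqF.
have phge : radB x - k <= phiB x0 x by rewrite /phiB lerD2l lerN2.
have p2' : y ^+ 2 <= radB x ^+ 2 - d by rewrite rE2; lra.
have r4 : 4 * k <= radB x.
  rewrite -(ler_pM2r E0) kE; apply: (@le_trans _ _ (radB x ^+ 2)).
    by have := sqr_ge0 y; lra.
  by rewrite expr2 ler_wpM2l.
have yr : `|y| <= radB x - 2 * k.
  rewrite -(@ler_pXn2r _ 2%N) ?nnegrE//; last by lra.
  rewrite real_normK ?num_real//; apply: le_trans p2' _.
  have : 4 * k * radB x <= 4 * k * E by rewrite ler_pM2l// mulr_gt0.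
  rewrite kE; have := sqr_ge0 k; nra.
apply: hM => //; rewrite -/x -/y.
- lra.
- lra.
- lra.
apply: le_trans yr _; apply: le_trans (ler_wpM2l lm0 phge).
have : k / E * (radB x - k) <= k / E * E by rewrite ler_pM2l//; lra.
by rewrite divfK ?gt_eqF//; lra.
Qed.

End PartB.

(** * Stirling's formula and the uniform expansion in B *)

Section UniformB.
Variables (R : realType) (a : R).
Hypothesis a0 : 0 < a.
Local Notation C := (Cplx R).
Implicit Types (z u xi : C) (b x t : R).

Lemma theorem_partB (K : set C) : compact K -> K `<=` @regB R ->
   exists (M b0 : R), forall b : R, b0 <= b -> forall xi : Cplx R, K xi ->
     let E := cexp (cofR b * (xi - 1 - clog xi)) * cofR (b `^ (a - 2^-1))
              * cofR (Num.sqrt (2 * pi) / Gamma a)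
              * xi * cpow (xi - 1) (cofR (a - 1)) in
     let S := 1 + cofR ((12 * b)^-1)
                  * (1 + cofR (12 * a * (a - 1)) / (xi - 1)
                       + cofR (6 * (a - 1) * (a - 2)) / (xi - 1) ^+ 2) in
     `|F11 a b (cofR b * xi) - E * S| <= cofR (M * b ^- 2) * `|E|.
Proof.
move=> cK KB; have [M1 [b1 hM1]] := partB_uniform a0 cK KB.
have [d d0 hd] := compact_lower cK (@continuous_psiB R) (fun z Kz => psiB_gt0 (KB z Kz)).
have [D D1 hD] := compact_cmod_le cK.
pose L := D + 1 + `|ln d|; pose c0 := expR (- (`|a - 1| * L)).
have c00 : 0 < c0 by exact: expR_gt0.
have [KT KT0 hKT] : bdisc (fun u : C => BT1 (cofR a) u) (d^-1).
  have I := bdisc_id d^-1; have K' := @bdisc_cst R ^~ d^-1.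
  exact: bdiscD (bdiscM (K' _) I) (bdiscM (K' _) (bdiscX 2 I)).
(* The first term uses rho <= 2 and |QB| >= c0. In the second, 20 = 18 + 2 comes from 2 sg^2 <= 18
   b^-2 and |th| <= 2 b^-2, and 6 KT from |rho - 1| <= 6 / b times BT1 / b. The threshold b >= 6
   ensures |sg| <= 1/2. *)
exists (2 * `|M1| / c0 + (20 + 6 * KT)), (Num.max b1 6) => b.
rewrite ge_max => /andP[hb1 hb2] xi Kxi; cbv zeta.
have b0 : 0 < b by lra.
have hd1 := hd _ Kxi; rewrite /psiB le_min in hd1; have {hd1} /andP[hd1 _] := hd1.
have x0 : 0 < cre xi by lra.
have sl := slit_cre x0; have xi0 := slit_neq0 sl.
have xi1re : d <= cre (xi - 1) by rewrite !cE; lra.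
have m1 : d <= cmod (xi - 1).
  by apply: le_trans xi1re _; apply: le_trans (ler_norm _) (normr_cre_le _).
have m0 : 0 < cmod (xi - 1) by lra.
have xi10 : xi - 1 != 0 by rewrite -cmod_gt0.
have lnL : `|ln (cmod (xi - 1))| <= L.
  have m2 : cmod (xi - 1) <= D + 1.
    by apply: le_trans (cmodB _ _) _; rewrite cmod1 lerD2r hD.
  have l1 : ln (cmod (xi - 1)) <= cmod (xi - 1) by apply/ltW/ln_sublinear.
  have l2 : ln d <= ln (cmod (xi - 1)) by rewrite ler_ln ?posrE.
  have l3 := ler_norm (ln d); have l4 : - ln d <= `|ln d| by rewrite -normrN ler_norm.
  by rewrite /L ler_norml; apply/andP; split; lra.
have /andP[hQ _] := cmod_QB a xi10 lnL.
rewrite -/c0 in hQ; rewrite -/(QB a xi).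
set E := _ * QB a xi; set S := 1 + _.
have [th hth st] : exists2 th, `|th| <= 2 / b ^+ 2 &
  ln (Gamma b) = ln (Num.sqrt (2 * pi)) + (b - 1 / 2) * ln b - b + ((12 * b)^-1 + th).
  have b1' : 1 <= b by lra.
  have [th hth e] := stirling b1'; exists th => //; rewrite e.
  have s0 : 0 < Num.sqrt (2 * pi) :> R by rewrite sqrtr_gt0 mulr_gt0// pi_gt0.
  rewrite -[in LHS](lnK s0) /powR gt_eqF// -!expRD expRK; ring.
(* rho is Gamma(b) divided by sqrt (2 pi) b^(b - 1/2) exp (-b); its expansion 1 + 1 / (12 b) +
   O(b^-2) supplies the summand 1 in the bracket. *)
pose sg := (12 * b)^-1 + th; pose rho := expR sg.
have s0 : 0 < Num.sqrt (2 * pi) :> R by rewrite sqrtr_gt0 mulr_gt0// pi_gt0.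
(* Undoing the normalisation of [vB] and inserting Stirling's formula into [lnc] reproduces the
   prefactor E of the statement, up to rho and the factor [QB]. *)
have key : kf a b xi * QB a xi = E * cofR rho * vB a b (lnc a b) xi.
  have e1 : b `^ (a - 2^-1) * (Num.sqrt (2 * pi) / Gamma a) * rho * expR (- b - lnc a b) = 1.
    rewrite /powR gt_eqF// -[Num.sqrt _](lnK s0) -[Gamma a](lnK (Gamma_gt0 a0)) -expRN -!expRD.
    rewrite -[RHS]expR0; congr expR; rewrite /sg /lnc st.
    move: (ln (Gamma a)) (ln (Num.sqrt _)) (ln b) ((12 * b)^-1) => p q r s; field; rewrite ?gt_eqF//.
  have e2 : cexp (cofR b * (xi - 1 - clog xi)) * xi * WB b (lnc a b) xi = cofR (expR (- b - lnc a b)).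
    rewrite -[X in _ * X * _](clogK xi0) /WB -!cexpD -cexp_cofR; congr cexp.
    rewrite !(rmorphB, rmorphN, rmorph1) /=; ring.
  rewrite /vB /E.
  rewrite [LHS](_ : _ = kf a b xi * QB a xi * (cofR (b `^ (a - 2^-1)) * cofR (Num.sqrt (2 * pi) / Gamma a)
     * cofR rho * (cexp (cofR b * (xi - 1 - clog xi)) * xi * WB b (lnc a b) xi))).
    move: (cofR (b `^ _)) (cofR (_ / _)) (cofR rho) (cexp _) (WB b _ xi) (QB a xi) (kf a b xi) => *; ring.
  by rewrite e2 -!rmorphM /= e1 rmorph1 mulr1.
have Q0 : QB a xi != 0 by exact: cpow_neq0.
have kE : kf a b xi - E * S =
    E * (cofR rho * eB a b xi / QB a xi + (cofR rho * qB a b (uB xi) - S)).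
  have -> : kf a b xi = E * cofR rho * vB a b (lnc a b) xi / QB a xi by rewrite -key mulfK.
  have -> : vB a b (lnc a b) xi = eB a b xi + QB a xi * qB a b (uB xi) by rewrite /eB /AB subrK.
  by move: (qB _ _ _) (eB _ _ _) => q e; field.
rewrite F11_kf// !normE -rmorphM ler_cofR kE cmodM mulrC ler_wpM2r ?cmod_ge0//.
have bi0 : 0 < b^-1 by rewrite invr_gt0.
have bi1 : b^-1 <= 1 / 6 by rewrite -[1 / 6]invf_div divr1 lef_pV2 ?posrE.
have w0 : 0 <= b ^- 2 by rewrite invr_ge0 sqr_ge0.
have wE : b ^- 2 = b^-1 * b^-1 by rewrite expr2 invfM.
have w1 : b ^- 2 <= b^-1 / 6.
  by rewrite wE ler_wpM2l//; lra.
have iE : (12 * b)^-1 = b^-1 / 12 by rewrite invfM mulrC.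
have sgn : `|sg| <= 3 * b^-1.
  rewrite /sg iE; apply: le_trans (ler_normD _ _) _; rewrite ger0_norm; last lra.
  by move: hth w1; move: (b ^- 2) `|th| => w t *; lra.
have sg12 : `|sg| <= 1 / 2 by lra.
have [r1 r2 r3] := expR_sub1_le sg12.
rewrite -/rho in r1 r2 r3.
have rho0 : 0 < rho by exact: expR_gt0.
have sg2 : sg ^+ 2 <= 9 * b ^- 2.
  rewrite wE -[sg ^+ 2]real_normK ?num_real// (_ : 9 * _ = (3 * b^-1) ^+ 2); last by ring.
  by rewrite lerXn2r ?nnegrE// mulr_ge0// ltW.
have rA : `|rho - 1 - (12 * b)^-1| <= 20 * b ^- 2.
  have -> : rho - 1 - (12 * b)^-1 = (rho - 1 - sg) + th by rewrite /sg; ring.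
  apply: le_trans (ler_normD _ _) _; move: hth; lra.
have rB : `|rho - 1| <= 6 * b^-1 by lra.
have uK : cmod (BT1 (cofR a) (uB xi)) <= KT.
  by apply: hKT; rewrite /uB cmodV lef_pV2 ?posrE.
apply: le_trans (cmodD _ _) _; rewrite [leRHS]mulrDl; apply: lerD.
  rewrite cmodM cmodM cmodV cmod_cofR (gtr0_norm rho0).
  have i1 : (cmod (QB a xi))^-1 <= c0^-1.
    by rewrite lef_pV2 ?posrE//; exact: lt_le_trans hQ.
  have i0 : 0 <= (cmod (QB a xi))^-1 by rewrite invr_ge0 cmod_ge0.
  have h1 : cmod (eB a b xi) <= `|M1| * b ^- 2.
    by apply: le_trans (hM1 b hb1 xi Kxi) _; rewrite ler_wpM2r// ler_norm.
  have h2 := ler_pM (ltW rho0) (cmod_ge0 _) r3 h1.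
  have h3 := ler_pM (mulr_ge0 (ltW rho0) (cmod_ge0 (eB a b xi))) i0 h2 i1.
  apply: le_trans h3 _; rewrite le_eqVlt; apply/orP; left; apply/eqP; ring.
(* The bracket S is 1 + 1 / (12 b) + BT1 / b, while rho qB is rho (1 + BT1 / b); only the Stirling
   remainder and the product of two O(1 / b) terms survive. *)
have SE : cofR rho * qB a b (uB xi) - S =
    cofR (rho - 1 - (12 * b)^-1) + cofR ((rho - 1) * b^-1) * BT1 (cofR a) (uB xi).
  rewrite /qB /Bq /S /BT1 /uB !invfM !(rmorphB, rmorphM, rmorph1, fmorphV, rmorph_nat) /=.
  have B0 : cofR b != 0 by rewrite cofR_eq0 gt_eqF.
  by move: (cofR rho) (cofR a) (cofR b) B0 => r A B B0; field; rewrite B0 xi10.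
rewrite SE; apply: le_trans (cmodD _ _) _; rewrite [leRHS]mulrDl; apply: lerD.
  by rewrite cmod_cofR.
rewrite cmodM cmod_cofR normrM (gtr0_norm bi0).
have h1 := ler_wpM2r (ltW bi0) rB.
have h2 := ler_pM (mulr_ge0 (normr_ge0 _) (ltW bi0)) (cmod_ge0 _) h1 uK.
by apply: le_trans h2 _; rewrite le_eqVlt wE; apply/orP; left; apply/eqP; ring.
Qed.

End UniformB.

Theorem theoremB1 (R : realType) (a : R) (ha : 0 < a) :
  (* (a) uniformly on compact subsets of A *)
  (forall K : set (Cplx R), compact K -> K `<=` @regA R ->
   exists (M b0 : R), forall b : R, b0 <= b -> forall xi : Cplx R, K xi ->
     let w := xi / (1 - xi) in
     let P := cpow (1 - xi) (cofR (- a)) in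
     let S := 1 - cofR (a * (a + 1) / 2) * w ^+ 2 * cofR (b^-1)
              + (cofR (a * (a + 1) * (a + 2) * (a + 3) / 8) * w ^+ 4
                 + cofR (2 * a * (a + 1) * (a + 2) / 3) * w ^+ 3
                 + cofR (a * (a + 1) / 2) * w ^+ 2) * cofR (b ^- 2) in
     `|F11 a b (cofR b * xi) - P * S| <= cofR (M * b ^- 3) * `|P|) /\
  (* (b) uniformly on compact subsets of B *)
  (forall K : set (Cplx R), compact K -> K `<=` @regB R ->
   exists (M b0 : R), forall b : R, b0 <= b -> forall xi : Cplx R, K xi ->
     let E := cexp (cofR b * (xi - 1 - clog xi)) * cofR (b `^ (a - 2^-1))
              * cofR (Num.sqrt (2 * pi) / Gamma a)
              * xi * cpow (xi - 1) (cofR (a - 1)) in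
     let S := 1 + cofR ((12 * b)^-1)
                  * (1 + cofR (12 * a * (a - 1)) / (xi - 1)
                       + cofR (6 * (a - 1) * (a - 2)) / (xi - 1) ^+ 2) in
     `|F11 a b (cofR b * xi) - E * S| <= cofR (M * b ^- 2) * `|E|).
Proof.
split => K cK; first exact: theorem_partA.
exact: theorem_partB.
Qed.
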